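(* Let $\{f_j^\lambda\}_{j\in\mathcal{A}}$, $\lambda\in\overline{U}$, be a parametrized IFS on $X$ satisfying the smoothness assumptions (A1)–(A4) and the transversality condition (T) on $U$. Let $\{\mu_\lambda\}_{\lambda\in\overline{U}}$ be a collection of nonzero finite ergodic shift-invariant Borel measures on $\Omega$ satisfying (M0), such that $h_{\mu_\lambda}$ and $\chi_{\mu_\lambda}$ are continuous in $\lambda$. Then the equality $$\dim_H\big((\Pi^\lambda)_*\mu_\lambda\big)=\min\left\{1,\frac{h_{\mu_\lambda}}{\chi_{\mu_\lambda}}\right\}$$ holds for Lebesgue almost every $\lambda\in U$.
   Context: Let $\mathcal{A}=\{1,\dots,m\}$, let $U\subset\mathbb{R}$ be a bounded open interval with closure $\overline{U}$, let $X\subset\mathbb{R}$ be a compact interval with $\operatorname{diam}(X)=1$, and for each $\lambda\in\overline{U}$ let $f_j^\lambda:X\to X$, $j\in\mathcal{A}$ (a parametrized iterated function system, IFS). The smoothness assumptions, for some fixed $\delta\in(0,1]$, are: (A1) the maps $f_j^\lambda$ are $C^{2+\delta}$ on $X$ with $M_1=\sup_{\lambda\in U}\sup_{j}\|\frac{d^2}{dx^2}f_j^\lambda\|_\infty<\infty$ and there are $C_1,C_2>0$ with $|\frac{d^2}{dx^2}f_j^\lambda(x)-\frac{d^2}{dx^2}f_j^\lambda(y)|\le C_1|x-y|^\delta$ and $|\frac{d^2}{dx^2}f_j^{\lambda_1}(x)-\frac{d^2}{dx^2}f_j^{\lambda_2}(x)|\le C_2|\lambda_1-\lambda_2|^\delta$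 for all $x,y\in X$, $j\in\mathcal{A}$, $\lambda,\lambda_1,\lambda_2\in U$; (A2) the maps $\lambda\mapsto f_j^\lambda(x)$ are $C^{1+\delta}$ on $U$ and there is $C_3>0$ with $|\frac{d}{d\lambda}f_j^{\lambda_1}(x)-\frac{d}{d\lambda}f_j^{\lambda_2}(x)|\le C_3|\lambda_1-\lambda_2|^\delta$ for all $x\in X$, $j\in\mathcal{A}$, $\lambda_1,\lambda_2\in U$; (A3) the second partial derivatives $\frac{d^2}{dx\,d\lambda}f_j^\lambda(x)$, $\frac{d^2}{d\lambda\,dx}f_j^\lambda(x)$ exist and are continuous on $U\times X$ (hence equal), with $M_2=\sup_j\sup_{\lambda\in U}\|\frac{d^2}{d\lambda\,dx}f_j^\lambda\|_\infty<\infty$, and there are $C_4,C_5>0$ with $|\frac{d^2}{dx\,d\lambda}f_j^{\lambda}(x)-\frac{d^2}{dx\,d\lambda}f_j^{\lambda}(y)|\le C_4|x-y|^\delta$ and $|\frac{d^2}{dx\,d\lambda}f_j^{\lambda_1}(x)-\frac{d^2}{dx\,d\lambda}f_j^{\lambda_2}(x)|\le C_5|\lambda_1-\lambda_2|^\delta$ for all $x,y\in X$, $j\in\mathcal{A}$, $\lambda,\lambda_1,\lambda_2\in U$; (A4) there are $\gamma_1,\gamma_2>0$ with $0<\gamma_1\le|\frac{d}{dx}f_j^\lambda(x)|\le\gamma_2<1$ for all $j\in\mathcal{A}$, $x\in X$, $\lambda\in\overline{U}$. Let $\Omega=\mathcal{A}^{\mathbb{N}}$ with left shift $\sigma$, and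 $\Omega^*=\bigcup_{n\ge0}\mathcal{A}^n$ the set of finite words; $|u|$ is the length of $u$, $f_u^\lambda=f_{u_1}^\lambda\circ\cdots\circ f_{u_n}^\lambda$ for $u=(u_1,\dots,u_n)$, and $[u]=\{\omega\in\Omega:\omega|_{|u|}=u\}$. The natural projection is $\Pi^\lambda(\omega)=\lim_{n\to\infty}f^\lambda_{\omega_1\ldots\omega_n}(x_0)$ (independent of $x_0\in X$). (T) There exists $\eta>0$ such that for all $\lambda\in U$ and all $u,v\in\Omega$ with $u_1\ne v_1$: $|\Pi^\lambda(u)-\Pi^\lambda(v)|<\eta$ implies $|\frac{d}{d\lambda}(\Pi^\lambda(u)-\Pi^\lambda(v))|\ge\eta$. (M0) For every $\lambda_0\in\overline{U}$ and every $\varepsilon>0$ there are $C,\xi>0$ such that $C^{-1}e^{-\varepsilon|\omega|}\mu_{\lambda_0}([\omega])\le\mu_\lambda([\omega])\le Ce^{\varepsilon|\omega|}\mu_{\lambda_0}([\omega])$ for every $\omega\in\Omega^*$ with $|\omega|\ge1$ and every $\lambda\in\overline{U}$ with $|\lambda-\lambda_0|<\xi$. Entropy: $h_{\mu_\lambda}=-\lim_{n\to\infty}\frac1n\sum_{\omega\in\mathcal{A}^n}\mu_\lambda([\omega])\log\mu_\lambda([\omega])$. Lyapunov exponent: $\chi_{\mu_\lambda}=-\int_\Omega\log|(f^\lambda_{\omega_1})'(\Pi^\lambda(\sigma\omega))|\,d\mu_\lambda(\omega)$. For a finite Borel measure $\nu$ on $\mathbb{R}$, $\dim_H(\nu)=\inf\{\dim_H(A):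 A \text{ Borel},\ \nu(\mathbb{R}\setminus A)=0\}$. *)

(* Defs.v *)
From HB Require Import structures.
From mathcomp Require Import all_boot all_order all_algebra.
From mathcomp Require Import all_classical all_reals all_analysis.

Set Implicit Arguments.
Unset Strict Implicit.
Unset Printing Implicit Defensive.

Import Order.TTheory GRing.Theory Num.Theory.
Import numFieldNormedType.Exports.

Local Open Scope classical_set_scope.
Local Open Scope ring_scope.

Section hausdorff.
Context {R : realType}.
Local Open Scope ereal_scope.

(* The diameter of the empty set is [-oo], the supremum of the empty set;
   [diam_pow] is 0 there for every exponent, including [s = 0]. *)
Definition diam (E : set R) : \bar R :=
  ereal_sup [set d | exists x y, [/\ E x, E y & d = `|x - y|%:E]].

Definition diam_pow (s : R) (E : set R) : \bar R :=
  if E == set0 then 0 else poweR (diam E) s.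

Definition hausdorff_content (s r : R) (A : set R) : \bar R :=
  ereal_inf [set \sum_(0 <= i <oo) diam_pow s (E i) |
    E in [set E : nat -> set R |
      A `<=` \bigcup_i E i /\ forall i, diam (E i) <= r%:E]].

Definition hausdorff_measure (s : R) (A : set R) : \bar R :=
  ereal_sup [set hausdorff_content s r A | r in [set r : R | (0 < r)%R]].

Definition hausdorff_dim (A : set R) : \bar R :=
  ereal_inf [set s%:E | s in [set s : R |
    (0 <= s)%R /\ hausdorff_measure s A = 0]].

Definition measure_hausdorff_dim (nu : set R -> \bar R) : \bar R :=
  ereal_inf [set hausdorff_dim A |
    A in [set A : set R | measurable A /\ nu (~` A) = 0]].

End hausdorff.

Section smoothness.
Context {R : realType}.
Implicit Types (D : set R) (g : R -> R).

(* Derivatives relative to [D]: for [D] a compact interval these are the usual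
   derivatives inside [D] and the one-sided ones at the endpoints. *)
Definition difference_quotient g (x y : R) : R := (g y - g x) / (y - x).

Definition derivable_within D g (x : R) : Prop :=
  cvg (difference_quotient g x y @[y --> within D x^']).

Definition derive_within D g (x : R) : R :=
  lim (difference_quotient g x y @[y --> within D x^']).

Definition holder_on D (delta : R) g : Prop :=
  exists2 C : R, 0 < C &
    forall x y, D x -> D y -> `|g x - g y| <= C * `|x - y| `^ delta.

Definition C2_holder D (delta : R) g : Prop :=
  [/\ forall x, D x -> derivable_within D g x,
      forall x, D x -> derivable_within D (derive_within D g) x
    & holder_on D delta (derive_within D (derive_within D g))].

End smoothness.

(* The alphabet is ['I_m.+1], i.e. it has [m.+1 >= 1] letters. [Omega m] is
   [seq_space m], the infinite sequences of letters with the product of the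
   discrete topologies, together with its Borel sigma-algebra. *)
Definition seq_space (m : nat) :=
  prod_topology (fun _ : nat => discrete_topology 'I_m.+1).

HB.instance Definition _ m := Topological.on (seq_space m).
HB.instance Definition _ m := isPointed.Build (seq_space m) (fun=> ord0).

Definition Omega (m : nat) := g_sigma_algebraType (@open (seq_space m)).

Section symbolic.
Context {m : nat}.

Definition letter (w : Omega m) (n : nat) : 'I_m.+1 := w n.

Definition shift (w : Omega m) : Omega m := fun n => letter w n.+1.

Definition trunc_word (w : Omega m) (n : nat) : seq 'I_m.+1 :=
  mkseq (letter w) n.

Definition cylinder (u : seq 'I_m.+1) : set (Omega m) :=
  [set w | trunc_word w (size u) = u].

Context {R : realType}.
Local Open Scope ereal_scope.

Definition shift_invariant (mu : set (Omega m) -> \bar R) : Prop :=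
  forall B, measurable B -> mu (shift @^-1` B) = mu B.

Definition ergodic (mu : set (Omega m) -> \bar R) : Prop :=
  forall B, measurable B -> shift @^-1` B = B -> mu B = 0 \/ mu (~` B) = 0.

(* The convention [0 * log 0 = 0] is automatic since [ln 0 = 0]. *)
Definition entropy (mu : set (Omega m) -> \bar R) : R :=
  (- lim ((n%:R^-1 * \sum_(u : n.-tuple 'I_m.+1)
       fine (mu (cylinder u)) * ln (fine (mu (cylinder u)))) @[n --> \oo]))%R.

End symbolic.

Section ifs.
Context {R : realType} {m : nat}.
(* [f l j x] is the value at [x] of the [j]-th map for the parameter [l];
   only the values for [l] in the closure of [U] and [x] in [X] matter. *)
Implicit Types (f : R -> 'I_m.+1 -> R -> R) (X U : set R).

Definition is_ifs f X U : Prop :=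
  forall l j x, closure U l -> X x -> X (f l j x).

Definition d_x f X (l : R) j : R -> R := derive_within X (f l j).

Definition d_xx f X (l : R) j : R -> R := derive_within X (d_x f X l j).

Definition d_l f (l : R) j (x : R) : R := derive1 (fun l' => f l' j x) l.

Definition d_xl f X (l : R) j : R -> R := derive_within X (d_l f l j).

Definition d_lx f X (l : R) j (x : R) : R := derive1 (fun l' => d_x f X l' j x) l.

Definition assumption_A1 f X U (delta : R) : Prop :=
  [/\ forall l j, closure U l -> C2_holder X delta (f l j),
      exists M1 : R, forall l j x, U l -> X x -> `|d_xx f X l j x| <= M1,
      exists2 C1 : R, 0 < C1 & forall l j x y, U l -> X x -> X y ->
        `|d_xx f X l j x - d_xx f X l j y| <= C1 * `|x - y| `^ delta
    & exists2 C2 : R, 0 < C2 & forall l1 l2 j x, U l1 -> U l2 -> X x ->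
        `|d_xx f X l1 j x - d_xx f X l2 j x| <= C2 * `|l1 - l2| `^ delta].

Definition assumption_A2 f X U (delta : R) : Prop :=
  (forall l j x, U l -> X x -> derivable (fun l' => f l' j x) l 1) /\
  exists2 C3 : R, 0 < C3 & forall l1 l2 j x, U l1 -> U l2 -> X x ->
    `|d_l f l1 j x - d_l f l2 j x| <= C3 * `|l1 - l2| `^ delta.

Definition assumption_A3 f X U (delta : R) : Prop :=
  [/\ forall l j x, U l -> X x ->
        derivable_within X (d_l f l j) x /\
        derivable (fun l' => d_x f X l' j x) l 1,
      forall j,
        {within U `*` X, continuous (fun p : R * R => d_xl f X p.1 j p.2)} /\
        {within U `*` X, continuous (fun p : R * R => d_lx f X p.1 j p.2)},
      exists M2 : R, forall l j x, U l -> X x -> `|d_lx f X l j x| <= M2,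
      exists2 C4 : R, 0 < C4 & forall l j x y, U l -> X x -> X y ->
        `|d_xl f X l j x - d_xl f X l j y| <= C4 * `|x - y| `^ delta
    & exists2 C5 : R, 0 < C5 & forall l1 l2 j x, U l1 -> U l2 -> X x ->
        `|d_xl f X l1 j x - d_xl f X l2 j x| <= C5 * `|l1 - l2| `^ delta].

Definition assumption_A4 f X U : Prop :=
  exists gamma1 gamma2 : R, [/\ 0 < gamma1, gamma2 < 1 &
    forall l j x, closure U l -> X x ->
      gamma1 <= `|d_x f X l j x| <= gamma2].

Definition f_word f (l : R) (u : seq 'I_m.+1) (x : R) : R :=
  foldr (fun j y => f l j y) x u.

(* The base point [x0] is any point of [X]: the limit does not depend on it. *)
Definition natural_projection f (x0 l : R) (w : Omega m) : R :=
  lim (f_word f l (trunc_word w n) x0 @[n --> \oo]).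

Definition transversality f (x0 : R) U : Prop :=
  exists2 eta : R, 0 < eta & forall l (u v : Omega m), U l ->
    letter u 0 <> letter v 0 ->
    `|natural_projection f x0 l u - natural_projection f x0 l v| < eta ->
    eta <= `|derive1 (fun l' => natural_projection f x0 l' u -
                                natural_projection f x0 l' v) l|.

Definition lyapunov f X (x0 l : R)
    (mu : {measure set (Omega m) -> \bar R}) : R :=
  - \int[mu]_(w in setT)
      ln `|d_x f X l (letter w 0) (natural_projection f x0 l (shift w))|.

Definition condition_M0 U (mu : R -> set (Omega m) -> \bar R) : Prop :=
  forall l0 eps : R, closure U l0 -> 0 < eps ->
  exists C xi : R, [/\ 0 < C, 0 < xi &
    forall (w : seq 'I_m.+1) (l : R), (1 <= size w)%N -> closure U l ->
      `|l - l0| < xi ->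
      ((C^-1 * expR (- eps * (size w)%:R))%:E * mu l0 (cylinder w)
         <= mu l (cylinder w))%E /\
      (mu l (cylinder w)
         <= (C * expR (eps * (size w)%:R))%:E * mu l0 (cylinder w))%E].

End ifs.

(* Main.v *)
Require Import Defs.
From HB Require Import structures.
From mathcomp Require Import all_boot all_order all_algebra.
From mathcomp Require Import all_classical all_reals all_analysis.
From mathcomp Require Import measurable_realfun ring lra zify.

(** Dividing mu_l by its mass gives a probability P_l with the same null sets,
    hence the same dimension of its projection.  Entropy and Lyapunov exponent
    of mu_l are those of P_l multiplied by the mass, so their ratio h/chi is
    that of P_l and remains continuous in l, and (M0) survives up to the
    constant.  Everything is therefore proved for the P_l.

    Ergodic input.  Two almost sure statements about a single ergodic measure
    are enough: Birkhoff sums of a bounded function do not exceed n (mean + e)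
    for large n ([birkhoff_ub]), and the cylinder of length n around a point
    has probability at most e^(-n (h - e)) for all large n, and at least
    e^(-n (h + e)) for infinitely many n ([cylinder_ub], [cylinder_lb]).  Both
    are proved by tiling.  An event that occurs for infinitely many n with
    positive probability occurs, after an arbitrarily small loss in the
    exponent, from almost every starting point ([ergodic_hits]); up to an
    exceptional set of small measure the orbit can then be cut into blocks of
    bounded length on which the event holds, and adding up over the blocks
    gives a bound for the mean, or for the entropy of long blocks.  The
    existence of the limit that defines h comes out of the same argument
    ([entropy_exists]).

    Geometry.  The maps are uniformly contracting with derivatives that are
    Lipschitz in the point and in the parameter.  So the derivative of f_u does
    not vary by more than a constant factor over the interval, varies by at
    most e^(drift |l - l'| |u|) between parameters ([deriv_word_ratio]), and
    its logarithm along an orbit is minus a Birkhoff sum whose mean is chi.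

    Upper bound, for every parameter.  Infinitely often the prefix u of length
    n of a typical point has probability at least e^(-n (h + e)), and for
    large n the image of f_u has diameter about e^(-n (chi - e)) at most.
    There are at most e^(n (h + e)) such words u, so these images are an
    efficient cover by the lim sup of small balls ([hausdorff_limsup_null]).

    Lower bound, almost surely near a parameter l0.  Call a word good if all
    its long prefixes w satisfy P_l0[w] <= |f_w'|^gam, with the derivative
    taken at l0.  For gam < h/chi, (M0) and the continuity of h/chi make the
    prefixes of P_l-typical points good for all l near l0, although goodness
    does not depend on l ([good_word_ae]).  If two words split after the prefix
    w, then by transversality their projections are rho-close only for
    parameters in an interval of length O(rho / |f_w'|), up to drift
    ([close_params_prefix]).  Summing over w, the P_l0 x P_l0-mass of pairs of
    good words of length proportional to k that project 2^-k-close has an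
    average over l of order k 2^(-k be) for be < gam < 1 ([energy_bound]), so
    by Borel-Cantelli it is small for almost every l and all large k.  By (M0)
    the same holds for P_l x P_l at the cost of an arbitrarily small
    exponential factor.  Deleting the few words which are close to too many
    others leaves a set of positive P_l-measure that satisfies a Frostman
    condition, and the mass distribution principle concludes ([local_dim],
    [hausdorff_dim_ge]).  A countable cover by such neighbourhoods
    ([ae_of_local]) and a countable set of precisions e finish the proof. *)

Set Implicit Arguments.
Unset Strict Implicit.
Unset Printing Implicit Defensive.

Import Order.TTheory GRing.Theory Num.Theory.
Import numFieldNormedType.Exports.

Local Open Scope classical_set_scope.
Local Open Scope ring_scope.

Local Notation sft := (@Defs.shift _).

(** * Symbolic space *)

Lemma continuous_shift0 (K : topologicalType) (w : {ptws nat -> K}) :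
  {ptws, ((fun (v : {ptws nat -> K}) n => v n.+1) @ w) --> (fun n => w n.+1)}.
Proof.
apply: (proj2 (@cvg_sup _ _ _ _ _ _)) => i.
apply/cvg_image; first by rewrite eqEsubset; split=> v // _; exists (fun=> v).
move=> W /= Wn; exists ((fun v : {ptws nat -> K} => v i) @^-1` W).
  by apply: (@proj_continuous nat (fun=> K) i.+1 w).
by rewrite eqEsubset; split => [j [? + <-//]|j Wj]; exists (fun=> j).
Qed.

Lemma continuous_shift m :
  continuous (@Defs.shift m : seq_space m -> seq_space m).
Proof.
move=> w; exact: (@continuous_shift0 (discrete_topology 'I_m.+1) w).
Qed.

Section words.
Context {m : nat}.
Implicit Types (w : Omega m) (u : seq 'I_m.+1).

Lemma measurable_shift : measurable_fun setT (@Defs.shift m : Omega m -> Omega m).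
Proof.
apply: (@measurability _ _ (Omega m) (Omega m) setT sft (@open (seq_space m))) => //.
move=> _ [B oB <-]; rewrite setTI; apply: sub_sigma_algebra => /=.
by move: (@continuous_shift m) => /continuousP; apply.
Qed.

Lemma open_cylinder u : @open (seq_space m) (cylinder u).
Proof.
pose F i := (fun v : seq_space m => v i) @^-1` [set nth ord0 u i].
have -> : cylinder u = \big[setI/setT]_(i < size u) F i.
  rewrite -bigcap_mkord; apply/seteqP; split => w.
  - by move=> /= wu i /= isz; rewrite /F /= -wu nth_mkseq.
  - move=> /= H; apply: (@eq_from_nth _ ord0); rewrite ?size_mkseq // => i isz.
    by rewrite nth_mkseq //; exact: H.
elim/big_ind : _ => [|A B oA oB|i _]; [exact: openT|exact: openI|].
apply: open_comp => [v _|].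
  exact: (@proj_continuous nat (fun=> discrete_topology 'I_m.+1) i v).
exact: discrete_open.
Qed.

Lemma measurable_cylinder u : measurable (cylinder u : set (Omega m)).
Proof. by apply: sub_sigma_algebra; exact: open_cylinder. Qed.

Lemma size_trunc w n : size (trunc_word w n) = n.
Proof. by rewrite size_mkseq. Qed.

Lemma cylinder_trunc w n : cylinder (trunc_word w n) w.
Proof. by rewrite /cylinder /= size_trunc. Qed.

(** There are finitely many words of length n and cylinders are open, so every
    function of the first n letters is measurable. *)
Lemma measurable_trunc n (Q : set (seq 'I_m.+1)) :
  measurable [set w : Omega m | Q (trunc_word w n)].
Proof.
have -> : [set w : Omega m | Q (trunc_word w n)] =
   \bigcup_(t in [set t : n.-tuple 'I_m.+1 | Q t]) (cylinder t : set (Omega m)).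
  apply/seteqP; split => w /=.
  - move=> Qw; have sz : size (trunc_word w n) == n by rewrite size_trunc.
    by exists (Tuple sz) => //=; exact: cylinder_trunc.
  - by case=> t /= Qt; rewrite /cylinder /= size_tuple => ->.
apply: fin_bigcup_measurable => [|t _]; last exact: measurable_cylinder.
exact: finite_finset.
Qed.

Lemma measurable_fun_trunc d (Y : measurableType d) n (g : seq 'I_m.+1 -> Y) :
  measurable_fun setT (fun w : Omega m => g (trunc_word w n)).
Proof.
move=> _ B mB; rewrite setTI.
exact: (@measurable_trunc n [set u | B (g u)]).
Qed.
End words.

(** * Lim sup sets and bounded functions on a probability space *)

Lemma lim_supP (T : Type) (F : (set T)^nat) (w : T) : lim_sup_set F w <->
  forall N, exists2 n, (N <= n)%N & F n w.
Proof.
split=> [h N|h N _]; first by have [n ? ?] := h N I; exists n.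
by have [n ? ?] := h N; exists n.
Qed.

Section expectation.
Context {d : measure_display} {T : measurableType d} {R : realType}.
Variable P : probability T R.
Local Notation E f := (\int[P]_(w in setT) f w).

Lemma bounded_integrable (f : T -> R) (B : R) : measurable_fun setT f ->
  (forall w, `|f w| <= B) -> P.-integrable setT (EFin \o f).
Proof.
move=> mf fB; apply: measurable_bounded_integrable => //.
  by rewrite (le_lt_trans (probability_le1 P _)) // ltry.
exists B; split; first by rewrite num_real.
by move=> M BM w _ /=; rewrite (le_trans (fB w)) // ltW.
Qed.

Lemma measurable_ge (f : T -> R) (c : R) : measurable_fun setT f ->
  measurable [set w | c <= f w].
Proof.
move=> mf; have -> : [set w | c <= f w] = setT `&` f @^-1` `[c, +oo[%classic.
  by apply/seteqP; split => w /=; rewrite in_itv /= andbT => // -[].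
exact: mf.
Qed.

Lemma mean_indic (A : set T) : measurable A -> E (\1_A) = fine (P A).
Proof.
by move=> mA; rewrite /Rintegral integral_indic // setIT.
Qed.

Lemma indic_integrable (A : set T) : measurable A ->
  P.-integrable setT (EFin \o (\1_A : T -> R)).
Proof.
by move=> mA; exact: integrable_indic.
Qed.

Lemma mean_cst (r : R) : E (fun=> r) = r.
Proof.
by rewrite Rintegral_cst //= probability_setT /= mulr1.
Qed.

Lemma fine_prob_le (A B : set T) : measurable A -> measurable B ->
  A `<=` B -> fine (P A) <= fine (P B).
Proof.
by move=> mA mB AB; rewrite fine_le ?fin_num_measure // le_measure ?inE.
Qed.

Lemma fine_prob_ge0 (A : set T) : 0 <= fine (P A).
Proof. by rewrite fine_ge0. Qed.

(** Continuity from above along the tails of the lim sup: the device by which an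
    almost sure event that happens at some unspecified time is turned into one
    that happens before a fixed time, up to small probability. *)
Lemma lim_sup_tail (F : (set T)^nat) (e : R) : (forall k, measurable (F k)) ->
  P (lim_sup_set F) = 0%E -> 0 < e ->
  exists n, fine (P (\bigcup_(k >= n) F k)) < e.
Proof.
move=> mF F0 e0.
have mU n : measurable (\bigcup_(k >= n) F k) by exact: bigcup_measurable.
have h : P (\bigcup_(k >= n) F k) @[n --> \oo] --> P (lim_sup_set F).
  apply: lim_sup_set_cvg => //.
  by rewrite (le_lt_trans (probability_le1 P _)) ?ltry.
move: h; rewrite F0 => /fine_cvgP[_ /cvgrPdist_lt /(_ e e0)] [n _ /(_ n (leqnn _))] /=.
by rewrite sub0r normrN ger0_norm ?fine_prob_ge0 //; exists n.
Qed.

(** Fatou for sets: every tail union has probability at least c, and these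
    unions decrease to the lim sup. *)
Lemma lim_sup_ge (F : (set T)^nat) (c : \bar R) : (forall k, measurable (F k)) ->
  (forall k, c <= P (F k))%E -> (c <= P (lim_sup_set F))%E.
Proof.
move=> mF cF.
have mU n : measurable (\bigcup_(k >= n) F k) by exact: bigcup_measurable.
have h : P (\bigcup_(k >= n) F k) @[n --> \oo] --> P (lim_sup_set F).
  apply: lim_sup_set_cvg => //.
  by rewrite (le_lt_trans (probability_le1 P _)) ?ltry.
rewrite -(cvg_lim _ h) //; apply: lime_ge; first by apply/cvg_ex; eexists; exact: h.
apply: nearW => n; rewrite (le_trans (cF n)) // le_measure ?inE //.
by move=> w; exists n => /=.
Qed.

Lemma measurable_lim_sup (F : (set T)^nat) : (forall k, measurable (F k)) ->
  measurable (lim_sup_set F).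
Proof.
move=> mF; apply: bigcap_measurable => // k _.
exact: bigcup_measurable.
Qed.

End expectation.

(** * Ergodic theory of the shift *)

Section ergodic_theory.
Context {R : realType} {m : nat} (P : probability (Omega m) R).
Hypotheses (Pinv : shift_invariant P) (Perg : ergodic P).
Local Notation E f := (\int[P]_(w in setT) f w).

Lemma measurable_iter_shift k :
  measurable_fun setT (iter k sft : Omega m -> Omega m).
Proof.
elim: k => [|k IH]; first exact: measurable_id.
exact: measurableT_comp measurable_shift IH.
Qed.

Lemma measurable_preimage_iter k (A : set (Omega m)) : measurable A ->
  measurable (iter k sft @^-1` A : set (Omega m)).
Proof.
move=> mA; rewrite -[_ @^-1` _]setTI; exact: measurable_iter_shift.
Qed.

Lemma prob_preimage_iter k (A : set (Omega m)) : measurable A ->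
  P (iter k sft @^-1` A) = P A.
Proof.
move=> mA; elim: k => [//|k <-].
have -> : iter k.+1 sft @^-1` A = sft @^-1` (iter k sft @^-1` A).
  by apply/seteqP; split => w; rewrite /preimage /= -iterSr.
by rewrite Pinv //; exact: measurable_preimage_iter.
Qed.

(** The set of points whose orbit meets A infinitely often is strictly invariant,
    and its probability is at least that of A, because it is the lim sup of the
    preimages of A.  Ergodicity makes it full, and every point of it lies in A'. *)
Lemma ergodic_hits (A A' : set (Omega m)) : measurable A -> measurable A' ->
  (forall k w, A (iter k sft w) -> A' w) -> P A <> 0%E -> P (~` A') = 0%E.
Proof.
move=> mA mA' AA' PA.
pose F k := iter k sft @^-1` A : set (Omega m).
have mF k : measurable (F k) by exact: measurable_preimage_iter.
have mV : measurable (lim_sup_set F) by exact: measurable_lim_sup.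
have VT : sft @^-1` (lim_sup_set F) = lim_sup_set F.
  apply/seteqP; split => w Vw n _.
  - have [k /= nk Fk] := Vw n I; exists k.+1; rewrite /= ?leqW //.
    by rewrite /F /preimage /= -iterS iterSr.
  - have [[//|k] /= nk Fk] := Vw n.+1 I; exists k => //.
    by rewrite /F /preimage /= -iterSr.
have PV : P (lim_sup_set F) <> 0%E.
  have : (P A <= P (lim_sup_set F))%E.
    by apply: lim_sup_ge => // k; rewrite /F prob_preimage_iter.
  by move=> PAV V0; apply: PA; apply/eqP; rewrite -measure_le0 -V0.
have [//|V0] := Perg mV VT.
apply/eqP; rewrite -measure_le0 -V0 le_measure ?inE //; try exact: measurableC.
by apply: subsetC => w /(_ 0%N I) [k _ /AA'].
Qed.

Lemma mean_shift (f : Omega m -> R) (B : R) : measurable_fun setT f ->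
  (forall w, `|f w| <= B) -> E (f \o sft) = E f.
Proof.
move=> mf fB; rewrite /Rintegral; congr fine.
have mfs : measurable_fun setT (f \o sft).
  exact: measurableT_comp mf measurable_shift.
have := @integral_pushforward _ _ _ _ R sft measurable_shift P setT (EFin \o f).
rewrite preimage_setT => <- //; last 2 first.
- exact/measurable_EFinP.
- exact: (@bounded_integrable _ _ _ P _ B mfs (fun w => fB _)).
apply: eq_measure_integral; first exact: measurable_shift.
by move=> ms A mA _; exact: Pinv.
Qed.

Definition birkhoff_sum (phi : Omega m -> R) n w := \sum_(i < n) phi (iter i sft w).

Lemma birkhoff_sumD (phi : Omega m -> R) n k w :
  birkhoff_sum phi (n + k) w = birkhoff_sum phi n w + birkhoff_sum phi k (iter n sft w).
Proof.
rewrite /birkhoff_sum big_split_ord /=; congr (_ + _).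
by apply: eq_bigr => i _; rewrite -iterD addnC.
Qed.

Lemma birkhoff_sumS (phi : Omega m -> R) n w : birkhoff_sum phi n.+1 w = phi w + birkhoff_sum phi n (sft w).
Proof. by rewrite -add1n birkhoff_sumD /birkhoff_sum big_ord1. Qed.

Lemma measurable_birkhoff_sum (phi : Omega m -> R) n : measurable_fun setT phi ->
  measurable_fun setT (birkhoff_sum phi n).
Proof.
move=> mphi; apply: measurable_sum => i.
exact: measurableT_comp mphi (measurable_iter_shift i).
Qed.

Lemma birkhoff_sum_bounded (phi : Omega m -> R) (B : R) n w : (forall w, `|phi w| <= B) ->
  `|birkhoff_sum phi n w| <= n%:R * B.
Proof.
move=> fB; rewrite (le_trans (ler_norm_sum _ _ _)) //.
rewrite (le_trans (ler_sum _ (fun i _ => fB _))) // sumr_const card_ord.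
by rewrite mulr_natl.
Qed.

Lemma mean_birkhoff_sum (phi : Omega m -> R) (B : R) n : measurable_fun setT phi ->
  (forall w, `|phi w| <= B) -> E (birkhoff_sum phi n) = n%:R * E phi.
Proof.
move=> mphi fB; elim: n => [|n IH].
  rewrite mul0r -[RHS](mean_cst P 0); apply: eq_Rintegral => w _.
  by rewrite /birkhoff_sum big_ord0.
transitivity (E (fun w => phi w + (birkhoff_sum phi n \o sft) w)).
  by apply: eq_Rintegral => w _; rewrite birkhoff_sumS.
have mS := @measurable_birkhoff_sum phi n mphi.
have bS w := @birkhoff_sum_bounded phi B n w fB.
rewrite RintegralD //; last 2 first.
- exact: bounded_integrable fB.
- apply: (@bounded_integrable _ _ _ P _ (n%:R * B)) => // [|w]; last exact: bS.
  exact: measurableT_comp mS measurable_shift.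
by rewrite (@mean_shift _ (n%:R * B)) // IH -natr1 mulrDl mul1r addrC.
Qed.

(** Cut the segment of length L greedily into blocks of length at most N with
    average at least q; only the last, incomplete block of fewer than N terms is
    lost, which costs N (|q| + B). *)
Lemma tiled_sum_ge (x : nat -> R) (q B : R) (N : nat) :
  (forall i, - B <= x i) -> 0 <= B ->
  (forall i, exists n, [/\ (0 < n)%N, (n <= N)%N &
     n%:R * q <= \sum_(k < n) x (i + k)%N]) ->
  forall L i, L%:R * q - N%:R * (`|q| + B) <= \sum_(k < L) x (i + k)%N.
Proof.
move=> xB B0 tile L; have [n nL] := ubnP L; elim: n L nL => // n IH L nL i.
have [k [k0 kN qk]] := tile i.
have [Lk|kL] := ltnP L k.
  have : L%:R * - B <= \sum_(j < L) x (i + j)%N.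
    rewrite mulr_natl -[X in _ *+ X]card_ord -sumr_const.
    exact: ler_sum.
  apply: le_trans.
  have LN : L%:R <= N%:R :> R by rewrite ler_nat ltnW // (leq_trans Lk).
  have h1 : L%:R * q <= N%:R * `|q|.
    apply: (@le_trans _ _ (L%:R * `|q|)); first by rewrite ler_wpM2l // ler_norm.
    by rewrite ler_wpM2r.
  have h2 : L%:R * B <= N%:R * B by rewrite ler_wpM2r.
  lra.
have {}IH := IH (L - k)%N _ (i + k)%N.
rewrite -(subnKC kL) natrD mulrDl big_split_ord /= .
under [X in _ <= _ + X]eq_bigr do rewrite addnA.
have : (L - k < n)%N by lia.
move/IH; lra.
Qed.

(** Let G N be the set where some block of length at most N has average at least
    q, and psi N equal phi on G N and the large constant |q| + B elsewhere.  Then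
    psi N has a good block at every point (a single step off G N), so its long
    Birkhoff sums are at least n q up to a constant and its mean is at least q.
    As N grows the complement of G N becomes null and the mean of psi N tends to
    that of phi. *)
Lemma birkhoff_tile (phi : Omega m -> R) (B q : R) : measurable_fun setT phi ->
  (forall w, `|phi w| <= B) ->
  P (~` [set w | exists2 n, (0 < n)%N & n%:R * q <= birkhoff_sum phi n w]) = 0%E ->
  q <= E phi.
Proof.
move=> mphi phiB Pq.
have B0 : 0 <= B by rewrite (le_trans (normr_ge0 (phi point))).
pose A n := [set w | n%:R * q <= birkhoff_sum phi n w].
have mA n : measurable (A n).
  by apply: measurable_ge; exact: measurable_birkhoff_sum.
pose G N := \bigcup_(n in [set n | (0 < n)%N /\ (n <= N)%N]) A n.
have mG N : measurable (G N) by apply: bigcup_measurable.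
(* large enough for the constant M to be a good block of length one, and for
   psi to dominate phi *)
pose M := B + `|q|.
have M0 : 0 <= M by rewrite addr_ge0.
pose psi N w := if w \in G N then phi w else M.
have psiE N : psi N = phi \_ (G N) \+ (cst M) \_ (~` G N).
  apply/funext => w; rewrite /psi /patch /= in_setC.
  by case: (w \in G N); rewrite ?addr0 ?add0r.
have mpsi N : measurable_fun setT (psi N).
  rewrite psiE; apply: measurable_funD.
    by apply/(measurable_restrictT _ (mG N)); exact: measurable_funTS.
  apply/(measurable_restrictT _ (measurableC (mG N))).
  exact: measurable_cst.
have psiM N w : `|psi N w| <= M.
  rewrite /psi /M; case: ifP => _; last by rewrite ger0_norm.
  by rewrite (le_trans (phiB w)) // lerDl.
have phipsi N w : phi w <= psi N w.
  rewrite /psi; case: ifP => // _; rewrite /M.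
  have := phiB w; rewrite ler_norml => /andP[_ h].
  by rewrite (le_trans h) // lerDl.
have tile N w i : exists n, [/\ (0 < n)%N, (n <= N.+1)%N &
     n%:R * q <= \sum_(k < n) psi N.+1 (iter (i + k) sft w)].
  have [] := boolP (iter i sft w \in G N.+1) => [|nG].
    rewrite inE => -[n /= [n0 nN] An]; exists n; split => //.
    rewrite (le_trans An) //; apply: ler_sum => k _.
    by rewrite addnC iterD.
  exists 1%N; split => //; rewrite big_ord1 addn0 /psi (negbTE nG) mul1r /M.
  by rewrite (le_trans (ler_norm _)) // lerDr.
(* the mean of psi is compared with q through Birkhoff sums of length L, which
   removes the boundary term of the tiling in the limit of large L *)
have Epsi N L : L%:R * q - N.+1%:R * (`|q| + M) <= L%:R * E (psi N.+1).
  rewrite -(mean_birkhoff_sum L (mpsi _) (psiM _)) -[leLHS](mean_cst P).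
  apply: le_Rintegral => //.
  - by apply: (@bounded_integrable _ _ _ P _
      (`|L%:R * q - N.+1%:R * (`|q| + M)|)) => //; exact: measurable_cst.
  - apply: (@bounded_integrable _ _ _ P _ (L%:R * M)).
      exact: measurable_birkhoff_sum.
    by move=> w; exact: birkhoff_sum_bounded.
  - move=> w _.
    apply: (@tiled_sum_ge (fun i => psi N.+1 (iter i sft w)) q M N.+1 _ _ _ L 0%N) => //.
    by move=> i; move: (psiM N.+1 (iter i sft w)); rewrite ler_norml => /andP[].
have qpsi N : q <= E (psi N.+1).
  apply/ler_addgt0Pl => e e0.
  have [L Le] : exists L : nat, N.+1%:R * (`|q| + M) / e < L.+1%:R.
    exists (Num.truncn (N.+1%:R * (`|q| + M) / e)).
    by rewrite truncnS_gt.
  have := Epsi N L.+1; rewrite ltr_pdivrMr // in Le.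
  have L0 : 0 < L.+1%:R :> R by [].
  move=> h; rewrite -(ler_pM2l L0); lra.
have psiphi N : E (psi N) <= E phi + 2 * M * fine (P (~` G N)).
  rewrite -mean_indic; last exact: measurableC.
  rewrite -RintegralZl //; last by apply: indic_integrable; exact: measurableC.
  rewrite -RintegralD //; last 2 first.
    exact: bounded_integrable phiB.
    apply: (@bounded_integrable _ _ _ P _ (2 * M)).
      apply: measurable_funM; first exact: measurable_cst.
      by apply: measurable_indic; exact: measurableC.
    move=> w; rewrite indicE normrM ger0_norm ?mulr_ge0 //.
    by rewrite ler_piMr ?mulr_ge0 //; case: (_ \in _); rewrite ?normr1 ?normr0.
  apply: le_Rintegral => //.
  - exact: bounded_integrable (psiM _).
  - apply: (@bounded_integrable _ _ _ P _ (B + 2 * M)).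
      apply: measurable_funD => //.
      apply: measurable_funM; first exact: measurable_cst.
      by apply: measurable_indic; exact: measurableC.
    move=> w; rewrite (le_trans (ler_normD _ _)) // lerD //.
    rewrite indicE normrM ger0_norm ?mulr_ge0 //.
    by rewrite ler_piMr ?mulr_ge0 //; case: (_ \in _); rewrite ?normr1 ?normr0.
  - move=> w _; rewrite /psi indicE in_setC.
    case: (w \in G N) => /=; first by rewrite mulr0 addr0.
    have := phiB w; rewrite ler_norml => /andP[h _].
    have := normr_ge0 q; rewrite mulr1 /M; lra.
apply/ler_addgt0Pl => e e0.
have e2 : 0 < e / (2 * M + 1) by rewrite divr_gt0 // ltr_wpDl // mulr_ge0.
have mCG k : measurable (~` G k.+1) by exact: measurableC.
have PG0 : P (lim_sup_set (fun k => ~` G k.+1)) = 0%E.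
  apply/eqP; rewrite -measure_le0 -Pq le_measure ?inE //.
  - exact: measurable_lim_sup.
  - apply: measurableC.
    have -> : [set w | exists2 n, (0 < n)%N & n%:R * q <= birkhoff_sum phi n w] =
      \bigcup_(n in [set n | (0 < n)%N]) A n by [].
    exact: bigcup_measurable.
  - move=> w Gw [n n0 An]; have [k /= nk] := Gw n I; apply.
    by exists n => //=; split => //; rewrite leqW.
have [k Pk] := lim_sup_tail mCG PG0 e2.
have PGk : fine (P (~` G k.+1)) < e / (2 * M + 1).
  rewrite (le_lt_trans _ Pk) // fine_prob_le //; first exact: bigcup_measurable.
  by move=> w Gw; exists k => /=.
have := qpsi k; have := psiphi k.+1.
rewrite ltr_pdivlMr in PGk; last by rewrite ltr_wpDl // mulr_ge0.
have := fine_prob_ge0 P (~` G k.+1).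
set p := fine _ in PGk *; move=> p0; nra.
Qed.

(** If the sums exceeded n q infinitely often with positive probability, then for
    a smaller q' > E phi almost every point would have some block with average
    at least q': the finitely many steps before the orbit enters the given set
    are absorbed in the loss from q to q'.  That contradicts [birkhoff_tile]. *)
Lemma birkhoff_ub (phi : Omega m -> R) (B q : R) : measurable_fun setT phi ->
  (forall w, `|phi w| <= B) -> E phi < q ->
  {ae P, forall w, exists N, forall n, (N <= n)%N -> birkhoff_sum phi n w <= n%:R * q}.
Proof.
move=> mphi phiB Eq.
have B0 : 0 <= B by rewrite (le_trans (normr_ge0 (phi point))).
pose A n := [set w | n%:R * q <= birkhoff_sum phi n w].
have mA n : measurable (A n).
  by apply: measurable_ge; exact: measurable_birkhoff_sum.
have mV : measurable (lim_sup_set A) by exact: measurable_lim_sup.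
have [q' /andP[Eq' qq']] : exists q', E phi < q' < q.
  by exists ((E phi + q) / 2); apply/andP; split; lra.
pose A' := [set w | exists2 n, (0 < n)%N & n%:R * q' <= birkhoff_sum phi n w].
have PV : P (lim_sup_set A) = 0%E.
  apply/eqP/negPn/negP => /eqP PV.
  have : P (~` A') = 0%E.
    apply: ergodic_hits PV => //.
      have -> : A' = \bigcup_(n in [set n | (0 < n)%N])
        [set w | n%:R * q' <= birkhoff_sum phi n w] by [].
      apply: bigcup_measurable => n _.
      by apply: measurable_ge; exact: measurable_birkhoff_sum.
    move=> k w Vw.
    (* n is so large that the k initial steps cost less than n (q - q') *)
    have [n /= nN An] := Vw (Num.truncn (k%:R * (B + `|q'|) / (q - q'))).+1 I.
    exists (k + n)%N; first by lia.
    rewrite birkhoff_sumD.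
    have h1 : k%:R * (B + `|q'|) <= n%:R * (q - q').
      rewrite -ler_pdivrMr ?subr_gt0 // ltW // (lt_le_trans (truncnS_gt _)) //.
      by rewrite ler_nat.
    have h2 := @birkhoff_sum_bounded phi B k w phiB.
    move: h2; rewrite ler_norml => /andP[h2 _].
    have h3 : k%:R * q' <= k%:R * `|q'| by rewrite ler_wpM2l // ler_norm.
    rewrite natrD mulrDl; move: An; rewrite /A /=; lra.
  by move/(birkhoff_tile mphi phiB); rewrite leNgt Eq'.
exists (lim_sup_set A); split => // w /= nw.
apply: contrapT => nV; apply: nw.
have [N nN] : exists N, ~ (\bigcup_(j in [set j | (N <= j)%N]) A j) w.
  by apply/existsNP => h; apply: nV => N _; exact: h.
exists N => n Nn; rewrite leNgt; apply/negP => h; apply: nN.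
by exists n => //; exact: ltW.
Qed.

End ergodic_theory.

(** * Words and sums over words *)

Section words_combinatorics.
Context {m : nat}.
Implicit Types (w : Omega m) (u v : seq 'I_m.+1).

Lemma letter_iter k n w : letter (iter k sft w) n = letter w (k + n).
Proof. by elim: k n => [//|k IH] n; rewrite iterS /= {1}/Defs.shift /letter -/(letter _ _) IH addnS. Qed.

Lemma trunc_cat k n w :
  trunc_word w (k + n) = trunc_word w k ++ trunc_word (iter k sft w) n.
Proof.
rewrite /trunc_word /mkseq iotaD map_cat; congr (_ ++ _).
rewrite add0n -[k in LHS]addn0 iotaDl -map_comp; apply: eq_map => i /=.
by rewrite letter_iter.
Qed.

Lemma cylinder_cat u v :
  cylinder (u ++ v) = cylinder u `&` (iter (size u) sft @^-1` cylinder v).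
Proof.
apply/seteqP; split => w; rewrite /cylinder /preimage /= size_cat trunc_cat.
  by move/eqP; rewrite eqseq_cat ?size_trunc // => /andP[/eqP ? /eqP ?].
by move=> [-> ->].
Qed.

Lemma trunc1 w : trunc_word w 1 = [:: letter w 0].
Proof. by []. Qed.

Lemma truncS w n : trunc_word w n.+1 = letter w 0 :: trunc_word (sft w) n.
Proof. exact: (trunc_cat 1 n w). Qed.

(** Finite words are turned into points of the symbolic space, so that the
    natural projection, and transversality with it, applies to them. *)
Definition pad_word u : Omega m := fun i => nth ord0 u i.

Lemma trunc_pad_word u : trunc_word (pad_word u) (size u) = u.
Proof.
apply: (@eq_from_nth _ ord0); first exact: size_trunc.
by move=> i; rewrite size_trunc => iu; rewrite nth_mkseq.
Qed.

Lemma trunc_take (w : Omega m) j n : (j <= n)%N ->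
  take j (trunc_word w n) = trunc_word w j.
Proof.
by move=> jn; rewrite -(subnKC jn) trunc_cat take_size_cat // size_trunc.
Qed.

Lemma iter_pad_word j u : iter j sft (pad_word u) = pad_word (drop j u).
Proof.
apply/funext => i; rewrite -[LHS]/(letter (iter j sft (pad_word u)) i) letter_iter.
by rewrite /letter /pad_word nth_drop.
Qed.

(** Two different words of the same length split after their longest common
    prefix; transversality is applied right after it. *)
Lemma first_difference u v : size u = size v -> u != v ->
  exists j, [/\ (j < size u)%N, take j u = take j v & nth ord0 u j <> nth ord0 v j].
Proof.
elim: u v => [|x u IH] [|y v] //= [] suv; rewrite eqseq_cons negb_and.
have [<- /= uv|xy _] := eqVneq x y.
  by have [j [ju tj nj]] := IH v suv uv; exists j.+1; split => //=; rewrite tj.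
by exists 0%N; split => //=; apply/eqP.
Qed.

End words_combinatorics.

Section word_sums.
Context {R : realType} {m : nat}.
Implicit Types (u v : seq 'I_m.+1) (F G : seq 'I_m.+1 -> R).

(** Recursion on the length makes concatenation of words ([word_sum_cat]) hold
    almost by computation; [word_sumE] connects it with sums over tuples. *)
Fixpoint word_sum n F : R :=
  if n is n'.+1 then \sum_(a : 'I_m.+1) word_sum n' (fun u => F (a :: u)) else F [::].

Lemma word_sumE n F : word_sum n F = \sum_(t : n.-tuple 'I_m.+1) F t.
Proof.
elim: n F => [|n IH] F /=.
  by rewrite (eq_bigr (fun=> F [::])) ?big_const ?card_tuple ?expn0 /= ?addr0 // => t _; rewrite tuple0.
under eq_bigr do rewrite IH.
rewrite pair_big /= .
rewrite [RHS](reindex (fun p : 'I_m.+1 * n.-tuple 'I_m.+1 => cons_tuple p.1 p.2)).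
  by apply: eq_bigr.
exists (fun t : n.+1.-tuple 'I_m.+1 => (thead t, behead_tuple t)) => [[a t] _|t _] /=.
  by rewrite theadE; congr (_, _); apply: val_inj.
by apply: val_inj => /=; rewrite [in RHS](tuple_eta t).
Qed.

Lemma word_sum_cat a b F :
  word_sum (a + b) F = word_sum a (fun u => word_sum b (fun v => F (u ++ v))).
Proof.
elim: a F => [//|a IH] F /=; by under eq_bigr do rewrite IH.
Qed.

Lemma eq_word_sum n F G : (forall u, size u = n -> F u = G u) -> word_sum n F = word_sum n G.
Proof.
by move=> FG; rewrite !word_sumE; apply: eq_bigr => t _; rewrite FG ?size_tuple.
Qed.

Lemma ler_word_sum n F G : (forall u, size u = n -> F u <= G u) ->
  word_sum n F <= word_sum n G.
Proof.
by move=> FG; rewrite !word_sumE; apply: ler_sum => t _; rewrite FG ?size_tuple.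
Qed.

Lemma word_sumZ n (c : R) F : word_sum n (fun u => c * F u) = c * word_sum n F.
Proof. by rewrite !word_sumE mulr_sumr. Qed.

Lemma word_sum_sum (I : finType) n (F : I -> seq 'I_m.+1 -> R) :
  word_sum n (fun u => \sum_i F i u) = \sum_i word_sum n (F i).
Proof.
rewrite word_sumE exchange_big; apply: eq_bigr => i _; by rewrite word_sumE.
Qed.

Lemma word_sumD n F G : word_sum n (fun u => F u + G u) = word_sum n F + word_sum n G.
Proof. by rewrite !word_sumE big_split. Qed.

Lemma word_sum_cst n (c : R) : word_sum n (fun=> c) = (m.+1 ^ n)%:R * c.
Proof. by rewrite word_sumE sumr_const card_tuple card_ord mulr_natl. Qed.

End word_sums.

(** * Cylinder probabilities and block entropy *)

Section cylinder_probability.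
Context {R : realType} {m : nat} (P : probability (Omega m) R).
Hypothesis Pinv : shift_invariant P.
Implicit Types (w : Omega m) (u v : seq 'I_m.+1).
Local Notation E f := (\int[P]_(w in setT) f w).

Definition cylprob u : R := fine (P (cylinder u)).

Lemma cylprob_ge0 u : 0 <= cylprob u. Proof. exact: fine_prob_ge0. Qed.

Lemma cylprobE u : P (cylinder u) = (cylprob u)%:E.
Proof. by rewrite fineK // fin_num_measure //; exact: measurable_cylinder. Qed.

Lemma cylprob_le1 u : cylprob u <= 1.
Proof.
rewrite -lee_fin -cylprobE; apply: probability_le1; exact: measurable_cylinder.
Qed.

Lemma cylprob_catr u v : cylprob (u ++ v) <= cylprob v.
Proof.
rewrite /cylprob -[P (cylinder v)](prob_preimage_iter Pinv (size u)); last exact: measurable_cylinder.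
apply: fine_prob_le; [exact: measurable_cylinder| |].
  by apply: measurable_preimage_iter; exact: measurable_cylinder.
by rewrite cylinder_cat; apply: subIsetr.
Qed.

Lemma trunc_bounded (g : seq 'I_m.+1 -> R) n :
  exists B, forall w, `|g (trunc_word w n)| <= B.
Proof.
exists (word_sum n (fun u => `|g u|)) => w; rewrite word_sumE.
have sz : size (trunc_word w n) == n by rewrite size_trunc.
by rewrite (bigD1 (Tuple sz)) //= lerDl sumr_ge0.
Qed.

Lemma trunc_integrable (g : seq 'I_m.+1 -> R) n :
  P.-integrable setT (EFin \o (fun w => g (trunc_word w n))).
Proof.
have [B gB] := trunc_bounded g n.
apply: bounded_integrable gB; exact: measurable_fun_trunc.
Qed.

Lemma mean_trunc (g : seq 'I_m.+1 -> R) n :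
  E (fun w => g (trunc_word w n)) = word_sum n (fun u => cylprob u * g u).
Proof.
rewrite word_sumE.
transitivity (E (fun w => \sum_(t : n.-tuple 'I_m.+1) g t * \1_(cylinder t) w)).
  apply: eq_Rintegral => w _.
  have sz : size (trunc_word w n) == n by rewrite size_trunc.
  rewrite (bigD1 (Tuple sz)) //= indicE mem_set ?mulr1; last exact: cylinder_trunc.
  rewrite big1 ?addr0 // => t tw; rewrite indicE memNset ?mulr0 //.
  move=> /=; rewrite /cylinder /= size_tuple => h.
  by move: tw; rewrite -val_eqE /= h eqxx.
have mc u : measurable (cylinder u : set (Omega m)) by exact: measurable_cylinder.
elim: (index_enum _) => [|t s IH].
  rewrite big_nil -[RHS](mean_cst P 0); apply: eq_Rintegral => w _.
  by rewrite big_nil.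
rewrite big_cons -IH.
have bnd (r : seq (n.-tuple 'I_m.+1)) : P.-integrable setT
   (EFin \o (fun w : Omega m => \sum_(t <- r) g t * \1_(cylinder t) w)).
  apply: (@bounded_integrable _ _ _ P _ (\sum_(t <- r) `|g t|)).
    apply: measurable_sum => t'; apply: measurable_funM.
      exact: measurable_cst.
    exact: measurable_indic.
  move=> w; rewrite (le_trans (ler_norm_sum _ _ _)) //; apply: ler_sum => t' _.
  rewrite normrM ler_piMr // indicE.
  by case: (_ \in _); rewrite ?normr1 ?normr0.
have h1 : E (fun w => g t * \1_(cylinder t) w) = cylprob t * g t.
  rewrite RintegralZl //; last exact: indic_integrable.
  by rewrite mean_indic // mulrC.
rewrite -h1 -RintegralD //.
- by apply: eq_Rintegral => w _; rewrite big_cons.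
- have := bnd [:: t]; congr (P.-integrable setT _).
  by apply/funext => w /=; rewrite big_seq1.
Qed.

Lemma word_sum_cylprob n : word_sum n cylprob = 1.
Proof.
rewrite -[RHS](mean_cst P 1) (@mean_trunc (fun=> 1) n).
by apply: eq_word_sum => u _; rewrite mulr1.
Qed.

Definition block_entropy n : R := word_sum n (fun u => cylprob u * - ln (cylprob u)).

(** Nonnegativity of relative entropy: ln x <= x - 1 at x = Q u / cylprob u,
    weighted by cylprob u. *)
Lemma gibbs n (Q : seq 'I_m.+1 -> R) : (forall u, size u = n -> 0 < Q u) ->
  word_sum n Q <= 1 -> block_entropy n <= word_sum n (fun u => cylprob u * - ln (Q u)).
Proof.
move=> Q0 Q1.
have h : block_entropy n <= word_sum n (fun u => cylprob u * - ln (Q u) + (Q u + -1 * cylprob u)).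
  apply: ler_word_sum => u /Q0 Qu; have := cylprob_ge0 u.
  rewrite le_eqVlt => /predU1P[<-|pu]; first by rewrite !mul0r mulr0 add0r addr0 ltW.
  have : ln (Q u / cylprob u) <= Q u / cylprob u - 1.
    have := @le_ln1Dx R (Q u / cylprob u - 1).
    by rewrite [1 + _]addrC subrK; apply; rewrite ltrBrDr addNr divr_gt0.
  rewrite ln_div ?posrE // => /(ler_wpM2l (ltW pu)).
  rewrite mulrBr mulrBr mulr1 mulrC -[cylprob u * (Q u / _)]mulrC mulfVK ?gt_eqF //.
  rewrite !mulrN mulN1r; lra.
rewrite (le_trans h) // !word_sumD word_sumZ word_sum_cylprob.
by rewrite gerDl mulr1 subr_le0.
Qed.

End cylinder_probability.

(** * Sums over tilings of a word *)

Section renewal.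
Context {R : realType} {m : nat}.
Variable wt : seq 'I_m.+1 -> R.
Hypothesis wt0 : forall u, 0 <= wt u.
Implicit Types (u v : seq 'I_m.+1) (w : Omega m).

(** Sum over all ways of cutting u into at most k nonempty tiles of the product
    of the weights of the tiles. *)
Fixpoint tiling_weight k u : R :=
  (u == [::])%:R +
  if k is k'.+1 then
    \sum_(l < size u) wt (take l.+1 u) * tiling_weight k' (drop l.+1 u) else 0.

Lemma tiling_weight_ge0 k u : 0 <= tiling_weight k u.
Proof.
elim: k u => [|k IH] u /=; rewrite addr_ge0 ?ler0n //.
by apply: sumr_ge0 => l _; rewrite mulr_ge0.
Qed.

(** Renewal argument: if the weights of all tiles add up to at most 1, then the
    tilings of the words of any fixed length also have total weight at most 1,
    by splitting off the first tile. *)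
Lemma tiling_weight_sum : (forall L, \sum_(l < L) word_sum l.+1 wt <= 1) ->
  forall k n, word_sum n (tiling_weight k) <= 1.
Proof.
move=> wt1; elim=> [|k IH] n.
  case: n => [|n]; first by rewrite /= addr0.
  rewrite (@eq_word_sum _ _ n.+1 _ (fun=> 0)).
    by rewrite word_sum_cst mulr0.
  by case=> [|a u] //= _; rewrite addr0.
case: n => [|n]; first by rewrite /= big_ord0 addr0.
rewrite (@eq_word_sum _ _ n.+1 _
  (fun u => \sum_(l < n.+1) wt (take l.+1 u) * tiling_weight k (drop l.+1 u))); last first.
  by move=> u sz /=; rewrite sz -size_eq0 sz add0r.
rewrite word_sum_sum (le_trans _ (wt1 n.+1)) //; apply: ler_sum => l _.
rewrite -{1}(subnKC (ltn_ord l)) word_sum_cat.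
rewrite (@eq_word_sum _ _ l.+1 _
  (fun u => wt u * word_sum (n.+1 - l.+1) (tiling_weight k))); last first.
  move=> u sz; rewrite -word_sumZ; apply: eq_word_sum => v _.
  by rewrite take_size_cat // drop_size_cat.
by apply: ler_word_sum => u _; rewrite ler_piMr.
Qed.

Lemma tiling_weight_cat k u v : u != [::] -> wt u * tiling_weight k v <= tiling_weight k.+1 (u ++ v).
Proof.
case: u => [//|a u] _ /=.
have lt : (size u < (size (u ++ v)).+1)%N by rewrite size_cat; lia.
rewrite add0r (bigD1 (Ordinal lt)) //= take_size_cat // drop_size_cat // lerDl.
by apply: sumr_ge0 => l _; rewrite mulr_ge0 // tiling_weight_ge0.
Qed.

Variable B : R.
Hypothesis (B0 : 0 <= B) (wtB : forall a, expR (- B) <= wt [:: a]).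

Lemma tiling_weight_letters L k w : (L <= k)%N -> expR (- (L%:R * B)) <= tiling_weight k (trunc_word w L).
Proof.
elim: L k w => [|L IH] [|k] w //=.
- by move=> _; rewrite mul0r oppr0 expR0 addr0.
- by move=> _; rewrite mul0r oppr0 expR0 big_ord0 addr0.
- move=> Lk; rewrite -[leRHS]/(tiling_weight k.+1 (trunc_word w L.+1)) truncS.
  apply: le_trans (@tiling_weight_cat k [:: letter w 0] _ _) => //.
  by rewrite -natr1 mulrDl mul1r addrC opprD expRD ler_pM ?expR_ge0 // IH.
Qed.

Variables (psi : Omega m -> R) (N : nat).
Hypothesis psi0 : forall w, 0 <= psi w.
Hypothesis tile : forall w, exists n, [/\ (0 < n)%N, (n <= N)%N &
  expR (- birkhoff_sum psi n w) <= wt (trunc_word w n)].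

Lemma birkhoff_sum_ge0 n w : 0 <= birkhoff_sum psi n w.
Proof. by apply: sumr_ge0. Qed.

(** The counterpart of [tiled_sum_ge] for weights: tile the word greedily by the
    tiles given by the hypothesis and fill the incomplete end, shorter than N,
    with single letters. *)
Lemma tiling_weight_tile L k w : (L <= k)%N ->
  expR (- (birkhoff_sum psi L w + N%:R * B)) <= tiling_weight k (trunc_word w L).
Proof.
have [n nL] := ubnP L; elim: n L nL k w => // n IH L nL k w Lk.
have [l [l0 lN wl]] := tile w.
have [Ll|lL] := ltnP L l.
  apply: le_trans (@tiling_weight_letters L k w Lk).
  rewrite ler_expR lerN2; apply: (@le_trans _ _ (N%:R * B)).
    by rewrite ler_wpM2r // ler_nat; lia.
  by rewrite lerDr birkhoff_sum_ge0.
case: k Lk => [|k] Lk; first by lia.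
rewrite -(subnKC lL) trunc_cat; apply: le_trans (@tiling_weight_cat _ _ _ _); last first.
  by rewrite -size_eq0 size_trunc -lt0n.
rewrite birkhoff_sumD -addrA opprD expRD ler_pM ?expR_ge0 //.
apply: IH; lia.
Qed.

End renewal.

(** * Entropy and the size of typical cylinders *)

Section entropy_theory.
Context {R : realType} {m : nat} (P : probability (Omega m) R).
Hypotheses (Pinv : shift_invariant P) (Perg : ergodic P).
Implicit Types (w : Omega m) (u v : seq 'I_m.+1).
Local Notation E f := (\int[P]_(w in setT) f w).
Local Notation p := (cylprob P).

(** Suppose almost every point has prefixes of arbitrarily large length n and
    probability at least e^(-n L).  Weigh long tiles by their probability,
    discounted geometrically in the length so that the total weight is at most
    1, and single letters by a constant.  The tiling weight is a
    sub-probability Q on words of length n for which -ln Q is at most n (L + d)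
    plus a constant on average: off a set of small measure there is a heavy tile
    of length at most N, and where there is none a single letter is used.  The
    Gibbs inequality turns this into a bound for the block entropy. *)
Lemma block_entropy_upper (L d : R) : 0 <= L -> 0 < d ->
  (forall K, P (~` [set w | exists2 n, (K <= n)%N &
     expR (- (n%:R * L)) <= p (trunc_word w n)]) = 0%E) ->
  exists C, forall n, block_entropy P n <= n%:R * (L + d) + C.
Proof.
move=> L0 d0 tileK.
(* rho ^ n c is the discount of tiles of length n; c is the value for which all
   long tiles together weigh at most 1/2, and exp (- B) is half the uniform
   weight of a letter, so that letters also weigh 1/2 in total *)
pose dd := d / 4; have dd0 : 0 < dd by rewrite divr_gt0.
pose rho := expR (- dd).
have rho0 : 0 < rho by exact: expR_gt0.
have rho1 : rho < 1 by rewrite /rho expR_lt1 oppr_lt0.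
pose c := (1 - rho) / 2; have c0 : 0 < c by rewrite divr_gt0 // subr_gt0.
pose B := ln (2 * m.+1%:R : R).
have expB : expR (- B) = (2 * m.+1%:R)^-1.
  by rewrite expRN lnK // posrE mulr_gt0.
have B0 : 0 <= B by rewrite ln_ge0 // -natrM ler1n.
(* a step at which no heavy tile of length at most N starts is charged Bb more
   than the others; N is chosen so that this costs at most dd on average *)
pose Bb := B + L + 2 * dd.
have Bb0 : 0 < Bb by rewrite /Bb; lra.
(* the tiles are long enough for exp (- n dd) to compensate the constant c *)
have [K K0 Kc] : exists2 K, (0 < K)%N & expR (- (K%:R * dd)) <= c.
  exists (Num.truncn (- ln c / dd)).+1 => //.
  rewrite -[leRHS](lnK (_ : c \in Num.pos)) ?posrE // ler_expR lerNl.
  by rewrite -ler_pdivrMr // ltW // truncnS_gt.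
pose A n := [set w | (K <= n)%N /\ expR (- (n%:R * L)) <= p (trunc_word w n)].
have mA n : measurable (A n : set (Omega m)).
  exact: (@measurable_trunc m n [set u | (K <= n)%N /\ expR (- (n%:R * L)) <= p u]).
pose G N := \bigcup_(n in [set n | (n <= N)%N]) A n.
have mG N : measurable (G N) by apply: bigcup_measurable.
have mCG N : measurable (~` G N) by exact: measurableC.
have PG0 : P (lim_sup_set (fun k => ~` G k)) = 0%E.
  apply/eqP; rewrite -measure_le0 -(tileK K) le_measure ?inE //.
  - exact: measurable_lim_sup.
  - apply: measurableC.
    have -> : [set w | exists2 n, (K <= n)%N &
     expR (- (n%:R * L)) <= p (trunc_word w n)] = \bigcup_n A n.
      apply/seteqP; split => w /=; first by move=> [n ? ?]; exists n.
      by move=> [n _ []]; exists n.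
    exact: bigcup_measurable.
  - move=> w Gw [n Kn An]; have [k /= nk] := Gw n I; apply.
    by exists n => //.
have [N PN] := lim_sup_tail mCG PG0 (divr_gt0 dd0 Bb0).
have PGN : fine (P (~` G N)) <= dd / Bb.
  rewrite ltW // (le_lt_trans _ PN) // fine_prob_le //.
    exact: bigcup_measurable.
  by move=> w Gw; exists N => /=.
pose psi w := (L + 2 * dd) + Bb * \1_(~` G N) w.
have mpsi : measurable_fun setT psi.
  apply: measurable_funD; first exact: measurable_cst.
  apply: measurable_funM; first exact: measurable_cst.
  exact: measurable_indic.
have ind01 w : 0 <= (\1_(~` G N) w : R) <= 1.
  by rewrite indicE; case: (_ \in _); rewrite ?lexx ?ler01.
have psiL w : L + 2 * dd <= psi w.
  by have /andP[i0 i1] := ind01 w; rewrite /psi lerDl mulr_ge0 // ltW.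
have psiB w : `|psi w| <= L + 2 * dd + Bb.
  have /andP[i0 i1] := ind01 w; rewrite ger0_norm; last first.
    by rewrite (le_trans _ (psiL w)) //; lra.
  by rewrite /psi lerD2l ler_piMr // ltW.
pose wt u : R := (size u == 1)%:R * expR (- B) +
  (K <= size u)%:R * (c * rho ^+ size u * p u).
have cp u : 0 <= (K <= size u)%:R * (c * rho ^+ size u * p u).
  rewrite mulr_ge0 // mulr_ge0 ?cylprob_ge0 //.
  by rewrite mulr_ge0 ?exprn_ge0 // ltW.
have wt0 u : 0 <= wt u.
  by rewrite /wt addr_ge0 // mulr_ge0 // expR_ge0.
have wtB a : expR (- B) <= wt [:: a].
  by rewrite /wt eqxx mul1r lerDl.
have tile w : exists n, [/\ (0 < n)%N, (n <= N.+1)%N &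
  expR (- birkhoff_sum psi n w) <= wt (trunc_word w n)].
  have [] := boolP (w \in G N) => [|nG].
    rewrite inE => -[n /= nN [Kn An]]; exists n.
    split; [exact: leq_trans K0 Kn|exact: leqW|].
    rewrite /wt size_trunc Kn mul1r.
    have h : n%:R * (L + 2 * dd) <= birkhoff_sum psi n w.
      rewrite mulr_natl -[X in _ *+ X]card_ord -sumr_const.
      exact: ler_sum.
    apply: (@le_trans _ _ (c * rho ^+ n * p (trunc_word w n))); last first.
      by rewrite lerDr mulr_ge0 // expR_ge0.
    apply: (@le_trans _ _ (expR (- (n%:R * dd)) * rho ^+ n * expR (- (n%:R * L)))).
      rewrite -expRM_natl -!expRD ler_expR; lra.
    rewrite ler_pM // ?mulr_ge0 ?expR_ge0 ?exprn_ge0 // ?(ltW rho0) //.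
    rewrite ler_pM2r ?exprn_gt0 // (le_trans _ Kc) // ler_expR lerN2.
    by rewrite ler_pM2r // ler_nat.
  exists 1%N; split => //; rewrite trunc1; apply: le_trans (wtB _).
  rewrite ler_expR lerN2 /birkhoff_sum big_ord1 /= /psi indicE in_setC nG mulr1 /Bb; lra.
have psi0 w : 0 <= psi w by rewrite (le_trans _ (psiL w)) //; lra.
have wt1 M : \sum_(l < M) word_sum l.+1 wt <= 1.
  apply: (@le_trans _ _ (\sum_(l < M) ((l == 0 :> nat)%:R / 2 + c * rho ^+ l.+1))).
    apply: ler_sum => l _.
    rewrite (@eq_word_sum _ _ l.+1 _ (fun u => (l == 0 :> nat)%:R * expR (- B) +
      (K <= l.+1)%:R * (c * rho ^+ l.+1) * p u)); last first.
      by move=> u sz; rewrite /wt sz eqSS -!mulrA.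
    rewrite word_sumD word_sum_cst word_sumZ word_sum_cylprob mulr1 lerD //.
      case: eqP => [->|_]; last by rewrite !mul0r mulr0.
      by rewrite expn1 mul1r expB invfM [_^-1 * _]mulrC mulrA mulfV // mul1r.
    rewrite ler_piMl //; last by case: (_ <= _)%N.
    by rewrite mulr_ge0 ?exprn_ge0 // ltW.
  rewrite big_split /=.
  have h1 : \sum_(l < M) ((l == 0 :> nat)%:R / 2) <= 1 / 2 :> R.
    case: M => [|M]; first by rewrite big_ord0.
    by rewrite big_ord_recl /= big1 ?addr0 // => i _; rewrite mul0r.
  have h2 : \sum_(l < M) (c * rho ^+ l.+1) <= 1 / 2.
    have -> : \sum_(l < M) (c * rho ^+ l.+1) = rho * (1 - rho ^+ M) / 2.
      elim: {h1} M => [|M IH]; first by rewrite big_ord0 expr0 subrr mulr0 mul0r.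
      rewrite big_ord_recr /= IH /c !exprS; lra.
    have r1 : 0 <= rho ^+ M by rewrite exprn_ge0 // ltW.
    have r2 : rho ^+ M <= 1 by rewrite exprn_ile1 // ltW.
    rewrite ler_pM2r ?invr_gt0 //; nra.
  lra.
have low n w : expR (- (birkhoff_sum psi n w + N.+1%:R * B)) <= tiling_weight wt n (trunc_word w n).
  exact: (@tiling_weight_tile _ _ wt wt0 B B0 wtB psi N.+1 psi0 tile n n w).
(* positivity at u, from the lower bound at a point of the cylinder of u *)
have renp n u : size u = n -> 0 < tiling_weight wt n u.
  move=> <-; have wu := trunc_pad_word u; pose w : Omega m := pad_word u.
  by rewrite -{2}wu (lt_le_trans _ (low _ w)) // expR_gt0.
exists (N.+1%:R * B) => n.
apply: (le_trans (@gibbs _ _ P n _ (@renp n) (tiling_weight_sum wt0 wt1 n n))).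
rewrite -(@mean_trunc _ _ P (fun u => - ln (tiling_weight wt n u))).
have mS : measurable_fun setT (birkhoff_sum psi n) by exact: measurable_birkhoff_sum.
have iS : P.-integrable setT (EFin \o birkhoff_sum psi n).
  apply: (@bounded_integrable _ _ _ P _ (n%:R * (L + 2 * dd + Bb))) => // w.
  exact: birkhoff_sum_bounded.
have ic (r : R) : P.-integrable setT (EFin \o (fun=> r)).
  by apply: (@bounded_integrable _ _ _ P _ `|r|) => //; exact: measurable_cst.
apply: (@le_trans _ _ (E (fun w => birkhoff_sum psi n w + N.+1%:R * B))).
  apply: le_Rintegral => //.
  - exact: (@trunc_integrable _ _ P (fun u => - ln (tiling_weight wt n u))).
  - have := integrableD measurableT iS (ic (N.+1%:R * B)).
    by congr (P.-integrable setT _).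
  - move=> w _; rewrite lerNl -[leLHS]expRK.
    by rewrite ler_ln ?posrE ?expR_gt0 // renp // size_trunc.
rewrite RintegralD // mean_cst lerD2r (mean_birkhoff_sum Pinv _ mpsi psiB).
rewrite ler_wpM2l //.
rewrite RintegralD // ?mean_cst; last first.
  apply: (@bounded_integrable _ _ _ P _ Bb).
    apply: measurable_funM; first exact: measurable_cst.
    exact: measurable_indic.
  move=> w; have /andP[i0 i1] := ind01 w.
  by rewrite ger0_norm ?mulr_ge0 // ?(ltW Bb0) // ler_piMr // ltW.
rewrite RintegralZl //; last exact: indic_integrable.
rewrite mean_indic //.
have : Bb * fine (P (~` G N)) <= dd by rewrite mulrC -ler_pdivlMr.
rewrite /dd; lra.
Qed.

Definition heavy_set (L : R) n : set (Omega m) :=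
  [set w | expR (- (n%:R * L)) <= p (trunc_word w n)].

Lemma measurable_heavy_set L n : measurable (heavy_set L n).
Proof. exact: (@measurable_trunc m n [set u | expR (- (n%:R * L)) <= p u]). Qed.

(** Removing the first k letters does not decrease the probability of a word
    ([cylprob_catr]) and costs k L' in the exponent, which L' - L > 0 absorbs for
    long words; so the images of a point with infinitely many heavy prefixes for
    L have infinitely many for L'.  If the points without them had positive
    probability, almost every orbit would hit them by [ergodic_hits], and almost
    no point would be heavy infinitely often for L. *)
Lemma heavy_set_full (L L' : R) : L < L' -> P (lim_sup_set (heavy_set L)) <> 0%E ->
  P (~` lim_sup_set (heavy_set L')) = 0%E.
Proof.
move=> LL' PL; apply/eqP/negPn/negP => /eqP PL'.
have mA M : measurable (lim_sup_set (heavy_set M)).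
  by apply: measurable_lim_sup => k; exact: measurable_heavy_set.
apply: PL; rewrite -[X in P X]setCK.
apply: (ergodic_hits Pinv Perg) PL'; [exact: measurableC|exact: measurableC|].
move=> k w nA AL; apply: nA; apply/lim_supP => N.
move/lim_supP : AL => /(_ (k + N + (Num.truncn (k%:R * L' / (L' - L))).+1)%N).
move=> [n Nn An]; exists (n - k)%N; first by lia.
have kn : (k <= n)%N by lia.
rewrite /heavy_set /=; apply: (@le_trans _ _ (p (trunc_word w n))); last first.
  by rewrite -{1}(subnKC kn) trunc_cat; apply: cylprob_catr.
apply: le_trans An; rewrite ler_expR lerN2 natrB //.
have h : k%:R * L' <= n%:R * (L' - L).
  rewrite -ler_pdivrMr ?subr_gt0 // ltW // (lt_le_trans (truncnS_gt _)) //.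
  by rewrite ler_nat (leq_trans _ Nn) // leq_addl.
lra.
Qed.

Lemma block_entropy_ge0 n : 0 <= block_entropy P n.
Proof.
rewrite /block_entropy word_sumE; apply: sumr_ge0 => u _; rewrite mulr_ge0 ?cylprob_ge0 //.
by rewrite oppr_ge0 ln_le0 // cylprob_le1.
Qed.

Lemma block_entropy_le n : block_entropy P n <= n%:R * ln m.+1%:R.
Proof.
have p0 : 0 < ((m.+1 ^ n)%:R : R)^-1 by rewrite invr_gt0 ltr0n expn_gt0.
have := @gibbs _ _ P n (fun=> ((m.+1 ^ n)%:R)^-1) (fun _ _ => p0).
rewrite word_sum_cst mulfV ?pnatr_eq0 -?lt0n ?expn_gt0 // lexx => /(_ isT).
move=> /le_trans; apply.
rewrite (@eq_word_sum _ _ n _ (fun u => ln (m.+1 ^ n)%:R * p u)).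
  by rewrite word_sumZ word_sum_cylprob mulr1 natrX lnXn ?ltr0n // mulr_natl.
by move=> u _; rewrite lnV ?posrE ?ltr0n ?expn_gt0 // opprK mulrC.
Qed.

(** Words outside the heavy set contribute at least n L each, and the heavy set
    of large order has small probability. *)
Lemma block_entropy_lower (L d : R) : 0 <= L -> 0 < d -> P (lim_sup_set (heavy_set L)) = 0%E ->
  exists N, forall n, (N <= n)%N -> n%:R * (L - d) <= block_entropy P n.
Proof.
move=> L0 d0 PA.
have mA n : measurable (heavy_set L n) by exact: measurable_heavy_set.
have [N PN] := lim_sup_tail mA PA (divr_gt0 d0 (ltr_wpDl L0 ltr01)).
exists N => n Nn.
have PAn : fine (P (heavy_set L n)) <= d / (L + 1).
  rewrite ltW // (le_lt_trans _ PN) // fine_prob_le //.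
    exact: bigcup_measurable.
  by move=> w Aw; exists n.
have h : word_sum n (fun u => p u * (n%:R * L * (1 - (expR (- (n%:R * L)) <= p u)%R%:R)))
    <= block_entropy P n.
  apply: ler_word_sum => u _; have := cylprob_ge0 P u.
  rewrite le_eqVlt => /predU1P[<-|pu]; first by rewrite !mul0r.
  rewrite ler_pM2l //; case: (leP (expR _)) => [_|pL] /=.
    by rewrite subrr mulr0 oppr_ge0 ln_le0 // cylprob_le1.
  rewrite subr0 mulr1 lerNr -[leRHS]expRK ler_ln ?posrE ?expR_gt0 //.
  exact: ltW.
apply: le_trans h.
rewrite (@eq_word_sum _ _ n _ (fun u => n%:R * L * p u +
   - (n%:R * L) * (p u * (expR (- (n%:R * L)) <= p u)%R%:R))); last first.
  by move=> u _; lra.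
rewrite word_sumD !word_sumZ word_sum_cylprob mulr1.
rewrite -(@mean_trunc _ _ P (fun u => (expR (- (n%:R * L)) <= p u)%R%:R)).
have -> : E (fun w => (expR (- (n%:R * L)) <= p (trunc_word w n))%R%:R) =
    fine (P (heavy_set L n)).
  rewrite -mean_indic //; apply: eq_Rintegral => w _; rewrite indicE.
  congr (_%:R); case: leP => h; first by rewrite mem_set.
  by rewrite memNset // /heavy_set /= leNgt h.
have Ld : L * fine (P (heavy_set L n)) <= d.
  rewrite (le_trans (ler_wpM2l L0 PAn)) // mulrA ler_pdivrMr ?ltr_wpDl //.
  by rewrite mulrDr mulr1 mulrC lerDl ltW.
rewrite mulrBr mulNr lerD2l lerN2 -mulrA ler_wpM2l //.
Qed.

(** The limit h is the supremum of the L for which heavy prefixes occur only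
    finitely often.  Below h the block entropy is bounded from below by
    [block_entropy_lower]; above h heavy prefixes recur almost surely by
    [heavy_set_full], and [block_entropy_upper] applies. *)
Lemma entropy_exists : exists h : R, [/\ 0 <= h,
  block_entropy P n / n%:R @[n --> \oo] --> h,
  forall L, L < h -> P (lim_sup_set (heavy_set L)) = 0%E &
  forall L, h < L -> P (~` lim_sup_set (heavy_set L)) = 0%E].
Proof.
pose S := [set L | P (lim_sup_set (heavy_set L)) = 0%E].
have mA L : measurable (lim_sup_set (heavy_set L)).
  by apply: measurable_lim_sup => k; exact: measurable_heavy_set.
have Sneg L : L < 0 -> S L.
  move=> L0; rewrite /S /= [X in P X](_ : _ = set0) ?measure0 //.
  apply/seteqP; split => // w /lim_supP /(_ 1%N)[n n1]; rewrite /heavy_set /=.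
  move/le_trans/(_ (cylprob_le1 P _)); rewrite expR_le1 oppr_le0.
  by rewrite pmulr_rge0 ?ltr0n // leNgt L0.
have Subset L L' : L <= L' -> S L' -> S L.
  rewrite /S /= => LL' PL'; apply/eqP; rewrite -measure_le0 -PL' le_measure ?inE //.
  move=> w /lim_supP Aw; apply/lim_supP => N; have [n Nn An] := Aw N.
  by exists n => //; apply: le_trans An; rewrite ler_expR lerN2 ler_wpM2l.
have Sub L : S L -> L <= ln m.+1%:R.
  move=> SL; rewrite leNgt; apply/negP => Lm.
  have L0 : 0 <= L by rewrite (le_trans _ (ltW Lm)) // ln_ge0 // ler1n.
  have d0 : 0 < (L - ln m.+1%:R) / 2 by rewrite divr_gt0 // subr_gt0.
  have [N HN] := block_entropy_lower L0 d0 SL.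
  have := le_trans (HN N.+1 (leqnSn _)) (block_entropy_le N.+1).
  by rewrite ler_pM2l ?ltr0n //; lra.
have hS : has_sup S.
  by split; [exists (-1); apply: Sneg; rewrite oppr_lt0|exists (ln m.+1%:R)].
pose h := sup S.
have h0 : 0 <= h.
  rewrite leNgt; apply/negP => hn.
  have : h / 2 <= h by apply: ub_le_sup; [case: hS|apply: Sneg; lra].
  lra.
have hlow L : L < h -> S L.
  move=> Lh; have hL : 0 < h - L by rewrite subr_gt0.
  have [L' SL' LL'] := sup_adherent hL hS.
  apply: Subset SL'; rewrite ltW //; move: LL'; rewrite -/h; lra.
have hup L : h < L -> P (~` lim_sup_set (heavy_set L)) = 0%E.
  move=> hL; apply: (@heavy_set_full ((h + L) / 2)); first by lra.
  move=> SL; have : (h + L) / 2 <= h by apply: ub_le_sup => //; case: hS.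
  lra.
exists h; split => //.
apply/cvgrPdist_le => e e0.
have [C HC] : exists C, forall n, block_entropy P n <= n%:R * (h + e / 4 + e / 4) + C.
  apply: block_entropy_upper; [lra|lra|] => K.
  apply/eqP; rewrite -measure_le0 -(hup (h + e / 4)); last by lra.
  rewrite le_measure ?inE //; try apply: measurableC => //.
    have -> : [set w | exists2 n, (K <= n)%N &
      expR (- (n%:R * (h + e / 4))) <= p (trunc_word w n)] =
      \bigcup_(n in [set n | (K <= n)%N]) heavy_set (h + e / 4) n by [].
    by apply: bigcup_measurable => n _; exact: measurable_heavy_set.
  by apply: subsetC => w /lim_supP/(_ K).
have [N HN] : exists N, forall n, (N <= n)%N -> n%:R * (h - e) <= block_entropy P n.
  have [he|he] := leP 0 (h - e / 2).
    have e2 : 0 < e / 2 by lra.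
    have /hlow/(block_entropy_lower he e2) : h - e / 2 < h by lra.
    move=> [N HN]; exists N => n /HN.
    by apply: le_trans; rewrite ler_wpM2l //; lra.
  exists 0%N => n _; rewrite (le_trans _ (block_entropy_ge0 n)) // mulr_ge0_le0 //; lra.
near=> n.
have n0 : 0 < n%:R :> R by rewrite ltr0n; near: n; exists 1%N.
rewrite ler_distlC; apply/andP; split.
  rewrite ler_pdivlMr // mulrC; apply: HN.
  by near: n; exists N.
rewrite ler_pdivrMr // mulrC (le_trans (HC n)) //.
have : C <= n%:R * (e / 2).
  rewrite -ler_pdivrMr; last by lra.
  apply: (le_trans (ltW (truncnS_gt _))); rewrite ler_nat.
  by near: n; exists (Num.truncn (C / (e / 2))).+1.
lra.
Unshelve. all: by end_near.
Qed.

Lemma entropyE (h : R) : block_entropy P n / n%:R @[n --> \oo] --> h -> entropy P = h.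
Proof.
move=> cvh; rewrite /entropy.
have -> : (fun n => n%:R^-1 * \sum_(u : n.-tuple 'I_m.+1)
       fine (P (cylinder u)) * ln (fine (P (cylinder u)))) =
   (fun n => - (block_entropy P n / n%:R)).
  apply/funext => n; rewrite /block_entropy word_sumE mulrC -mulNr; congr (_ / _).
  by rewrite -sumrN; apply: eq_bigr => u _; rewrite mulrN opprK.
by rewrite -[RHS]opprK; congr (- _); apply: cvg_lim => //; exact: cvgN.
Qed.

Theorem entropy_ge0 : 0 <= entropy P.
Proof. by have [h [h0 /entropyE ->]] := entropy_exists. Qed.

Theorem cylinder_ub (e : R) : 0 < e ->
  {ae P, forall w, exists N, forall n, (N <= n)%N ->
     p (trunc_word w n) <= expR (- (n%:R * (entropy P - e)))}.
Proof.
move=> e0; have [h [h0 /entropyE -> low _]] := entropy_exists.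
exists (lim_sup_set (heavy_set (h - e))); split.
- by apply: measurable_lim_sup => k; exact: measurable_heavy_set.
- by apply: low; lra.
- move=> w /= nw; apply/lim_supP; apply: contrapT => /existsNP[N HN].
  apply: nw; exists N => n Nn; rewrite leNgt; apply/negP => h1.
  by apply: HN; exists n => //; exact: ltW.
Qed.

Theorem cylinder_lb (e : R) : 0 < e ->
  {ae P, forall w, forall N, exists2 n, (N <= n)%N &
     expR (- (n%:R * (entropy P + e))) <= p (trunc_word w n)}.
Proof.
move=> e0; have [h [h0 /entropyE -> _ up]] := entropy_exists.
exists (~` lim_sup_set (heavy_set (h + e))); split.
- apply: measurableC; apply: measurable_lim_sup => k; exact: measurable_heavy_set.
- by apply: up; lra.
- by move=> w /= nw Aw; apply: nw; exact: (proj1 (lim_supP _ _) Aw).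
Qed.

End entropy_theory.

(** * Mean value theorems *)

Section derivatives_within.
Context {R : realType}.
Implicit Types (X : set R) (g : R -> R).

(** First order expansion with a uniform error, the form in which the relative
    derivative is used at the end points of the interval. *)
Lemma derive_withinP X g x : derivable_within X g x -> forall e : R, 0 < e ->
  exists2 r : R, 0 < r & forall y, X y -> `|y - x| < r ->
    `|g y - g x - derive_within X g x * (y - x)| <= e * `|y - x|.
Proof.
move=> /cvgrPdist_le h e e0; have := h e e0.
rewrite !near_withinE => -[r /= r0 rP].
exists r => // y Xy yx.
have [->|nyx] := eqVneq y x; first by rewrite !subrr mulr0 subrr normr0 mulr0.
have := rP y; rewrite /= distrC => /(_ yx nyx Xy).
rewrite /difference_quotient /derive_within => hh.
have yx0 : y - x != 0 by rewrite subr_eq0.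
have -> : g y - g x = (g y - g x) / (y - x) * (y - x) by rewrite divfK.
by rewrite -mulrBl normrM ler_wpM2r // distrC.
Qed.

Context {a b : R}.
Local Notation X := (`[a, b]%classic : set R).

Lemma is_derive_within g x : derivable_within X g x -> a < x < b ->
  is_derive x 1 g (derive_within X g x).
Proof.
move=> dg /andP[ax xb].
have h : h^-1 *: ((g \o shift x) (h *: 1) - g x) @[h --> 0^'] --> derive_within X g x.
  apply/cvgrPdist_le => e e0.
  have [r r0 rP] := derive_withinP dg e0.
  near=> h.
  have h0 : h != 0 by near: h; exact: nbhs_dnbhs_neq.
  have hr : `|h| < Num.min r (Num.min (x - a) (b - x)).
    by near: h; apply: dnbhs0_lt; rewrite !lt_min r0 !subr_gt0 ax xb.
  move: hr; rewrite !lt_min => /and3P[h1].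
  rewrite !ltr_norml => /andP[h2 _] /andP[_ h3].
  have Xh : X (x + h) by rewrite /= in_itv /=; apply/andP; split; lra.
  have := rP (x + h) Xh; rewrite [x + h - x]addrAC subrr add0r => /(_ h1) hh.
  rewrite /= [h *: 1]mulr1 [h + x]addrC.
  have -> : derive_within X g x - h^-1 *: (g (x + h) - g x) =
    - (h^-1 * (g (x + h) - g x - derive_within X g x * h)).
    by rewrite mulrBr [_ * h]mulrC mulKf // opprB.
  by rewrite normrN normrM normfV mulrC ler_pdivrMr // normr_gt0.
split; last exact: cvg_lim h.
by apply/cvg_ex; exists (derive_within X g x).
Unshelve. all: by end_near.
Qed.

Lemma continuous_within g : (forall x, X x -> derivable_within X g x) ->
  {within X, continuous g}.
Proof.
move=> dg; apply/subspace_continuousP => x Xx.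
apply/cvgrPdist_lt => e e0.
have [r r0 rP] := derive_withinP (dg x Xx) ltr01.
pose D := derive_within X g x.
have D0 : 0 < 1 + `|D| by rewrite ltr_pwDl.
rewrite near_withinE; exists (Num.min r (e / (1 + `|D|))) => /=.
  by rewrite lt_min r0 divr_gt0.
move=> y /=; rewrite lt_min => /andP[yr ye] Xy.
have := rP y Xy; rewrite distrC => /(_ yr) h.
rewrite distrC.
have -> : g y - g x = (g y - g x - D * (y - x)) + D * (y - x) by rewrite subrK.
rewrite (le_lt_trans (ler_normD _ _)) //.
rewrite normrM -(distrC x y) -/D in h *.
rewrite (le_lt_trans (lerD h (lexx _))) // -mulrDl mulrC.
by rewrite -ltr_pdivlMr.
Qed.

Lemma MVT_within g x y : (forall x, X x -> derivable_within X g x) ->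
  X x -> X y -> x < y ->
  exists2 z, x < z < y & g y - g x = derive_within X g z * (y - x).
Proof.
rewrite /= !in_itv /= => dg /andP[ax xb] /andP[ay yb] xy.
have [] := @MVT R g (derive_within X g) x y xy _ _.
- move=> z; rewrite in_itv /= => /andP[xz zy]; apply: is_derive_within.
    by apply: dg; rewrite /= in_itv /=; apply/andP; split; lra.
  by apply/andP; split; lra.
- apply: continuous_subspaceW (continuous_within dg) => z /=.
  by rewrite !in_itv /= => /andP[xz zy]; apply/andP; split; lra.
- by move=> z; rewrite in_itv /= => zxy h; exists z.
Qed.

End derivatives_within.

Section mean_value.
Context {R : realType}.

Lemma MVT_derivable (phi : R -> R) (c d x y : R) :
  (forall z, c < z < d -> derivable phi z 1) -> c < x -> y < d -> x < y ->
  exists2 z, x < z < y & phi y - phi x = derive1 phi z * (y - x).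
Proof.
move=> dphi cx yd xy.
have [] := @MVT R phi (derive1 phi) x y xy _ _.
- move=> z; rewrite in_itv /= => /andP[xz zy].
  rewrite derive1E; apply: derivableP; apply: dphi.
  by apply/andP; split; lra.
- apply: derivable_within_continuous => z; rewrite in_itv /= => /andP[xz zy].
  by apply: dphi; apply/andP; split; lra.
- by move=> z; rewrite in_itv /= => zxy h; exists z.
Qed.

(** Mean value theorem without an order between x and y.  The last clause records
    that the intermediate point lies between x and y in the form that later
    estimates need: any ball containing both contains it. *)
Lemma MVT_ball (P : R -> Prop) (phi dphi : R -> R) x y :
  (forall x y z, P x -> P y -> x <= z <= y -> P z) ->
  (forall x y, P x -> P y -> x < y ->
     exists2 z, x < z < y & phi y - phi x = dphi z * (y - x)) ->
  P x -> P y ->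
  exists z, [/\ P z, phi y - phi x = dphi z * (y - x) &
    forall t r : R, `|x - t| <= r -> `|y - t| <= r -> `|z - t| <= r].
Proof.
move=> Pconv mvt Px Py; have [xy|yx|<-] := ltgtP x y.
- have [z /andP[xz zy] ->] := mvt x y Px Py xy; exists z; split => //.
    by apply: (Pconv x y) => //; rewrite !ltW.
  by move=> t r; rewrite !ler_norml => /andP[? ?] /andP[? ?]; lra.
- have [z /andP[xz zy] h] := mvt y x Py Px yx; exists z; split => //.
  + by apply: (Pconv y x) => //; rewrite !ltW.
  + by rewrite -opprB h -mulrN opprB.
  + by move=> t r; rewrite !ler_norml => /andP[? ?] /andP[? ?]; lra.
- by exists x; split => //; rewrite !subrr mulr0.
Qed.

End mean_value.

(** * Quantitative regularity of the iterated function system *)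

(** What is used of (A1)-(A4): [f] maps the interval [a, b] to itself for
    parameters in ]c, d[, [g] stands for its derivative in the point, and [K] is a common
    Lipschitz constant for [g], jointly, and for [f] in the parameter.
    [tame_cauchy] says that the difference quotients in the parameter converge
    uniformly in the point, without naming the derivative. *)
Record tame {R : realType} {m : nat} (c d a b : R)
    (f g : R -> 'I_m.+1 -> R -> R) (K g1 g2 : R) : Prop := Tame {
  tame_consts : [/\ 0 < K, 0 < g1, g1 <= g2 & g2 < 1];
  tame_ab : a <= b <= a + 1;
  tame_in : forall l j x, c < l < d -> a <= x <= b -> a <= f l j x <= b;
  tame_bd : forall l j x, c < l < d -> a <= x <= b -> g1 <= `|g l j x| <= g2;
  tame_mvt : forall l j x y, c < l < d -> a <= x <= b -> a <= y <= b ->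
    exists z, [/\ a <= z <= b, f l j y - f l j x = g l j z * (y - x) &
      forall t r : R, `|x - t| <= r -> `|y - t| <= r -> `|z - t| <= r];
  tame_glip : forall l l' j x y, c < l < d -> c < l' < d ->
    a <= x <= b -> a <= y <= b ->
    `|g l j x - g l' j y| <= K * (`|l - l'| + `|x - y|);
  tame_flip : forall l l' j x, c < l < d -> c < l' < d -> a <= x <= b ->
    `|f l j x - f l' j x| <= K * `|l - l'|;
  tame_cauchy : forall l (e : R), c < l < d -> 0 < e -> exists2 r : R, 0 < r &
    forall l' l'' j x, c < l' < d -> c < l'' < d -> a <= x <= b ->
    0 < `|l' - l| < r -> 0 < `|l'' - l| < r ->
    `|(f l' j x - f l j x) / (l' - l) - (f l'' j x - f l j x) / (l'' - l)| <= e
}.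

Lemma powR_small {R : realType} (C delta e : R) : 0 < C -> 0 < delta -> 0 < e ->
  exists2 r, 0 < r & forall x, 0 <= x < r -> C * x `^ delta <= e.
Proof.
move=> C0 d0 e0; exists ((e / C) `^ delta^-1).
  by rewrite powR_gt0 // divr_gt0.
move=> x /andP[x0 xr].
rewrite mulrC -ler_pdivlMr //.
have -> : e / C = (e / C) `^ delta^-1 `^ delta.
  by rewrite -powRrM mulVf ?gt_eqF // powRr1 // divr_ge0 // ltW.
by rewrite ge0_ler_powR ?nnegrE ?powR_ge0 // ltW.
Qed.

(** All clauses are mean value estimates.  The only bound that no assumption
    provides is that of the derivative in the parameter: on the middle half of
    ]c, d[ the value varies by at most 1, so the derivative is at most
    2 / (d - c) somewhere, and its Hoelder continuity bounds it everywhere. *)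
Lemma tame_of_assumptions (R : realType) (m : nat) (delta : R)
  (a b x0 c d : R) (X U : set R) (f : R -> 'I_m.+1 -> R -> R) :
  0 < delta <= 1 -> X = `[a, b]%classic -> diam X = 1%:E -> X x0 ->
  U = `]c, d[%classic -> c < d -> is_ifs f X U ->
  assumption_A1 f X U delta -> assumption_A2 f X U delta ->
  assumption_A3 f X U delta -> assumption_A4 f X U ->
  exists K g1 g2, tame c d a b f (d_x f X) K g1 g2.
Proof.
move=> /andP[delta0 _] hX hdiam hx0 hU hcd hf [A1a [M1 A1b] _ _].
move=> [A2a [C3 C30 A2b]] [A3a _ [M2 A3c] _ _] [g1 [g2 [g10 g21 hg]]].
have XE x : X x = (a <= x <= b) by rewrite hX /= in_itv.
have UE l : U l = (c < l < d) by rewrite hU /= in_itv.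
have Ucl l : U l -> closure U l by move=> ?; exact: subset_closure.
have X1 x y : X x -> X y -> `|x - y| <= 1.
  move=> Xx Xy; rewrite -lee_fin -hdiam; apply: ereal_sup_ubound.
  by exists x, y; split.
have Xconv x y z : X x -> X y -> x <= z <= y -> X z.
  rewrite !XE => /andP[? ?] /andP[? ?] /andP[? ?].
  by apply/andP; split; lra.
have Uconv x y z : U x -> U y -> x <= z <= y -> U z.
  rewrite !UE => /andP[? ?] /andP[? ?] /andP[? ?].
  by apply/andP; split; lra.
have ab : a <= b by move: hx0; rewrite XE => /andP[]; exact: le_trans.
have mvtx l j x y : U l -> X x -> X y -> x < y ->
    exists2 z, x < z < y & f l j y - f l j x = d_x f X l j z * (y - x).
  move=> Ul Xx Xy xy; rewrite /d_x hX.
  apply: MVT_within => //; rewrite -?hX // => z Xz.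
  by have [+ _ _] := A1a l j (Ucl _ Ul); apply.
have mvtxx l j x y : U l -> X x -> X y -> x < y -> exists2 z, x < z < y &
    d_x f X l j y - d_x f X l j x = d_xx f X l j z * (y - x).
  move=> Ul Xx Xy xy; rewrite /d_xx hX.
  apply: MVT_within => //; rewrite -?hX // => z Xz.
  by have [_ + _] := A1a l j (Ucl _ Ul); apply.
have mvtl j x l l' : X x -> U l -> U l' -> l < l' ->
    exists2 z, l < z < l' & f l' j x - f l j x = d_l f z j x * (l' - l).
  move=> Xx Ul Ul' ll'; rewrite /d_l.
  apply: (@MVT_derivable _ (fun l => f l j x) c d) => //.
  - by move=> z zcd; apply: A2a; rewrite ?UE.
  - by move: Ul; rewrite UE => /andP[].
  - by move: Ul'; rewrite UE => /andP[].
have mvtlx j x l l' : X x -> U l -> U l' -> l < l' -> exists2 z, l < z < l' &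
    d_x f X l' j x - d_x f X l j x = d_lx f X z j x * (l' - l).
  move=> Xx Ul Ul' ll'; rewrite /d_lx.
  apply: (@MVT_derivable _ (fun l => d_x f X l j x) c d) => //.
  - by move=> z zcd; have [] := A3a z j x; rewrite ?UE.
  - by move: Ul; rewrite UE => /andP[].
  - by move: Ul'; rewrite UE => /andP[].
(* the mean value bound at one point, plus the Hoelder variation over ]c, d[ *)
pose D0 := 2 / (d - c) + C3 * (d - c) `^ delta.
have D00 : 0 <= D0.
  by rewrite addr_ge0 ?divr_ge0 ?mulr_ge0 ?powR_ge0 ?subr_ge0 // ltW.
have dlb l j x : U l -> X x -> `|d_l f l j x| <= D0.
  move=> Ul Xx; pose la := c + (d - c) / 4; pose lb := d - (d - c) / 4.
  have Ula : U la by rewrite UE /la; apply/andP; split; lra.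
  have Ulb : U lb by rewrite UE /lb; apply/andP; split; lra.
  have lab : la < lb by rewrite /la /lb; lra.
  have [z /andP[zl zb] hz] := mvtl j x la lb Xx Ula Ulb lab.
  have Uz : U z by apply: (Uconv la lb); rewrite ?ltW.
  have -> : d_l f l j x = d_l f z j x + (d_l f l j x - d_l f z j x).
    by rewrite addrC subrK.
  rewrite (le_trans (ler_normD _ _)) // lerD //.
    rewrite ler_pdivlMr ?subr_gt0 //.
    have : `|f lb j x - f la j x| <= 1.
      by apply: X1; apply: hf => //; exact: Ucl.
    rewrite hz normrM (gtr0_norm (_ : 0 < lb - la)) ?subr_gt0 //.
    rewrite /lb /la; lra.
  rewrite (le_trans (A2b _ _ _ _ Ul Uz Xx)) // ler_wpM2l ?(ltW C30) //.
  rewrite ge0_ler_powR ?nnegrE ?subr_ge0 // ?ltW //.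
  move: Ul Uz; rewrite !UE => /andP[? ?] /andP[? ?].
  by rewrite ltr_norml; apply/andP; split; lra.
pose K := `|M1| + `|M2| + D0 + 1.
have K1 : M1 <= K.
  have := ler_norm M1; have := normr_ge0 M2; rewrite /K; lra.
have K2 : M2 <= K.
  have := ler_norm M2; have := normr_ge0 M1; rewrite /K; lra.
have KD : D0 <= K.
  have := normr_ge0 M2; have := normr_ge0 M1; rewrite /K; lra.
have K0 : 0 < K.
  have := normr_ge0 M2; have := normr_ge0 M1; rewrite /K; lra.
exists K, g1, g2; split.
- split => //; have lU : U ((c + d) / 2) by rewrite UE; apply/andP; split; lra.
  by have /andP[] := hg _ ord0 x0 (Ucl _ lU) hx0; exact: le_trans.
- rewrite ab /=; have Xa : X a by rewrite XE lexx.
  have Xb : X b by rewrite XE lexx andbT.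
  by have := X1 b a Xb Xa; rewrite ler_norml => /andP[_]; lra.
- move=> l j x; rewrite -UE -!XE => Ul Xx.
  by apply: hf => //; exact: Ucl.
- by move=> l j x; rewrite -UE -XE => /Ucl; exact: hg.
- move=> l j x y; rewrite -UE -!XE => Ul Xx Xy.
  have [z [Xz h1 h2]] := MVT_ball Xconv (fun x y => @mvtx l j x y Ul) Xx Xy.
  by exists z; rewrite -XE; split.
- move=> l l' j x y; rewrite -!UE -!XE => Ul Ul' Xx Xy.
  have -> : d_x f X l j x - d_x f X l' j y =
    (d_x f X l j x - d_x f X l' j x) + (d_x f X l' j x - d_x f X l' j y).
    by rewrite addrA subrK.
  rewrite (le_trans (ler_normD _ _)) // mulrDr lerD //.
    have [z [Uz -> _]] := MVT_ball Uconv (fun l l' => @mvtlx j x l l' Xx) Ul' Ul.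
    by rewrite normrM ler_wpM2r // (le_trans (A3c _ _ _ Uz Xx)).
  have [z [Xz -> _]] := MVT_ball Xconv (fun x y => @mvtxx l' j x y Ul') Xy Xx.
  by rewrite normrM ler_wpM2r // (le_trans (A1b _ _ _ Ul' Xz)).
- move=> l l' j x; rewrite -!UE -XE => Ul Ul' Xx.
  have [z [Uz -> _]] := MVT_ball Uconv (fun l l' => @mvtl j x l l' Xx) Ul' Ul.
  by rewrite normrM ler_wpM2r // (le_trans (dlb _ _ _ Uz Xx)).
- move=> l e; rewrite -UE => Ul e0.
  have [r r0 rP] := powR_small C30 delta0 e0.
  exists (r / 2); first by rewrite divr_gt0.
  move=> l' l'' j x; rewrite -!UE -XE => Ul' Ul'' Xx /andP[n1 h1] /andP[n2 h2].
  have [z1 [Uz1 -> b1]] := MVT_ball Uconv (fun l l' => @mvtl j x l l' Xx) Ul Ul'.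
  have [z2 [Uz2 -> b2]] := MVT_ball Uconv (fun l l' => @mvtl j x l l' Xx) Ul Ul''.
  rewrite !mulfK -?normr_gt0 //.
  rewrite (le_trans (A2b _ _ _ _ Uz1 Uz2 Xx)) // rP // normr_ge0 /=.
  have c1 : `|z1 - l| < r / 2.
    by rewrite (le_lt_trans _ h1) // b1 // subrr normr0.
  have c2 : `|l - z2| < r / 2.
    by rewrite distrC (le_lt_trans _ h2) // b2 // subrr normr0.
  have -> : z1 - z2 = (z1 - l) + (l - z2) by rewrite addrA subrK.
  by rewrite (le_lt_trans (ler_normD _ _)) //; lra.
Qed.

Section geometric.
Context {R : realType}.

Lemma geometric_small (C q e : R) : 0 <= q < 1 -> 0 < e ->
  exists N, forall n, (N <= n)%N -> C * q ^+ n < e.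
Proof.
move=> /andP[q0 q1] e0.
have h : C * q ^+ n @[n --> \oo] --> C * 0.
  by apply: cvgMr; apply: cvg_expr; rewrite ger0_norm.
move/cvgrPdist_lt : h => /(_ e e0) [N _ HN]; exists N => n /HN /=.
by rewrite mulr0 sub0r normrN; apply: le_lt_trans; exact: ler_norm.
Qed.

(** Lets a recursive estimate at depth n be stated with an error that decays
    geometrically, and the error be dropped at the end; used for all fixed point
    type estimates on the projection. *)
Lemma ler_geometric (C q x y : R) : 0 <= q < 1 -> (forall n, x <= y + C * q ^+ n) -> x <= y.
Proof.
move=> q01 h; apply/ler_addgt0Pl => e e0.
have [N HN] := geometric_small C q01 e0.
by rewrite (le_trans (h N)) // addrC lerD2r ltW // HN.
Qed.

End geometric.

(** * Natural projection, bounded distortion, transversality *)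

Section projection.
Context {R : realType} {m : nat} {c d a b : R}.
Context {f g : R -> 'I_m.+1 -> R -> R} {K g1 g2 : R}.
Hypothesis H : tame c d a b f g K g1 g2.
Context {x0 : R}.
Hypothesis X0 : a <= x0 <= b.
Local Notation U l := (c < l < d).
Local Notation X x := (a <= x <= b).
Local Notation Pi := (natural_projection f x0).
Implicit Types (l : R) (w : Omega m) (u v : seq 'I_m.+1).

Let K0 : 0 < K. Proof. by have [] := tame_consts H. Qed.
Let g10 : 0 < g1. Proof. by have [] := tame_consts H. Qed.
Let g12 : g1 <= g2. Proof. by have [] := tame_consts H. Qed.
Let g21 : g2 < 1. Proof. by have [] := tame_consts H. Qed.
Let g20 : 0 < g2. Proof. exact: lt_le_trans g12. Qed.
Let g201 : 0 <= g2 < 1. Proof. by rewrite g21 ltW. Qed.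

Lemma X_dist x y : X x -> X y -> `|x - y| <= 1.
Proof.
have /andP[ab ba] := tame_ab H; move=> /andP[? ?] /andP[? ?].
by rewrite ler_norml; apply/andP; split; lra.
Qed.

Lemma f_contr l j x y : U l -> X x -> X y ->
  `|f l j x - f l j y| <= g2 * `|x - y|.
Proof.
move=> Ul Xx Xy; have [z [Xz -> _]] := tame_mvt H j Ul Xy Xx.
by rewrite normrM ler_wpM2r //; have /andP[] := tame_bd H j Ul Xz.
Qed.

Lemma f_word_cat l u v x : f_word f l (u ++ v) x = f_word f l u (f_word f l v x).
Proof. by rewrite /f_word foldr_cat. Qed.

Lemma f_word_in l u x : U l -> X x -> X (f_word f l u x).
Proof. by move=> Ul Xx; elim: u => //= j u IH; exact: tame_in H _ _ _ Ul IH. Qed.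

Lemma f_word_contr l u x y : U l -> X x -> X y ->
  `|f_word f l u x - f_word f l u y| <= g2 ^+ size u.
Proof.
move=> Ul Xx Xy; elim: u => [|j u IH] /=; first by rewrite expr0 X_dist.
rewrite (le_trans (f_contr _ Ul (f_word_in _ Ul Xx) (f_word_in _ Ul Xy))) //.
by rewrite exprS ler_pM2l.
Qed.

Lemma proj_cvg l w : U l -> f_word f l (trunc_word w n) x0 @[n --> \oo] --> Pi l w.
Proof.
move=> Ul; apply: cauchy_cvg; apply: cauchy_exP => e e0.
have [N HN] := geometric_small 1 g201 e0.
exists (f_word f l (trunc_word w N) x0); exists N => // n /= Nn.
rewrite /ball /= -(subnKC Nn) trunc_cat f_word_cat.
rewrite (le_lt_trans (f_word_contr _ Ul X0 (f_word_in _ Ul X0))) // size_trunc.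
by have := HN N (leqnn _); rewrite mul1r.
Qed.

Lemma proj_dist l w n x : U l -> X x ->
  `|Pi l w - f_word f l (trunc_word w n) x| <= g2 ^+ n.
Proof.
move=> Ul Xx; apply/ler_addgt0Pl => e e0.
move/cvgrPdist_lt : (@proj_cvg l w Ul) => /(_ e e0) [N _ HN].
have := HN (n + N)%N (leq_addl _ _); rewrite trunc_cat f_word_cat => h.
have := f_word_contr (trunc_word w n) Ul
  (f_word_in (trunc_word (iter n sft w) N) Ul X0) Xx.
rewrite size_trunc => h2.
rewrite (le_trans (ler_distD (f_word f l (trunc_word w n)
  (f_word f l (trunc_word (iter n sft w) N) x0)) _ _)) //.
by rewrite lerD // ltW.
Qed.

Lemma proj_in l w : U l -> X (Pi l w).
Proof.
move=> Ul; apply/andP; split.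
- apply: (@ler_geometric _ 1 g2) => // n; rewrite mul1r.
  have /andP[h _] := f_word_in (trunc_word w n) Ul X0.
  have := proj_dist w n Ul X0; rewrite ler_norml => /andP[]; lra.
- apply: (@ler_geometric _ 1 g2) => // n; rewrite mul1r.
  have /andP[_ h] := f_word_in (trunc_word w n) Ul X0.
  have := proj_dist w n Ul X0; rewrite ler_norml => /andP[]; lra.
Qed.

Lemma proj_shift l w : U l -> Pi l w = f l (letter w 0) (Pi l (sft w)).
Proof.
move=> Ul; apply/eqP; rewrite -subr_eq0 -normr_le0.
apply: (@ler_geometric _ (2 * g2) g2) => // n; rewrite add0r.
have h1 := proj_dist w n.+1 Ul X0; rewrite truncS /= in h1.
have h2 := f_contr (letter w 0)
  Ul (f_word_in (trunc_word (sft w) n) Ul X0) (proj_in (sft w) Ul).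
have h3 := proj_dist (sft w) n Ul X0; rewrite distrC in h3.
have h4 : g2 * `|f_word f l (trunc_word (sft w) n) x0 - Pi l (sft w)| <= g2 * g2 ^+ n.
  by rewrite ler_pM2l.
rewrite (le_trans (ler_distD (f l (letter w 0) (f_word f l (trunc_word (sft w) n) x0)) _ _)) //.
rewrite exprS in h1; rewrite -mulrA mulr_natl mulr2n lerD //.
exact: le_trans h4.
Qed.

Lemma proj_word l w n : U l ->
  Pi l w = f_word f l (trunc_word w n) (Pi l (iter n sft w)).
Proof.
move=> Ul; elim: n w => [//|n IH] w.
by rewrite [LHS]proj_shift // truncS iterSr /= -IH.
Qed.

Let LipPi := K / (1 - g2).

Lemma LipPi_gt0 : 0 < LipPi.
Proof. by rewrite divr_gt0 // subr_gt0. Qed.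

(** From Pi w = f (Pi (shift w)) the Lipschitz constant L of the projection in the
    parameter satisfies L <= g2 L + K. *)
Lemma proj_lip l l' w : U l -> U l' -> `|Pi l w - Pi l' w| <= LipPi * `|l - l'|.
Proof.
rewrite /LipPi => Ul Ul'; apply: (@ler_geometric _ 1 g2) => // n; rewrite mul1r.
elim: n w => [|n IH] w.
  rewrite expr0 (le_trans (X_dist (proj_in _ Ul) (proj_in _ Ul'))) //.
  by rewrite lerDr mulr_ge0 // divr_ge0 ?subr_ge0 // ltW.
rewrite !(@proj_shift _ w) //.
set p := Pi l (sft w); set q := Pi l' (sft w); set j := letter w 0.
have Xp : X p by exact: proj_in.
have Xq : X q by exact: proj_in.
rewrite (le_trans (ler_distD (f l j q) _ _)) //.
have h1 := f_contr j Ul Xp Xq.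
have h2 := tame_flip H j Ul Ul' Xq.
have h3 : g2 * `|p - q| <= g2 * (K / (1 - g2) * `|l - l'| + g2 ^+ n).
  by rewrite ler_pM2l //; exact: IH.
have h4 : K / (1 - g2) = g2 * (K / (1 - g2)) + K.
  by field; rewrite subr_eq0 gt_eqF.
rewrite {1}h4 exprS; lra.
Qed.

Lemma measurable_proj l : U l -> measurable_fun setT (Pi l).
Proof.
move=> Ul; apply: (@measurable_fun_cvg _ _ _ _
  (fun n w => f_word f l (trunc_word w n) x0)) => [n|w _].
  exact: (@measurable_fun_trunc m _ R n (fun u => f_word f l u x0)).
exact: proj_cvg.
Qed.

(** Its Birkhoff sums are minus the logarithms of the derivatives of the
    composed maps, and its mean is the Lyapunov exponent. *)
Definition potential l w : R := - ln `|g l (letter w 0) (Pi l (sft w))|.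

Lemma potential_bd l w : U l -> - ln g2 <= potential l w <= - ln g1.
Proof.
move=> Ul; have /andP[h1 h2] := tame_bd H (letter w 0) Ul (proj_in (sft w) Ul).
have p0 := lt_le_trans g10 h1.
by rewrite /potential !lerN2 !ler_ln ?posrE // h1 h2.
Qed.

Lemma contraction_rate_gt0 : 0 < - ln g2.
Proof. by rewrite oppr_gt0 ln_lt0 // g20 g21. Qed.

Lemma potential_abs l w : U l -> `|potential l w| <= - ln g1.
Proof.
move=> Ul; have /andP[h1 h2] := potential_bd w Ul.
by rewrite ger0_norm // (le_trans _ h1) // ltW // contraction_rate_gt0.
Qed.

Lemma g_loglip l l' j x y : U l -> U l' -> X x -> X y ->
  `|g l j x| <= expR (K / g1 * (`|l - l'| + `|x - y|)) * `|g l' j y|.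
Proof.
move=> Ul Ul' Xx Xy.
have /andP[p1 _] := tame_bd H j Ul' Xy.
have p0 := lt_le_trans g10 p1.
have := tame_glip H j Ul Ul' Xx Xy.
set D := `|l - l'| + `|x - y| => h.
have D0 : 0 <= D by rewrite addr_ge0.
have h1 : `|g l j x| <= `|g l' j y| + K * D.
  by rewrite -lerBlDl (le_trans (lerB_dist _ _)).
apply: (le_trans h1).
have h2 : K * D <= K / g1 * D * `|g l' j y|.
  have -> : K / g1 * D * `|g l' j y| = K * D * (`|g l' j y| / g1) by ring.
  by rewrite ler_peMr ?mulr_ge0 ?(ltW K0) // ler_pdivlMr // mul1r.
have h3 := expR_ge1Dx (K / g1 * D).
apply: (@le_trans _ _ ((1 + K / g1 * D) * `|g l' j y|)); last by rewrite ler_pM2r.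
by rewrite mulrDl mul1r lerD2l.
Qed.

Lemma measurable_potential l : U l -> measurable_fun setT (potential l).
Proof.
move=> Ul; pose h n w := - ln `|g l (letter w 0) (f_word f l (trunc_word (sft w) n) x0)|.
apply: (@measurable_fun_cvg _ _ _ _ h) => [n|w _].
  pose G (u : seq 'I_m.+1) := if u is j :: u' then - ln `|g l j (f_word f l u' x0)| else 0.
  have -> : h n = (fun w => G (trunc_word w n.+1)).
    by apply/funext => w; rewrite truncS.
  exact: measurable_fun_trunc.
have XF n : X (f_word f l (trunc_word (sft w) n) x0) by exact: f_word_in.
have gc : g l (letter w 0) (f_word f l (trunc_word (sft w) n) x0) @[n --> \oo] -->
   g l (letter w 0) (Pi l (sft w)).
  apply/cvgrPdist_lt => e e0.
  have [N HN] := geometric_small K g201 e0; exists N => // n /= /HN.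
  apply: le_lt_trans.
  rewrite (le_trans (tame_glip H _ Ul Ul (proj_in _ Ul) (XF n))) //.
  by rewrite subrr normr0 add0r ler_pM2l // proj_dist.
have gp : 0 < `|g l (letter w 0) (Pi l (sft w))|.
  have /andP[h1 _] := tame_bd H (letter w 0) Ul (proj_in (sft w) Ul).
  exact: lt_le_trans h1.
rewrite /h /potential; apply: cvgN.
apply: (@continuous_cvg _ _ _ _ _ (fun n => `|g l (letter w 0) (f_word f l (trunc_word (sft w) n) x0)|) (@ln R)).
  exact: continuous_ln.
exact: cvg_norm.
Qed.

(** Absolute value of the derivative of [f_word f l u] at x, as the chain rule
    computes it. *)
Fixpoint deriv_word l u x : R :=
  if u is j :: u' then `|g l j (f_word f l u' x)| * deriv_word l u' x else 1.

Lemma deriv_word_bd l u x : U l -> X x -> g1 ^+ size u <= deriv_word l u x <= g2 ^+ size u.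
Proof.
move=> Ul Xx; elim: u => [|j u /andP[IH1 IH2]] /=; first by rewrite !expr0 lexx.
have /andP[h1 h2] := tame_bd H j Ul (f_word_in u Ul Xx).
have e1 : 0 <= g1 ^+ size u by rewrite exprn_ge0 // ltW.
by rewrite !exprS !ler_pM ?(ltW g10) // (le_trans e1).
Qed.

Lemma deriv_word_gt0 l u x : U l -> X x -> 0 < deriv_word l u x.
Proof.
by move=> Ul Xx; have /andP[+ _] := deriv_word_bd u Ul Xx; apply: lt_le_trans; rewrite exprn_gt0.
Qed.

Lemma f_word_dist l l' u x y : U l -> U l' -> X x -> X y ->
  `|f_word f l u x - f_word f l' u y| <= g2 ^+ size u + LipPi * `|l - l'|.
Proof.
move=> Ul Ul' Xx Xy; elim: u => [|j u IH] /=.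
  rewrite expr0 (le_trans (X_dist Xx Xy)) // lerDl mulr_ge0 //.
  exact: ltW LipPi_gt0.
set p := f_word f l u x in IH *; set q := f_word f l' u y in IH *.
have Xp : X p by exact: f_word_in.
have Xq : X q by exact: f_word_in.
rewrite (le_trans (ler_distD (f l j q) _ _)) //.
have h1 := f_contr j Ul Xp Xq.
have h2 := tame_flip H j Ul Ul' Xq.
have h3 : g2 * `|p - q| <= g2 * (g2 ^+ size u + LipPi * `|l - l'|).
  by rewrite ler_pM2l.
have h4 : LipPi = g2 * LipPi + K.
  by rewrite /LipPi; field; rewrite subr_eq0 gt_eqF.
rewrite {1}h4 exprS; lra.
Qed.

(** Sum over all suffixes of the logarithmic variation K / g1 * g2 ^ k of the
    derivative of one map, on an image of diameter at most g2 ^ k. *)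
Definition distortion : R := K / g1 / (1 - g2).
(** Logarithmic variation of the derivative per letter and per unit of change of
    the parameter: directly, and through the motion of the point at which the
    derivative is taken. *)
Definition drift : R := K / g1 * (1 + LipPi).

Lemma distortion_ge0 : 0 <= distortion.
Proof. by rewrite !divr_ge0 ?subr_ge0 // ltW. Qed.

Lemma drift_ge0 : 0 <= drift.
Proof.
rewrite /drift mulr_ge0 ?divr_ge0 ?(ltW K0) ?(ltW g10) // addr_ge0 //.
exact: ltW LipPi_gt0.
Qed.

Let distortion_step n : K / g1 * g2 ^+ n + distortion * (1 - g2 ^+ n) =
  distortion * (1 - g2 ^+ n.+1).
Proof.
rewrite /distortion exprS; field.
by rewrite subr_eq0 !gt_eqF.
Qed.

(** Bounded distortion: letter by letter the points are at distance at most
    g2 ^ k + LipPi |l - l'|, and the logarithm of each factor is Lipschitz.  The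
    first part sums to a constant, the second is linear in the length. *)
Lemma deriv_word_ratio l l' u x y : U l -> U l' -> X x -> X y ->
  deriv_word l u x <= expR (distortion + drift * `|l - l'| * (size u)%:R) * deriv_word l' u y.
Proof.
move=> Ul Ul' Xx Xy.
(* the truncated geometric sum is what the induction on u reproduces *)
suff h : deriv_word l u x <= expR (distortion * (1 - g2 ^+ size u) +
    drift * `|l - l'| * (size u)%:R) * deriv_word l' u y.
  rewrite (le_trans h) // ler_pM2r ?deriv_word_gt0 // ler_expR lerD2r.
  by rewrite ler_piMr ?distortion_ge0 // gerBl exprn_ge0 // ltW.
elim: u => [|j u IH] /=.
  by rewrite expr0 subrr mulr0 mulr0 addr0 expR0 mul1r.
have Xp : X (f_word f l u x) by exact: f_word_in.
have Xq : X (f_word f l' u y) by exact: f_word_in.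
have h1 := g_loglip j Ul Ul' Xp Xq.
have h2 := f_word_dist u Ul Ul' Xx Xy.
have gq0 : 0 < `|g l' j (f_word f l' u y)|.
  have /andP[+ _] := tame_bd H j Ul' Xq; exact: lt_le_trans.
have h3 : expR (K / g1 * (`|l - l'| + `|f_word f l u x - f_word f l' u y|)) <=
   expR (drift * `|l - l'| + K / g1 * g2 ^+ size u).
  have -> : drift * `|l - l'| + K / g1 * g2 ^+ size u =
     K / g1 * (`|l - l'| + (g2 ^+ size u + LipPi * `|l - l'|)).
    by rewrite /drift; ring.
  by rewrite ler_expR ler_pM2l ?divr_gt0 // lerD2l.
apply: (@le_trans _ _ (expR (drift * `|l - l'| + K / g1 * g2 ^+ size u) *
   `|g l' j (f_word f l' u y)| * (expR (distortion * (1 - g2 ^+ size u) +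
    drift * `|l - l'| * (size u)%:R) * deriv_word l' u y))).
  apply: ler_pM => //; first exact: ltW (deriv_word_gt0 _ _ _).
  by rewrite (le_trans h1) // ler_pM2r.
rewrite le_eqVlt; apply/orP; left; apply/eqP.
rewrite mulrACA -expRD; congr (expR _ * _).
rewrite -distortion_step -natr1; ring.
Qed.

(** The mean value theorem along the word, with distortion controlling the
    position of the intermediate points. *)
Lemma f_word_bilip l u x y z : U l -> X x -> X y -> X z ->
  expR (- distortion) * deriv_word l u z * `|x - y| <= `|f_word f l u x - f_word f l u y|
  <= expR distortion * deriv_word l u z * `|x - y|.
Proof.
move=> Ul Xx Xy Xz.
suff h : expR (- (distortion * (1 - g2 ^+ size u))) * deriv_word l u z * `|x - y| <=
   `|f_word f l u x - f_word f l u y| <=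
   expR (distortion * (1 - g2 ^+ size u)) * deriv_word l u z * `|x - y|.
  have du := deriv_word_gt0 u Ul Xz.
  have hd : distortion * (1 - g2 ^+ size u) <= distortion.
    by rewrite ler_piMr ?distortion_ge0 // gerBl exprn_ge0 // ltW.
  move: h => /andP[h1 h2]; apply/andP; split.
    apply: le_trans h1; rewrite ler_wpM2r // ler_pM2r // ler_expR lerN2 //.
  by apply: (le_trans h2); rewrite ler_wpM2r // ler_pM2r // ler_expR.
elim: u => [|j u /andP[IH1 IH2]] /=.
  by rewrite expr0 subrr mulr0 oppr0 expR0 !mul1r lexx.
set p := f_word f l u x in IH1 IH2 *; set q := f_word f l u y in IH1 IH2 *.
set r := f_word f l u z.
have Xp : X p by exact: f_word_in.
have Xq : X q by exact: f_word_in.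
have Xr : X r by exact: f_word_in.
have [t [Xt -> ht]] := tame_mvt H j Ul Xq Xp.
have tr : `|t - r| <= g2 ^+ size u by apply: ht; apply: f_word_contr.
have gr0 : 0 < `|g l j r|.
  have /andP[+ _] := tame_bd H j Ul Xr; exact: lt_le_trans.
have gt0 : 0 < `|g l j t|.
  have /andP[+ _] := tame_bd H j Ul Xt; exact: lt_le_trans.
have e1 s s' : `|s - s'| <= g2 ^+ size u ->
   expR (K / g1 * (`|l - l| + `|s - s'|)) <= expR (K / g1 * g2 ^+ size u).
  by move=> h; rewrite ler_expR subrr normr0 add0r ler_pM2l ?divr_gt0.
have b1 : `|g l j t| <= expR (K / g1 * g2 ^+ size u) * `|g l j r|.
  by rewrite (le_trans (g_loglip j Ul Ul Xt Xr)) // ler_pM2r // e1.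
have b2 : expR (- (K / g1 * g2 ^+ size u)) * `|g l j r| <= `|g l j t|.
  rewrite expRN mulrC ler_pdivrMr ?expR_gt0 // mulrC.
  by rewrite (le_trans (g_loglip j Ul Ul Xr Xt)) // ler_pM2r // e1 // distrC.
have dz := deriv_word_gt0 u Ul Xz.
rewrite normrM -distortion_step opprD !expRD; apply/andP; split.
- apply: le_trans (ler_pM _ _ b2 IH1); rewrite ?mulr_ge0 ?expR_ge0 ?(ltW gr0) ?(ltW dz) //.
  by rewrite le_eqVlt; apply/orP; left; apply/eqP; ring.
- apply: (le_trans (ler_pM _ _ b1 IH2)) => //.
  by rewrite le_eqVlt; apply/orP; left; apply/eqP; ring.
Qed.

Lemma deriv_word_birkhoff_sum l w n : U l ->
  deriv_word l (trunc_word w n) (Pi l (iter n sft w)) = expR (- birkhoff_sum (potential l) n w).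
Proof.
move=> Ul; elim: n w => [|n IH] w.
  by rewrite /birkhoff_sum big_ord0 oppr0 expR0.
rewrite truncS iterSr /= IH -proj_word // birkhoff_sumS opprD expRD /potential opprK.
rewrite lnK // posrE.
have /andP[+ _] := tame_bd H (letter w 0) Ul (proj_in (sft w) Ul).
exact: lt_le_trans.
Qed.

(** The difference quotients D w at l of the projection of w satisfy
    D w = A + B * D (shift w), where A is a difference quotient of the first map,
    B its derivative at an intermediate point, and |B| <= g2 < 1.  Both A and B
    converge uniformly in w, so two solutions of the recursion are uniformly
    close. *)
Lemma proj_slope_cauchy l (e : R) : U l -> 0 < e -> exists2 r : R, 0 < r &
  forall l' l'' w, U l' -> U l'' -> 0 < `|l' - l| < r -> 0 < `|l'' - l| < r ->
  `|(Pi l' w - Pi l w) / (l' - l) - (Pi l'' w - Pi l w) / (l'' - l)| <= e.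
Proof.
move=> Ul e0.
(* distance at which the difference of the factors B, multiplied by a slope of
   size at most LipPi, is at most e (1 - g2) / 2 *)
pose C := LipPi * K * (2 + 2 * LipPi).
have L0 := LipPi_gt0.
have C0 : 0 < C by rewrite /C mulr_gt0 ?(mulr_gt0 L0 K0) //; lra.
have e20 : 0 < e * (1 - g2) / 2 by rewrite divr_gt0 // mulr_gt0 // subr_gt0.
have [r1 r10 r1P] := tame_cauchy H Ul e20.
exists (Num.min r1 (e * (1 - g2) / 2 / C)).
  by rewrite lt_min r10 divr_gt0.
move=> l' l'' w Ul' Ul''; rewrite !lt_min => /and3P[n1 h1 k1] /and3P[n2 h2 k2].
pose D w (t : R) := (Pi t w - Pi l w) / (t - l).
have Dlip t (v : Omega m) : U t -> 0 < `|t - l| -> `|D v t| <= LipPi.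
  move=> Ut t0; rewrite /D normrM normfV ler_pdivrMr //.
  exact: proj_lip.
have rec t (v : Omega m) : U t -> 0 < `|t - l| -> exists z, [/\ X z,
    `|z - Pi l (sft v)| <= LipPi * `|t - l| &
    D v t = (f t (letter v 0) (Pi l (sft v)) - f l (letter v 0) (Pi l (sft v))) / (t - l)
        + g t (letter v 0) z * D (sft v) t].
  move=> Ut t0.
  have [z [Xz hz bz]] := tame_mvt H (letter v 0) Ut (proj_in (sft v) Ul) (proj_in (sft v) Ut).
  exists z; split => //.
    apply: bz; last exact: proj_lip.
    by rewrite subrr normr0 mulr_ge0 // ltW.
  rewrite /D (proj_shift v Ut) (proj_shift v Ul) mulrA -hz -mulrDl.
  by congr (_ / _); ring.
suff main n (v : Omega m) : `|D v l' - D v l''| <= e + 2 * LipPi * g2 ^+ n.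
  by apply: (@ler_geometric _ (2 * LipPi) g2) => // n; exact: main.
elim: n v => [|n IH] v.
  rewrite expr0 mulr1 (le_trans (ler_normB _ _)) //.
  have := Dlip l' v Ul' n1; have := Dlip l'' v Ul'' n2; lra.
have [z1 [Xz1 bz1 ->]] := rec l' v Ul' n1.
have [z2 [Xz2 bz2 ->]] := rec l'' v Ul'' n2.
set p := Pi l (sft v) in bz1 bz2 *; set j := letter v 0.
have Xp : X p by exact: proj_in.
set A1 := _ / (l' - l); set A2 := _ / (l'' - l).
have hA : `|A1 - A2| <= e * (1 - g2) / 2.
  by apply: r1P => //; apply/andP.
set D1 := D _ l' in IH *; set D2 := D _ l''.
have hD2 : `|D2| <= LipPi by exact: Dlip.
have -> : A1 + g l' j z1 * D1 - (A2 + g l'' j z2 * D2) =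
  (A1 - A2) + (g l' j z1 - g l'' j z2) * D2 + g l' j z1 * (D1 - D2) by ring.
have hg : `|g l' j z1 - g l'' j z2| <= K * (2 + 2 * LipPi) * (e * (1 - g2) / 2 / C).
  rewrite (le_trans (tame_glip H j Ul' Ul'' Xz1 Xz2)) // -mulrA ler_pM2l //.
  rewrite mulrDl lerD //.
    rewrite (le_trans (ler_distD l _ _)) // (distrC l); lra.
  rewrite (le_trans (ler_distD p _ _)) // (distrC p).
  have b1 : LipPi * `|l' - l| <= LipPi * (e * (1 - g2) / 2 / C) by rewrite ler_pM2l // ltW.
  have b2 : LipPi * `|l'' - l| <= LipPi * (e * (1 - g2) / 2 / C) by rewrite ler_pM2l // ltW.
  lra.
have hg2 : `|(g l' j z1 - g l'' j z2) * D2| <= e * (1 - g2) / 2.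
  rewrite normrM (le_trans (ler_pM _ _ hg hD2)) //.
  rewrite le_eqVlt; apply/orP; left; apply/eqP.
  have -> (q : R) : K * (2 + 2 * LipPi) * q * LipPi = q * C by rewrite /C; ring.
  by rewrite divfK // gt_eqF.
have hg3 : `|g l' j z1 * (D1 - D2)| <= g2 * (e + 2 * LipPi * g2 ^+ n).
  rewrite normrM ler_pM //; last exact: IH.
  by have /andP[] := tame_bd H j Ul' Xz1.
rewrite (le_trans (ler_normD _ _)) // (le_trans (lerD (ler_normD _ _) (lexx _))) //.
rewrite exprS; lra.
Qed.

Lemma derivable_proj l w : U l -> derivable (fun t => Pi t w) l 1.
Proof.
move=> Ul; apply: cauchy_cvg; apply: cauchy_exP => e e0.
have e20 : 0 < e / 2 by rewrite divr_gt0.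
have [r r0 rP] := proj_slope_cauchy Ul e20.
have /andP[cl ld] := Ul.
pose s := Num.min r (Num.min (l - c) (d - l)).
have s0 : 0 < s by rewrite !lt_min r0 !subr_gt0 cl ld.
have inU t : `|t| < s -> U (t + l) /\ `|t| < r.
  rewrite !lt_min => /and3P[h1 /ltr_normlP[h2 _] /ltr_normlP[_ h3]].
  by split => //; apply/andP; split; lra.
have q0 : `|s / 2| < s by rewrite gtr0_norm ?divr_gt0 //; lra.
set A := (Pi (s / 2 + l) w - Pi l w) / (s / 2 + l - l).
suff h : \forall t \near (0 : R)^', ball A e (t^-1 *: (Pi (t *: 1 + l) w - Pi l w)).
  by exists A; exact: h.
near=> t.
have t0 : t != 0 by near: t; exact: nbhs_dnbhs_neq.
have ts : `|t| < s by near: t; exact: dnbhs0_lt.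
rewrite /ball /= [t *: 1]mulr1.
have [Ut tr] := inU _ ts; have [Us sr] := inU _ q0.
have -> : t^-1 *: (Pi (t + l) w - Pi l w) = (Pi (t + l) w - Pi l w) / (t + l - l).
  by rewrite addrK mulrC.
rewrite (@le_lt_trans _ _ (e / 2)) //; last by lra.
apply: rP => //; rewrite addrK normr_gt0.
  by rewrite gt_eqF ?divr_gt0.
by rewrite t0.
Unshelve. all: by end_near.
Qed.

(** On an interval so short that the difference phi of the two projections varies
    by less than eta / 2, either |phi| <= rho < eta / 2 nowhere, or |phi| < eta
    throughout; in the second case transversality gives |phi'| >= eta everywhere
    and two parameters with |phi| <= rho are at distance at most 2 rho / eta.  For
    larger rho the whole interval has length O(rho). *)
Lemma transversal_sublevel l0 : U l0 ->
  (exists2 eta : R, 0 < eta & forall l (u v : Omega m), U l ->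
    letter u 0 <> letter v 0 -> `|Pi l u - Pi l v| < eta ->
    eta <= `|derive1 (fun t => Pi t u - Pi t v) l|) ->
  exists (r C : R), [/\ 0 < r, 0 < C, forall l, `|l - l0| < r -> U l &
    forall (u v : Omega m) (rho : R), letter u 0 <> letter v 0 -> 0 < rho ->
    exists y, forall l, `|l - l0| < r -> `|Pi l u - Pi l v| <= rho ->
      `|l - y| <= C * rho].
Proof.
move=> Ul0 [eta eta0 T].
have /andP[cl ld] := Ul0; have L0 := LipPi_gt0.
pose r := Num.min (eta / (8 * LipPi)) (Num.min (l0 - c) (d - l0)).
have r0 : 0 < r.
  by rewrite !lt_min; apply/and3P; split; rewrite ?subr_gt0 // divr_gt0 // mulr_gt0.
have rU l : `|l - l0| < r -> U l.
  rewrite !lt_min => /and3P[_ /ltr_normlP[h2 _] /ltr_normlP[_ h3]].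
  by apply/andP; split; lra.
exists r, (2 / eta + 2 * r / eta); split => //.
  by rewrite addr_gt0 // divr_gt0 // mulr_gt0.
move=> u v rho uv rho0.
pose phi t := Pi t u - Pi t v.
have [rhoeta|rhoeta] := leP (eta / 2) rho.
  exists l0 => l lr _; rewrite (le_trans (ltW lr)) // mulrDl.
  have h1 : r <= 2 * r / eta * rho.
    by rewrite mulrAC ler_pdivlMr //; nra.
  by rewrite (le_trans h1) // lerDr mulr_ge0 ?divr_ge0 // ltW.
have [[y [yr yrho]]|none] := pselect (exists y, `|y - l0| < r /\ `|phi y| <= rho);
  last by exists 0 => l lr lrho; exfalso; apply: none; exists l.
exists y => l lr lrho.
have lip s t : U s -> U t -> `|phi s - phi t| <= 2 * LipPi * `|s - t|.
  move=> Us Ut; have -> : phi s - phi t = (Pi s u - Pi t u) - (Pi s v - Pi t v).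
    by rewrite /phi; ring.
  rewrite (le_trans (ler_normB _ _)) //.
  have := proj_lip u Us Ut; have := proj_lip v Us Ut; lra.
have small t : `|t - l0| < r -> `|phi t| < eta.
  move=> tr.
  have h := lip t y (rU _ tr) (rU _ yr).
  have h2 : `|t - y| < eta / (8 * LipPi) + eta / (8 * LipPi).
    rewrite (le_lt_trans (ler_distD l0 _ _)) // (distrC l0) ltrD //.
      by move: tr; rewrite lt_min => /andP[].
    by move: yr; rewrite lt_min => /andP[].
  have h3 : 2 * LipPi * `|t - y| <= eta / 2.
    have L2 : 0 < 2 * LipPi by rewrite mulr_gt0.
    rewrite mulrC -ler_pdivlMr // (le_trans (ltW h2)) //.
    rewrite le_eqVlt; apply/orP; left; apply/eqP; field.
    by rewrite gt_eqF.
  have -> : phi t = (phi t - phi y) + phi y by rewrite subrK.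
  rewrite (le_lt_trans (ler_normD _ _)) //.
  by lra.
have dphi z : c < z < d -> derivable phi z 1.
  by move=> Uz; apply: derivableB; exact: derivable_proj.
have key s t : `|s - l0| < r -> `|t - l0| < r -> s < t ->
    `|phi s| <= rho -> `|phi t| <= rho -> `|s - t| <= 2 / eta * rho.
  move=> sr tr st hs ht.
  have /andP[cs _] := rU s sr; have /andP[_ td] := rU t tr.
  have [z /andP[sz zt] hz] := MVT_derivable dphi cs td st.
  have zr : `|z - l0| < r.
    move: sr tr; rewrite !ltr_norml => /andP[? ?] /andP[? ?].
    by apply/andP; split; lra.
  have := T z u v (rU _ zr) uv (small z zr); rewrite -/phi => hT.
  have h1 : `|phi t - phi s| <= 2 * rho by rewrite (le_trans (ler_normB _ _)) //; lra.
  move: h1; rewrite hz normrM => h1.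
  rewrite mulrAC ler_pdivlMr // mulrC distrC (le_trans _ h1) //.
  by rewrite ler_wpM2r.
apply: (@le_trans _ _ (2 / eta * rho)); last first.
  by rewrite ler_wpM2r ?(ltW rho0) // lerDl divr_ge0 ?mulr_ge0 // ltW.
have [ly|yl|->] := ltgtP l y.
- exact: key.
- by rewrite distrC; exact: key.
- by rewrite subrr normr0 mulr_ge0 ?divr_ge0 // ltW.
Qed.

End projection.

Arguments potential {R m} f g x0 l w.
Arguments deriv_word {R m} f g l u x.
Arguments distortion {R} K g1 g2.
Arguments drift {R} K g1 g2.

(** * Covers by balls and mass distribution *)

Section hausdorff_theory.
Context {R : realType}.
Implicit Types (A E : set R) (s r t : R).

Lemma le_nneseries (u : (\bar R)^nat) (B : \bar R) : (forall i, 0 <= u i)%E ->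
  (forall M, \sum_(0 <= i < M) u i <= B)%E -> (\sum_(i <oo) u i <= B)%E.
Proof.
move=> u0 uB; apply: lime_le; last exact: nearW.
exact: is_cvg_nneseries.
Qed.

Lemma diam_pow_ge0 s E : (0 <= diam_pow s E)%E.
Proof. by rewrite /diam_pow; case: ifP => // _; exact: poweR_ge0. Qed.

Lemma diam_ge E x y : E x -> E y -> (`|x - y|%:E <= diam E)%E.
Proof. by move=> Ex Ey; apply: ereal_sup_ubound; exists x, y. Qed.

Lemma diam_le E r : (forall x y, E x -> E y -> `|x - y| <= r) -> (diam E <= r%:E)%E.
Proof.
by move=> h; apply: ge_ereal_sup => _ [x [y [Ex Ey ->]]]; rewrite lee_fin h.
Qed.

Lemma diam_pow_le E s r : 0 <= s -> 0 <= r ->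
  (forall x y, E x -> E y -> `|x - y| <= r) -> (diam_pow s E <= (r `^ s)%:E)%E.
Proof.
move=> s0 r0 h; rewrite /diam_pow; case: ifPn => [_|/set0P[x Ex]].
  by rewrite lee_fin powR_ge0.
rewrite -poweR_EFin; apply: gt0_ler_poweR => //.
- rewrite /= in_itv /= leey andbT (le_trans _ (diam_ge Ex Ex)) //.
- by rewrite /= in_itv /= leey andbT lee_fin.
- exact: diam_le.
Qed.

Lemma hausdorff_content_ge0 s r A : (0 <= hausdorff_content s r A)%E.
Proof.
apply: le_ereal_inf_tmp => _ [E _ <-]; apply: nneseries_ge0 => i _ _.
exact: diam_pow_ge0.
Qed.

(** The balls of order at least N cover the lim sup, and the sum of their
    diameters to the power s is the tail of a convergent geometric series. *)
Lemma hausdorff_limsup_null s (cs : nat -> seq R) (r : nat -> R) (C q : R) :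
  0 < s -> 0 <= C -> 0 <= q < 1 -> (forall n, 0 <= r n) ->
  (forall e, 0 < e -> exists N, forall n, (N <= n)%N -> 2 * r n <= e) ->
  (forall n, (size (cs n))%:R * (2 * r n) `^ s <= C * q ^+ n) ->
  hausdorff_measure s [set x | forall N, exists2 n, (N <= n)%N &
     exists2 c, c \in cs n & `|x - c| <= r n] = 0%E.
Proof.
move=> s0 C0 /andP[q0 q1] r0 rlim cover; set A := [set x | _].
suff h rr e : 0 < rr -> 0 < e -> (hausdorff_content s rr A <= e%:E)%E.
  apply/eqP; rewrite eq_le; apply/andP; split.
    apply: ge_ereal_sup => _ [rr /= rr0 <-].
    by apply/lee_addgt0Pr => e e0; rewrite add0e h.
  apply: (le_trans (hausdorff_content_ge0 s 1 A)).
  by apply: ereal_sup_ubound; exists 1 => //=; exact: ltr01.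
move=> rr0 e0.
have [N1 HN1] := rlim rr rr0.
have [N2 HN2] := @geometric_small R (C / (1 - q)) q e (introT andP (conj q0 q1)) e0.
pose N := maxn N1 N2.
(* all balls of order at least N, enumerated by pairs (order, index) *)
pose Eb (p : nat * nat) : set R := if (N <= p.1)%N && (p.2 < size (cs p.1))%N then
  [set x | `|x - nth 0 (cs p.1) p.2| <= r p.1] else set0.
have : ([set: nat] #= [set: nat * nat])%card by rewrite card_eq_sym; exact: card_nat2.
move=> /card_set_bijP[h hbij].
have bound p x y : Eb p x -> Eb p y -> `|x - y| <= 2 * r p.1.
  rewrite /Eb; case: ifP => // _ /= hx hy.
  by rewrite (le_trans (ler_distD (nth 0 (cs p.1) p.2) _ _)) // (distrC _ y); lra.
apply: (@le_trans _ _ (\sum_(i <oo) diam_pow s (Eb (h i)))%E).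
  apply: ereal_inf_lbound; exists (Eb \o h) => //; split.
  - move=> x Ax; have [n Nn [c cn xc]] := Ax N.
    have [_ _ /(_ (n, index c (cs n)) I)[i _ hi]] := hbij.
    exists i => //=; rewrite hi /Eb /= Nn index_mem cn /= nth_index //.
  - move=> i /=; have [Ni|Ni] := boolP (N <= (h i).1)%N; last first.
      by apply: diam_le => x y; rewrite /Eb (negbTE Ni).
    apply: diam_le => x y Ex Ey; rewrite (le_trans (bound _ _ _ Ex Ey)) //.
    by apply: HN1; rewrite (leq_trans _ Ni) // leq_maxl.
rewrite nneseries_esumT; last by move=> i; exact: diam_pow_ge0.
rewrite -(@reindex_esum R _ _ setT setT h (fun p => diam_pow s (Eb p)) hbij).
have -> : [set: nat * nat] = setT `*`` (fun=> setT) by apply/seteqP; split.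
have -> : \esum_(j in setT `*`` (fun=> setT)) diam_pow s (Eb j) =
    \esum_(n in [set: nat]) \esum_(k in [set: nat]) diam_pow s (Eb (n, k)).
  rewrite esum_esum; first by apply: eq_esum => -[].
  by move=> *; exact: diam_pow_ge0.
rewrite -nneseries_esumT; last first.
  by move=> n; apply: esum_ge0 => k _; exact: diam_pow_ge0.
apply: le_nneseries => [n|M].
  by apply: esum_ge0 => k _; exact: diam_pow_ge0.
have inner n : (\esum_(j in [set: nat]) diam_pow s (Eb (n, j)) <=
    ((N <= n)%N%:R * (C * q ^+ n))%:E)%E.
  rewrite -nneseries_esumT; last by move=> k; exact: diam_pow_ge0.
  apply: le_nneseries => [k|L]; first exact: diam_pow_ge0.
  have [Nn|Nn] := boolP (N <= n)%N; last first.
    rewrite mul0r big1 // => k _; rewrite /Eb (negbTE Nn) /diam_pow /=.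
    by rewrite eqxx.
  rewrite mul1r; apply: (@le_trans _ _ ((size (cs n))%:R * (2 * r n) `^ s)%:E);
    last by rewrite lee_fin.
  apply: (@le_trans _ _ (\sum_(0 <= k < L) ((k < size (cs n))%N%:R * (2 * r n) `^ s)%:E)%E).
    apply: lee_sum => k _; case: (ltnP k (size (cs n))) => kn.
      rewrite mul1r; apply: diam_pow_le => //; [exact: ltW|exact: mulr_ge0|].
      by move=> x y; apply: (bound (n, k)).
    by rewrite /Eb /= ltnNge kn andbF /diam_pow eqxx mul0r.
  rewrite sumEFin lee_fin -mulr_suml -natr_sum ler_wpM2r ?powR_ge0 // ler_nat.
  apply: (@leq_trans (minn L (size (cs n)))); last exact: geq_minr.
  elim: L => [|L IH]; first by rewrite big_geq // min0n.
  rewrite big_nat_recr //=; move: IH; set S := \sum_(_ <= _ < _) _; move: S (size _) => S z.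
  lia.
apply: (@le_trans _ _ (\sum_(0 <= n < M) ((N <= n)%N%:R * (C * q ^+ n))%:E)%E).
  exact: lee_sum.
rewrite sumEFin lee_fin.
apply: (@le_trans _ _ (C / (1 - q) * (q ^+ N - q ^+ (maxn N M)))).
  elim: M => [|M IH].
    by rewrite big_geq // maxn0 subrr mulr0.
  rewrite big_nat_recr //=.
  have [NM|MN] := leqP N M; last first.
    rewrite mul0r addr0 (le_trans IH) // (maxn_idPl MN).
    by rewrite (maxn_idPl (ltnW MN)).
  move: IH; rewrite mul1r (maxn_idPr (leqW NM)) (maxn_idPr NM) => IH.
  rewrite (le_trans (lerD IH (lexx _))) // exprS.
  rewrite le_eqVlt; apply/orP; left; apply/eqP; field.
  by rewrite subr_eq0 gt_eqF.
apply: (@le_trans _ _ (C / (1 - q) * q ^+ N)).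
  rewrite ler_wpM2l ?divr_ge0 ?subr_ge0 ?(ltW q1) //.
  by rewrite gerBl exprn_ge0.
by rewrite ltW // HN2 // leq_maxr.
Qed.

Lemma dyadic_scale (k0 : nat) (rho : R) : 0 < rho -> rho <= 2^-1 ^+ k0 ->
  exists2 k, (k0 <= k)%N & 2^-1 ^+ k.+1 < rho <= 2^-1 ^+ k.
Proof.
move=> rho0 rhok.
have h01 : 0 <= (2^-1 : R) < 1.
  by rewrite invr_ge0 ler0n /= invf_lt1 // ltr1n.
have [N HN] := geometric_small 1 h01 rho0.
pose Q k := 2^-1 ^+ k.+1 < rho.
have exQ : exists k, Q k by exists N; have := HN N.+1 (leqnSn N); rewrite mul1r.
case: (ex_minnP exQ) => k Qk kmin; exists k.
  rewrite leqNgt; apply/negP => kk0; move: Qk; rewrite /Q ltNge => /negP; apply.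
  rewrite (le_trans rhok) //.
  by rewrite ler_wiXn2l // ?invr_ge0 // invf_le1 // ler1n.
apply/andP; split => //; case: k Qk kmin => [|k] Qk kmin.
  rewrite expr0 (le_trans rhok) // exprn_ile1 ?invr_ge0 // invf_le1 // ler1n //.
rewrite leNgt; apply/negP => h.
by have := kmin k h; rewrite ltnn.
Qed.

(** Mass distribution principle on the symbolic side.  If s < t and the
    s-dimensional measure of A vanishes, cover A by sets E i with small sum of
    diam ^ s.  Each E i that meets the projection of G at a point lies in a dyadic
    ball around it of comparable radius, so the part of G projected into E i has
    probability at most (2 diam) ^ t, which is O(diam ^ s); adding up, G would
    have arbitrarily small probability.  Only points of G have to satisfy the
    Frostman condition, and the sets B replace preimages of balls because they
    will be unions of cylinders. *)
Lemma hausdorff_dim_ge d (T : measurableType d) (P : probability T R)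
    (Pi : T -> R) (G : set T) t (k0 : nat) : 0 < t -> measurable G ->
  (0 < P G)%E ->
  (forall k w, (k0 <= k)%N -> G w -> exists B, [/\ measurable B,
    forall w', G w' -> `|Pi w' - Pi w| <= 2^-1 ^+ k -> B w' &
    (P B <= ((2^-1 ^+ k) `^ t)%:E)%E]) ->
  forall A, measurable (Pi @^-1` A) -> P (~` (Pi @^-1` A)) = 0%E ->
  (t%:E <= hausdorff_dim A)%E.
Proof.
move=> t0 mG PG loc A mA PA.
apply: le_ereal_inf_tmp => _ [s [s0 HA] <-].
rewrite lee_fin leNgt; apply/negP => st.
have h01 : 0 <= (2^-1 : R) < 1.
  by rewrite invr_ge0 ler0n /= invf_lt1 // ltr1n.
have hk0 k : 0 < (2^-1 : R) ^+ k by rewrite exprn_gt0.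
have Hc : (hausdorff_content s (2^-1 ^+ k0) A <= 0)%E.
  rewrite -HA; apply: ereal_sup_ubound; exists (2^-1 ^+ k0) => //=.
have PGf : P G = (fine (P G))%:E by rewrite fineK // fin_num_measure.
set pG := fine (P G) in PGf; have pG0 : 0 < pG by rewrite -lte_fin -PGf.
(* half of the mass of G is the contradiction aimed at: the cover costs
   2 ^ t e, and e in total is spent on sets of diameter 0 *)
pose e := pG / (2 * (2 `^ t + 1)).
have t20 : 0 < 2 `^ t :> R by rewrite powR_gt0.
have e0 : 0 < e by rewrite divr_gt0 // mulr_gt0 // addr_gt0.
have [_ [E [AE Er] <-] He] : exists2 x, [set \sum_(0 <= i <oo) diam_pow s (E i) |
    E in [set E : nat -> set R |
      A `<=` \bigcup_i E i /\ forall i, (diam (E i) <= (2^-1 ^+ k0)%:E)%E]]%E x &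
    (x < e%:E)%E.
  by apply: ereal_inf_lt; rewrite (le_lt_trans Hc) // lte_fin.
have pt1 E' : (0 <= (2 `^ t)%:E * diam_pow s E')%E.
  by rewrite mule_ge0 ?lee_fin ?powR_ge0 ?diam_pow_ge0.
have coverB i : exists B, [/\ measurable B,
    (forall w, G w -> E i (Pi w) -> B w) &
    (P B <= (2 `^ t)%:E * diam_pow s (E i) + (e / (2 ^ i.+1)%:R)%:E)%E].
  have ei0 : 0 < e / (2 ^ i.+1)%:R by rewrite divr_gt0 // ltr0n expn_gt0.
  have [[w [Gw Ew]]|none] := pselect (exists w, G w /\ E i (Pi w)); last first.
    exists set0; split => //.
      by move=> w Gw Ew; apply: none; exists w.
    by rewrite measure0 adde_ge0 // lee_fin ltW //.
  have dk : (diam (E i) <= (2^-1 ^+ k0)%:E)%E by exact: Er.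
  have d0 : (0%:E <= diam (E i))%E by have := diam_ge Ew Ew; rewrite subrr normr0.
  have dE : diam (E i) = (fine (diam (E i)))%:E.
    by rewrite fineK // ge0_fin_numE // (le_lt_trans dk) // ltry.
  set rho := fine (diam (E i)) in dE.
  have rho0 : 0 <= rho by rewrite -lee_fin -dE.
  have rhok : rho <= 2^-1 ^+ k0 by rewrite -lee_fin -dE.
  have dp : diam_pow s (E i) = (rho `^ s)%:E.
    rewrite /diam_pow ifF ?dE ?poweR_EFin //.
    by apply/negP => /eqP E0; rewrite E0 in Ew.
  move: rho0; rewrite le_eqVlt => /predU1P[rho0|rho0].
    have q01 : 0 <= (2^-1 : R) `^ t < 1.
      have one : (1 : R) `^ t = 1 by rewrite powR1.
      rewrite powR_ge0 /= -[ltRHS]one gt0_ltr_powR ?nnegrE //.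
      by rewrite invf_lt1 // ltr1n.
    (* a set of diameter 0: use a ball so small that it costs less than the share
       of e reserved for i *)
    have [N HN] := geometric_small 1 q01 ei0.
    have [B [mB GB PB]] := loc (maxn k0 N) w (leq_maxl _ _) Gw.
    exists B; split => // [w' Gw' Ew'|].
      apply: GB => //; apply: (@le_trans _ _ rho); last by rewrite -rho0 ltW.
      by rewrite -lee_fin -dE diam_ge.
    rewrite (le_trans PB) // -[leLHS]add0e leeD // lee_fin.
    rewrite -powR_mulrn ?invr_ge0 // powRAC powR_mulrn ?powR_ge0 //.
    by have := HN (maxn k0 N) (leq_maxr _ _); rewrite mul1r => /ltW.
  have [k k0k /andP[rk kr]] := dyadic_scale rho0 rhok.
  have [B [mB GB PB]] := loc k w k0k Gw.
  exists B; split => // [w' Gw' Ew'|].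
    by apply: GB => //; rewrite (le_trans _ kr) // -lee_fin -dE diam_ge.
  rewrite (le_trans PB) // -[leLHS]adde0 leeD //; last by rewrite lee_fin ltW.
  rewrite dp -EFinM lee_fin.
  have rho1 : rho <= 1.
    by rewrite (le_trans rhok) // exprn_ile1 ?invr_ge0 // invf_le1 // ler1n.
  apply: (@le_trans _ _ ((2 * rho) `^ t)).
    apply: ge0_ler_powR; rewrite ?nnegrE ?(ltW t0) ?mulr_ge0 ?(ltW rho0) //.
    by rewrite (le_trans _ (_ : 2 * 2^-1 ^+ k.+1 <= _)) ?ler_pM2l ?(ltW rk) // exprS mulrA mulfV // mul1r.
  rewrite powRM ?(ltW rho0) // ler_pM2l //.
  by apply: ger_powR; [rewrite rho0|exact: ltW].
pose B i := sval (cid (coverB i)).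
have mB i : measurable (B i) by rewrite /B; case: cid => B' /= [].
have GB i w : G w -> E i (Pi w) -> B i w by rewrite /B; case: cid => B' /= [_ h _]; exact: h.
have PB i : (P (B i) <= (2 `^ t)%:E * diam_pow s (E i) + (e / (2 ^ i.+1)%:R)%:E)%E.
  by rewrite /B; case: cid => B' /= [].
have PGle : (P G <= P (\bigcup_i B i))%E.
  apply: (@le_trans _ _ (P ((\bigcup_i B i) `|` ~` (Pi @^-1` A)))).
    rewrite le_measure ?inE //.
      by apply: measurableU; [exact: bigcup_measurable|exact: measurableC].
    move=> w Gw; have [Aw|nAw] := pselect (A (Pi w)); last by right.
    by left; have [i _ Ei] := AE _ Aw; exists i => //; exact: GB.
  have h0 : (P ((\bigcup_i B i) `|` ~` (Pi @^-1` A)) <=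
      P (\bigcup_i B i) + P (~` (Pi @^-1` A)))%E.
    by apply: measureU2; [exact: bigcup_measurable|exact: measurableC].
  by rewrite (le_trans h0) // PA adde0.
have : (P G <= (2 `^ t)%:E * e%:E + e%:E)%E.
  have h0 : (P (\bigcup_i B i) <= \sum_(i <oo) P (B i))%E.
    by apply: measure_sigma_subadditive => //; exact: bigcup_measurable.
  rewrite (le_trans PGle) // (le_trans h0) //.
  rewrite (le_trans (lee_nneseries _ (fun i _ => PB i))) //.
  rewrite (le_trans (epsilon_trick _ _ (ltW e0))) //.
  rewrite leeD2r // nneseriesZl //; last by move=> i _; exact: diam_pow_ge0.
  by rewrite lee_pmul2l ?lte_fin // ltW.
rewrite PGf -EFinM -EFinD lee_fin => h.
have : (2 `^ t + 1) * e = pG / 2 by rewrite /e; field; rewrite gt_eqF // addr_gt0.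
nra.
Qed.

End hausdorff_theory.

(** * Upper bound for the dimension *)

Section upper_bound.
Context {R : realType}.

Lemma measure_dim_le (nu : set R -> \bar R) (A : set R) (s : R) :
  measurable A -> nu (~` A) = 0%E -> 0 <= s -> hausdorff_measure s A = 0%E ->
  (measure_hausdorff_dim nu <= s%:E)%E.
Proof.
move=> mA nuA s0 HA; apply: (@le_trans _ _ (hausdorff_dim A)).
  by apply: ereal_inf_lbound; exists A.
by apply: ereal_inf_lbound; exists s.
Qed.

Lemma measurable_balls (cs : seq R) (r : R) :
  measurable [set x | exists2 c, c \in cs & `|x - c| <= r].
Proof.
have -> : [set x | exists2 c, c \in cs & `|x - c| <= r] =
    \bigcup_(c in [set` cs]) `[c - r, c + r]%classic.
  apply/seteqP; split => x /=.
    by move=> [c cc h]; exists c => //=; rewrite in_itv /= -ler_distlC distrC.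
  by move=> [c cc] /=; rewrite in_itv /= -ler_distlC distrC => h; exists c.
by apply: fin_bigcup_measurable => [|c _]; [exact: finite_seq|exact: measurable_itv].
Qed.

Lemma measurable_limsup_balls (cs : nat -> seq R) (r : nat -> R) :
  measurable [set x | forall N, exists2 n, (N <= n)%N &
     exists2 c, c \in cs n & `|x - c| <= r n].
Proof.
have -> : [set x | forall N, exists2 n, (N <= n)%N &
     exists2 c, c \in cs n & `|x - c| <= r n] =
  lim_sup_set (fun n => [set x | exists2 c, c \in cs n & `|x - c| <= r n]).
  by apply/seteqP; split => x; rewrite lim_supP.
apply: bigcap_measurable => // k _; apply: bigcup_measurable => n _.
exact: measurable_balls.
Qed.

Lemma powR_exprn (x s : R) n : 0 <= x -> (x ^+ n) `^ s = (x `^ s) ^+ n.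
Proof. by move=> x_ge0; rewrite -powR_mulrn // powRAC powR_mulrn // powR_ge0. Qed.

Context {m : nat} {c d a b : R}.
Context {f g : R -> 'I_m.+1 -> R -> R} {K g1 g2 : R}.
Hypothesis H : tame c d a b f g K g1 g2.
Context {x0 : R}.
Hypothesis X0 : a <= x0 <= b.
Local Notation Pi := (natural_projection f x0).
Variable P : probability (Omega m) R.
Hypotheses (Pinv : shift_invariant P) (Perg : ergodic P).
Local Notation E f := (\int[P]_(w in setT) f w).
Variable l : R.
Hypothesis Ul : c < l < d.
Local Notation phi := (potential f g x0 l).
Local Notation chi := (E phi).

Lemma integrable_potential : P.-integrable setT (EFin \o phi).
Proof.
apply: (@bounded_integrable _ _ _ P _ (- ln g1)).
  exact: (measurable_potential H X0 Ul).
by move=> w; exact: (potential_abs H X0 w Ul).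
Qed.

Lemma lyapunov_ge : - ln g2 <= chi.
Proof.
rewrite -[leLHS](mean_cst P); apply: le_Rintegral => //.
- by apply: (@bounded_integrable _ _ _ P _ `|- ln g2|) => //; exact: measurable_cst.
- exact: integrable_potential.
- by move=> w _; have /andP[] := potential_bd H X0 w Ul.
Qed.

Lemma birkhoff_potential_lb (e : R) : 0 < e ->
  {ae P, forall w, exists N, forall n, (N <= n)%N ->
     n%:R * (chi - e) <= birkhoff_sum phi n w}.
Proof.
move=> e0; have mphi := measurable_potential H X0 Ul.
have iphi := integrable_potential.
have EN : E (fun w => - phi w) = - chi.
  transitivity (E (fun w => (-1) * phi w)).
    by apply: eq_Rintegral => w _; rewrite mulN1r.
  by rewrite RintegralZl // mulN1r.
have bd w : `|- phi w| <= - ln g1 by rewrite normrN; exact: (potential_abs H X0 w Ul).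
have mN : measurable_fun setT (fun w => - phi w) by exact: measurableT_comp.
have lt : E (fun w => - phi w) < - chi + e by rewrite EN ltrDl.
have := birkhoff_ub Pinv Perg mN bd lt.
apply: filterS => w [N HN]; exists N => n /HN.
rewrite /birkhoff_sum sumrN; lra.
Qed.

Lemma birkhoff_potential_ub (e : R) : 0 < e ->
  {ae P, forall w, exists N, forall n, (N <= n)%N ->
     birkhoff_sum phi n w <= n%:R * (chi + e)}.
Proof.
move=> e0; apply: (birkhoff_ub Pinv Perg (measurable_potential H X0 Ul)).
  by move=> w; apply: (potential_abs H X0 w Ul).
by rewrite ltrDl.
Qed.

Lemma ae_pushforward0 (A : set R) : measurable A ->
  {ae P, forall w, A (Pi l w)} -> pushforward P (Pi l) (~` A) = 0%E.
Proof.
move=> mA aeA; rewrite /pushforward.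
have mB : measurable (Pi l @^-1` (~` A)).
  rewrite -[_ @^-1` _]setTI; apply: (measurable_proj H X0 Ul) => //.
  exact: measurableC.
exact: (@measure_negligible _ _ _ P _ mB aeA).
Qed.

(** Cover the interval by 2 ^ n + 1 balls of radius 2 ^ -n; the lim sup form of
    the covering lemma is used although all orders cover every point. *)
Lemma dim_le1 : (measure_hausdorff_dim (pushforward P (Pi l)) <= 1)%E.
Proof.
apply/lee_addgt0Pr => e e0; rewrite -EFinD.
pose cs n : seq R := [seq a + k%:R * 2^-1 ^+ n | k <- iota 0 (2 ^ n).+1].
pose r n : R := 2^-1 ^+ n.
have e1 : 0 < 1 + e by rewrite addr_gt0.
have h01 : 0 <= (2^-1 : R) < 1.
  by rewrite invr_ge0 ler0n /= invf_lt1 // ltr1n.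
pose A := [set x | forall N, exists2 n, (N <= n)%N &
     exists2 c, c \in cs n & `|x - c| <= r n].
apply: (@measure_dim_le _ A) => //; [exact: measurable_limsup_balls| |exact: ltW|].
  apply: ae_pushforward0; first exact: measurable_limsup_balls.
  apply: aeW => w N; exists N => //.
  have /andP[ax xb] := proj_in H X0 w Ul.
  have /andP[_ ba] := tame_ab H.
  set x := Pi l w in ax xb *.
  pose k := Num.truncn ((x - a) * 2 ^+ N).
  have p2 : 0 < 2 ^+ N :> R by rewrite exprn_gt0.
  have xa0 : 0 <= (x - a) * 2 ^+ N by rewrite mulr_ge0 ?subr_ge0 // ltW.
  have /andP[k1 k2] := truncn_itv xa0.
  exists (a + k%:R * 2^-1 ^+ N).
    apply/mapP; exists k => //; rewrite mem_iota /= add0n ltnS.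
    rewrite -(ler_nat R) (le_trans k1) // natrX ler_piMl ?(ltW p2) //; lra.
  have -> : x - (a + k%:R * 2^-1 ^+ N) = ((x - a) * 2 ^+ N - k%:R) * 2^-1 ^+ N.
    by rewrite mulrBl exprVn mulfK ?gt_eqF // opprD addrA.
  rewrite normrM /r (ger0_norm (_ : 0 <= 2^-1 ^+ N)) ?exprn_ge0 ?invr_ge0 //.
  rewrite ler_piMl ?exprn_ge0 ?invr_ge0 // ger0_norm ?subr_ge0 //.
  by move: k2; rewrite -/k -natr1; lra.
apply: (@hausdorff_limsup_null _ _ _ _ (2 * 2 `^ (1 + e)) (2^-1 `^ e)) => //.
- have one : (1 : R) `^ e = 1 by rewrite powR1.
  rewrite powR_ge0 /= -[ltRHS]one gt0_ltr_powR ?nnegrE //.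
  by rewrite invf_lt1 // ltr1n.
- by move=> n; rewrite /r exprn_ge0 // invr_ge0.
- move=> e' e'0; have [N HN] := geometric_small 2 h01 e'0.
  by exists N => n /HN /ltW.
- move=> n; rewrite size_map size_iota.
  rewrite powRM ?exprn_ge0 ?invr_ge0 // powR_exprn ?invr_ge0 //.
  have -> : 2^-1 `^ (1 + e) = 2^-1 * 2^-1 `^ e :> R.
    by rewrite powRD ?powRr1 ?invr_ge0 //; apply/implyP => _; rewrite invr_neq0.
  rewrite exprMn; set q := 2^-1 `^ e; set p := 2 `^ (1 + e).
  have -> : (2 ^ n).+1%:R * (p * (2^-1 ^+ n * q ^+ n)) =
     (2 ^ n).+1%:R * 2^-1 ^+ n * (p * q ^+ n) by ring.
  rewrite -[leRHS]mulrA ler_wpM2r ?mulr_ge0 ?exprn_ge0 ?powR_ge0 //.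
  rewrite exprVn ler_pdivrMr ?exprn_gt0 // -natrX -natrM ler_nat.
  by rewrite mul2n -addnn -addn1 leq_add2l expn_gt0.
Qed.

(** Cover by balls around f_u x0, over the words u of length n with probability at
    least e^(-n (h + e)) and derivative at most e^(-n (chi - e)) up to distortion.
    There are at most e^(n (h + e)) of them, since their probabilities add up to
    at most 1; almost every point has infinitely many such prefixes, and
    h + e < s (chi - e) makes the cover efficient. *)
Lemma dim_le_ratio (s : R) : entropy P / chi < s ->
  (measure_hausdorff_dim (pushforward P (Pi l)) <= s%:E)%E.
Proof.
move=> hs.
have lg := contraction_rate_gt0 H.
have chi0 : 0 < chi by apply: lt_le_trans lyapunov_ge.
have h0 : 0 <= entropy P by exact: entropy_ge0.
set h := entropy P in hs h0 *.
have s0 : 0 < s by apply: le_lt_trans hs; rewrite divr_ge0 // ltW.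
have hs' : h < s * chi by rewrite -ltr_pdivrMr.
(* half of the value at which h + e and s (chi - e) agree *)
pose e := (s * chi - h) / (2 * (1 + s)).
have s1 : 0 < 1 + s by rewrite addr_gt0.
have e0 : 0 < e by rewrite divr_gt0 ?mulr_gt0 // subr_gt0.
have ee : e * (1 + s) = (s * chi - h) / 2.
  by rewrite /e; field; rewrite gt_eqF.
have gap : h + e < s * (chi - e) by nra.
have chie : 0 < chi - e.
  by rewrite -(pmulr_rgt0 _ s0); apply: le_lt_trans gap; rewrite addr_ge0 // ltW.
pose D := distortion K g1 g2.
pose p := cylprob P.
pose good n (t : n.-tuple 'I_m.+1) :=
  (expR (- (n%:R * (h + e))) <= p t) && (deriv_word f g l t x0 <= expR (D - n%:R * (chi - e))).
pose F n : seq (seq 'I_m.+1) := [seq val t | t <- [seq t <- enum {: n.-tuple 'I_m.+1} | good _ t]].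
pose cs n := [seq f_word f l u x0 | u <- F n].
pose r n := expR (2 * D) * expR (- (chi - e)) ^+ n.
pose A := [set x | forall N, exists2 n, (N <= n)%N &
     exists2 c, c \in cs n & `|x - c| <= r n].
have sizeF n : (size (F n))%:R <= expR (n%:R * (h + e)).
  rewrite -[leRHS]mulr1 -[X in _ <= _ * X](word_sum_cylprob P n) -/p word_sumE mulr_sumr.
  rewrite size_map -sum1_size natr_sum big_filter big_enum_cond /=.
  rewrite [leRHS](bigID (good n)) /=.
  rewrite -[leLHS]addr0 lerD //; last first.
    by apply: sumr_ge0 => t _; rewrite mulr_ge0 ?expR_ge0 ?cylprob_ge0.
  apply: ler_sum => t /andP[h1 _].
  by rewrite -[leLHS](expRxMexpNx_1 (n%:R * (h + e))) ler_pM2l ?expR_gt0.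
apply: (@measure_dim_le _ A) => //; [exact: measurable_limsup_balls| |exact: ltW|].
  apply: ae_pushforward0; first exact: measurable_limsup_balls.
  have := cylinder_lb Pinv Perg e0; have := birkhoff_potential_lb e0.
  apply: filterS2 => w [N1 HN1] HN N.
  have [n nN hn] := HN (maxn N1 N).
  have n1 : (N1 <= n)%N by rewrite (leq_trans _ nN) // leq_maxl.
  have n2 : (N <= n)%N by rewrite (leq_trans _ nN) // leq_maxr.
  have bs := HN1 n n1.
  exists n => //; set u := trunc_word w n in hn.
  have su : size u = n by rewrite size_trunc.
  have Xz := proj_in H X0 (iter n sft w) Ul.
  have dw : deriv_word f g l u x0 <= expR (D - n%:R * (chi - e)).
    have := deriv_word_ratio H u Ul Ul X0 Xz.
    rewrite subrr normr0 mulr0 mul0r addr0 => /le_trans; apply.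
    rewrite (deriv_word_birkhoff_sum H X0 w n Ul) -expRD ler_expR lerD2l lerN2.
    exact: bs.
  exists (f_word f l u x0).
    apply: map_f; apply/mapP.
    have sz : size u == n by rewrite su.
    by exists (Tuple sz) => //; rewrite mem_filter /good /= hn dw mem_enum.
  rewrite (proj_word H X0 w n Ul) -/u.
  have /andP[_ h1] := f_word_bilip H u Ul Xz X0 X0.
  rewrite (le_trans h1) // /r -expRM_natl -mulr_natl.
  apply: (@le_trans _ _ (expR D * expR (D - n%:R * (chi - e)) * 1)).
    rewrite ler_pM ?mulr_ge0 ?expR_ge0 ?(ltW (deriv_word_gt0 H u Ul X0)) //.
      by rewrite ler_pM2l ?expR_gt0.
    exact: (X_dist H Xz X0).
  by rewrite mulr1 -!expRD ler_expR; lra.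
pose C := (2 * expR (2 * D)) `^ s.
apply: (@hausdorff_limsup_null _ _ _ _ C (expR (h + e - s * (chi - e)))) => //.
- by rewrite powR_ge0.
- by rewrite expR_ge0 /= expR_lt1 subr_lt0.
- by move=> n; rewrite /r mulr_ge0 ?expR_ge0 // exprn_ge0 // expR_ge0.
- move=> e' e'0.
  have q01 : 0 <= expR (- (chi - e)) < 1 by rewrite expR_ge0 /= expR_lt1 oppr_lt0.
  have [N HN] := geometric_small (2 * expR (2 * D)) q01 e'0.
  by exists N => n nN; rewrite /r mulrA ltW // HN.
- move=> n; rewrite size_map /r mulrA powRM ?mulr_ge0 ?expR_ge0 ?exprn_ge0 //.
  rewrite powR_exprn ?expR_ge0 // -expRM -/C mulrCA ler_wpM2l ?powR_ge0 //.
  rewrite (le_trans (ler_wpM2r _ (sizeF n))) ?exprn_ge0 ?expR_ge0 //.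
  by rewrite -!expRM_natl -expRD ler_expR; lra.
Qed.

Lemma dim_upper_bound : (measure_hausdorff_dim (pushforward P (Pi l)) <=
  (Num.min 1 (entropy P / chi))%:E)%E.
Proof.
rewrite /Num.min; case: ifP => _; first exact: dim_le1.
by apply/lee_addgt0Pr => e e0; apply: dim_le_ratio; rewrite ltrDl.
Qed.

End upper_bound.

(** * Tools for the energy estimate *)

Section preliminaries.
Context {R : realType}.

Lemma markov_indic d (T : measurableType d) (mu : {measure set T -> \bar R})
    (I : finType) (c : I -> R) (S : I -> set T) (B x : R) :
  (forall i, 0 <= c i) -> (forall i, measurable (S i)) -> 0 < x ->
  (\sum_(i : I) (c i)%:E * mu (S i) <= B%:E)%E ->
  (mu [set l | (x <= \sum_(i : I) c i * \1_(S i) l)%R] <= (B / x)%:E)%E.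
Proof.
move=> c0 mS x0 sumB; set A := [set l | _].
have mt i : measurable_fun setT (fun l => c i * \1_(S i) l : R).
  by apply: measurable_funM; [exact: measurable_cst|exact: measurable_indic].
have mW : measurable_fun setT (fun l => \sum_(i : I) c i * \1_(S i) l).
  by apply: measurable_sum.
have mA : measurable A by exact: measurable_ge.
rewrite EFinM lee_pdivlMr //.
apply: le_trans sumB.
have -> : (\sum_(i : I) (c i)%:E * mu (S i))%E =
    (\int[mu]_l (\sum_(i : I) c i * \1_(S i) l)%:E)%E.
  under [RHS]eq_integral do rewrite -sumEFin.
  rewrite ge0_integral_sum //.
  - apply: eq_bigr => i _.
    under [RHS]eq_integral do rewrite EFinM.
    rewrite ge0_integralZl_EFin //.
    + by rewrite integral_indic // setIT.
    + by apply/measurable_EFinP; exact: measurable_indic.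
  - by move=> i; apply/measurable_EFinP; exact: mt.
  - by move=> i l _; rewrite lee_fin mulr_ge0.
have -> : (mu A * x%:E)%E = (\int[mu]_l (x * \1_A l)%:E)%E.
  under eq_integral do rewrite EFinM.
  rewrite ge0_integralZl_EFin ?(ltW x0) //.
  + by rewrite integral_indic // setIT muleC.
  + by apply/measurable_EFinP; exact: measurable_indic.
apply: ge0_le_integral => //.
- by move=> l _; rewrite lee_fin mulr_ge0 // ltW.
- apply/measurable_EFinP; apply: measurable_funM; first exact: measurable_cst.
  exact: measurable_indic.
- by apply/measurable_EFinP.
- move=> l _; rewrite lee_fin indicE; case: (boolP (l \in A)).
    by rewrite inE mulr1.
  by move=> _; rewrite mulr0 sumr_ge0 // => i _; rewrite mulr_ge0.
Qed.

Lemma geometric_bc d (T : measurableType d) (mu : {measure set T -> \bar R})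
    (F : (set T)^nat) (C q : R) : 0 <= C -> 0 <= q < 1 ->
  (forall k, measurable (F k)) -> (forall k, (mu (F k) <= (C * q ^+ k)%:E)%E) ->
  mu (lim_sup_set F) = 0%E.
Proof.
move=> C0 /andP[q0 q1] mF muF; apply: lim_sup_set_cvg0 => //.
apply: (@le_lt_trans _ _ (C / (1 - q))%:E); last exact: ltry.
apply: le_nneseries => // M.
apply: (@le_trans _ _ (\sum_(0 <= k < M) (C * q ^+ k)%:E)%E); first exact: lee_sum.
rewrite sumEFin lee_fin -mulr_sumr ler_wpM2l //.
have -> : \sum_(0 <= k < M) q ^+ k = (1 - q ^+ M) / (1 - q).
  elim: M => [|M IH]; first by rewrite big_geq // expr0 subrr mul0r.
  rewrite big_nat_recr //= IH exprS; field.
  by rewrite subr_eq0 gt_eqF.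
rewrite -[leRHS]div1r ler_pM2r ?invr_gt0 ?subr_gt0 //.
by rewrite gerBl exprn_ge0.
Qed.

(** The minimum of a constant and an exponential is below any interpolation of
    the two; this combines the total length of the parameter interval and the
    transversality bound into one bound with exponent be. *)
Lemma expR_interp (be x : R) (C1 C2 : R) : 0 <= be <= 1 -> 0 <= C1 -> 0 <= C2 ->
  Num.min C1 (C2 * expR x) <= (C1 + C2) * expR (be * x).
Proof.
move=> /andP[b0 b1] c1 c2; have [x_ge0|x_lt0] := leP 0 x.
  apply: (@le_trans _ _ C1); first by rewrite ge_min lexx.
  apply: (@le_trans _ _ (C1 + C2)); first by rewrite lerDl.
  by rewrite ler_peMr ?addr_ge0 // -expR0 ler_expR mulr_ge0.
apply: (@le_trans _ _ (C2 * expR x)); first by rewrite ge_min lexx orbT.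
apply: (@le_trans _ _ (C2 * expR (be * x))).
  by rewrite ler_wpM2l // ler_expR ler_niMl // ltW.
by rewrite ler_wpM2r ?expR_ge0 // lerDr.
Qed.

Lemma linear_le_exp (n : R) (del : R) : 0 <= n -> 0 < del ->
  exists2 A, 0 <= A & forall k : nat, n * k%:R + 1 <= A * expR (del * k%:R).
Proof.
move=> n0 d0; exists (n / del + 1); first by rewrite addr_ge0 // divr_ge0 // ltW.
move=> k; have h := expR_ge1Dx (del * k%:R).
apply: (@le_trans _ _ ((n / del + 1) * (1 + del * k%:R))); last first.
  by rewrite ler_wpM2l // addr_ge0 // divr_ge0 // ltW.
have -> : (n / del + 1) * (1 + del * k%:R) = n / del + 1 + n * k%:R + del * k%:R.
  by field; rewrite gt_eqF.
have p1 : 0 <= n / del by rewrite divr_ge0 // ltW.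
have p2 : 0 <= del * k%:R by rewrite mulr_ge0 // ltW.
lra.
Qed.

End preliminaries.

(** * Energy estimate *)

Section energy.
Context {R : realType} {m : nat} {c d a b : R}.
Context {f g : R -> 'I_m.+1 -> R -> R} {K g1 g2 : R}.
Hypothesis H : tame c d a b f g K g1 g2.
Context {x0 : R}.
Hypothesis X0 : a <= x0 <= b.
Local Notation Pi := (natural_projection f x0).
Local Notation U l := (c < l < d).
Context {l0 : R}.
Hypothesis Ul0 : U l0.
Variable P0 : probability (Omega m) R.
Local Notation p0 := (cylprob P0).
Local Notation D := (distortion K g1 g2).
Local Notation dr := (drift K g1 g2).
Local Notation L := (ln (2 : R)).
Implicit Types (u v : seq 'I_m.+1).

(** Derivatives of words are taken at the fixed parameter l0 and the fixed point
    x0; distortion and drift transfer them to other points and parameters. *)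
Definition log_deriv u : R := ln (deriv_word f g l0 u x0).

Lemma expR_log_deriv u : expR (log_deriv u) = deriv_word f g l0 u x0.
Proof. by rewrite lnK // posrE; exact: (deriv_word_gt0 H u Ul0 X0). Qed.

Lemma log_deriv_ub u : log_deriv u <= (size u)%:R * ln g2.
Proof.
have [_ g10 g12 g21] := tame_consts H; have g20 := lt_le_trans g10 g12.
rewrite -[leRHS]expRK ler_ln ?posrE ?expR_gt0 ?(deriv_word_gt0 H u Ul0 X0) //.
rewrite expRM_natl lnK ?posrE //.
by have /andP[] := deriv_word_bd H u Ul0 X0.
Qed.

Lemma log_deriv_lb u : (size u)%:R * ln g1 <= log_deriv u.
Proof.
have [_ g10 g12 g21] := tame_consts H.
rewrite -[leLHS]expRK ler_ln ?posrE ?expR_gt0 ?(deriv_word_gt0 H u Ul0 X0) //.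
rewrite expRM_natl lnK ?posrE //.
by have /andP[] := deriv_word_bd H u Ul0 X0.
Qed.

(** The condition involves only the reference measure and the maps at l0, so the
    set of good words is the same for all parameters l near l0. *)
Definition good_word (gam : R) N u : bool :=
  all (fun j => p0 (take j u) <= expR (gam * log_deriv (take j u)))
    [seq j <- iota 0 (size u).+1 | (N <= j)%N].

Lemma good_wordP gam N u : reflect
  (forall j, (N <= j <= size u)%N -> p0 (take j u) <= expR (gam * log_deriv (take j u)))
  (good_word gam N u).
Proof.
apply: (iffP allP) => h j.
  move=> /andP[Nj ju]; apply: h.
  by rewrite mem_filter mem_iota add0n ltnS Nj ju.
by rewrite mem_filter mem_iota add0n ltnS => jj; exact: h.
Qed.

(** Prefixes shorter than N are covered by a constant, since their derivative is
    at least g1 ^ N. *)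
Lemma good_word_bound gam N u j : 0 <= gam -> good_word gam N u -> (j <= size u)%N ->
  p0 (take j u) <= expR (gam * (N%:R * - ln g1)) * expR (gam * log_deriv (take j u)).
Proof.
move=> gam0 /good_wordP gu ju.
have [_ g10 g12 g21] := tame_consts H; have g11 := le_lt_trans g12 g21.
have lg1 : 0 <= - ln g1 by rewrite oppr_ge0 ln_le0 // ltW.
have [Nj|jN] := leqP N j.
  have h : p0 (take j u) <= expR (gam * log_deriv (take j u)) by apply: gu; rewrite Nj.
  rewrite (le_trans h) // ler_peMl ?expR_ge0 //.
  by rewrite -[leLHS]expR0 ler_expR mulr_ge0 // mulr_ge0.
rewrite (le_trans (cylprob_le1 P0 _)) // -expRD -[leLHS]expR0 ler_expR -mulrDr mulr_ge0 //.
have := log_deriv_lb (take j u); rewrite size_takel // => h.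
have : j%:R * - ln g1 <= N%:R * - ln g1 by rewrite ler_wpM2r // ler_nat ltnW.
lra.
Qed.

Context {r0 C0 : R}.
Hypotheses (C00 : 0 < C0) (r0U : forall l, `|l - l0| < r0 -> U l).
Hypothesis sublevel : forall (u v : Omega m) (rho : R), letter u 0 <> letter v 0 ->
  0 < rho -> exists y, forall l, `|l - l0| < r0 -> `|Pi l u - Pi l v| <= rho ->
      `|l - y| <= C0 * rho.
Context {r : R}.
Hypotheses (r_gt0 : 0 < r) (rr0 : r <= r0).

Definition close_params u v (rho : R) : set R :=
  [set l | `|l - l0| < r /\ `|Pi l (pad_word u) - Pi l (pad_word v)| <= rho].

Lemma measurable_close_params u v rho : measurable (close_params u v rho).
Proof.
pose J := `]l0 - r, l0 + r[%classic.
have JE l : J l -> `|l - l0| < r0.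
  by rewrite /J /= in_itv /= -ltr_distlC distrC => /lt_le_trans; apply.
pose phi l := Pi l (pad_word u) - Pi l (pad_word v).
have mphi : measurable_fun J phi.
  apply: subspace_continuous_measurable_fun; first exact: measurable_itv.
  apply/continuous_in_subspaceT => l; rewrite inE => Jl.
  apply: differentiable_continuous; apply/derivable1_diffP.
  by apply: derivableB; apply: (derivable_proj H X0); apply: r0U; exact: JE.
have -> : close_params u v rho = J `&` phi @^-1` `[- rho, rho]%classic.
  apply/seteqP; split => l; rewrite /close_params /J /= !in_itv /= -ler_norml -ltr_distlC distrC //.
by apply: mphi; exact: measurable_itv.
Qed.

(** Remove the common prefix w by the lower distortion estimate for f_w at l: the
    remaining words differ in their first letter and have projections at distance
    at most rho / |f_w'|.  Transversality locates l in an interval of that order;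
    the derivative at l is compared with the one at l0 at the price of the drift. *)
Lemma close_params_prefix u v (j : nat) (rho : R) : size u = size v -> (j < size u)%N ->
  take j u = take j v -> nth ord0 u j <> nth ord0 v j -> 0 < rho ->
  exists y, forall l, close_params u v rho l ->
    `|l - y| <= C0 * (rho * expR (2 * D + dr * r * j%:R - log_deriv (take j u))).
Proof.
move=> suv ju tuv nuv rho0; set w := take j u in tuv *.
have sw : size w = j by rewrite size_takel // ltnW.
(* after the common prefix the padded words differ in their first letter *)
have ltr : letter (pad_word (drop j u)) 0 <> letter (pad_word (drop j v)) 0.
  by rewrite /letter /pad_word !nth_drop addn0.
have pos : 0 < rho * expR (2 * D + dr * r * j%:R - log_deriv w).
  by rewrite mulr_gt0 // expR_gt0.
have [y hy] := sublevel ltr pos.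
exists y => l [lr lrho]; have lr0 := lt_le_trans lr rr0; have Ul := r0U lr0.
apply: hy => //.
have projw t : (j <= size t)%N -> Pi l (pad_word t) = f_word f l (take j t) (Pi l (pad_word (drop j t))).
  move=> jt; rewrite (proj_word H X0 (pad_word t) j Ul) iter_pad_word; congr (f_word f l _ _).
  by rewrite -[in RHS](trunc_pad_word t) trunc_take.
have Xu := proj_in H X0 (pad_word (drop j u)) Ul.
have Xv := proj_in H X0 (pad_word (drop j v)) Ul.
have /andP[h1 _] := f_word_bilip H w Ul Xu Xv X0.
move: lrho; rewrite (projw u) ?(ltnW ju) // (projw v) -?suv ?(ltnW ju) // -tuv.
rewrite -/w => h2; have h3 := le_trans h1 h2.
have h4 := deriv_word_ratio H w Ul0 Ul X0 X0; rewrite sw distrC in h4.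
rewrite -expR_log_deriv in h4.
have dr0 := drift_ge0 H.
have h5 : expR (log_deriv w) <= expR (D + dr * r * j%:R) * deriv_word f g l w x0.
  apply: (le_trans h4); rewrite ler_pM2r ?(deriv_word_gt0 H w Ul X0) // ler_expR.
  by rewrite lerD2l ler_wpM2r // ler_wpM2l // ltW.
have h6 : expR (log_deriv w - D - dr * r * j%:R) <= deriv_word f g l w x0.
  rewrite -ler_pdivrMl ?expR_gt0 // -expRN -expRD in h5.
  apply: le_trans h5; rewrite ler_expR; lra.
rewrite -ler_pdivrMr ?expR_gt0 // -expRN.
apply: le_trans h3; rewrite mulrC; apply: ler_wpM2r => //.
apply: (@le_trans _ _ (expR (- D) * expR (log_deriv w - D - dr * r * j%:R))).
  by rewrite -expRD ler_expR; lra.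
by rewrite ler_pM2l ?expR_gt0.
Qed.

Local Notation lam := (@lebesgue_measure R).

Lemma close_params_ball u v rho y s : 0 <= s -> (forall l, close_params u v rho l -> `|l - y| <= s) ->
  (lam (close_params u v rho) <= (2 * s)%:E)%E.
Proof.
move=> s0 h; apply: (@le_trans _ _ (lam `[y - s, y + s]%classic)).
  rewrite le_measure ?inE //; [exact: measurable_close_params|].
  by move=> l /h; rewrite /= in_itv /= -ler_distlC distrC.
rewrite lebesgue_measure_itv /= lte_fin; case: ifP => _; last by rewrite lee_fin mulr_ge0.
by rewrite -EFinD lee_fin; lra.
Qed.

Lemma close_params_total u v rho : (lam (close_params u v rho) <= (2 * r)%:E)%E.
Proof. by apply: (@close_params_ball _ _ _ l0) => [|l [/ltW]]; first exact: ltW. Qed.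

Definition transv_const : R := 2 * r + 6 * C0 * expR (2 * D).

Lemma transv_const_ge0 : 0 <= transv_const.
Proof.
by rewrite /transv_const addr_ge0 ?mulr_ge0 ?expR_ge0 ?(ltW C00) // ltW.
Qed.

(** The indicator over all prefix lengths j avoids naming the place where u and v
    split: the summand at that place already dominates, and the sum over all
    common prefixes is easy to average over v. *)
Lemma close_params_measure (be : R) u v (k : nat) : 0 <= be <= 1 -> size u = size v ->
  (lam (close_params u v (3 * expR (- (k%:R * L)))) <=
   (\sum_(j < size u) (take j u == take j v)%:R *
      (transv_const * expR (be * (- (k%:R * L) + dr * r * j%:R - log_deriv (take j u)))) +
    (u == v)%:R * transv_const)%:E)%E.
Proof.
move=> be01 suv; have sum0 (I : Type) (s : seq I) (p : pred I) (F : I -> bool) (G : I -> R) :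
    0 <= \sum_(j <- s | p j) (F j)%:R * (transv_const * expR (G j)).
  by apply: sumr_ge0 => i _; rewrite mulr_ge0 // mulr_ge0 ?transv_const_ge0 ?expR_ge0.
have [->|uv] := eqVneq u v.
  apply: (le_trans (close_params_total _ _ _)); rewrite lee_fin.
  rewrite mul1r ler_wpDl ?sum0 // /transv_const lerDl !mulr_ge0 ?expR_ge0 //.
  exact: ltW.
rewrite mul0r addr0.
have [j [ju tj nj]] := first_difference suv uv.
rewrite (bigD1 (Ordinal ju)) //= tj eqxx mul1r -tj.
apply: (@le_trans _ _ (transv_const * expR (be * (- (k%:R * L) + dr * r * j%:R - log_deriv (take j u))))%:E); last first.
  by rewrite lee_fin lerDl sum0.
set x := - (k%:R * L) + dr * r * j%:R - log_deriv (take j u).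
have rho0 : 0 < 3 * expR (- (k%:R * L)) by rewrite mulr_gt0 // expR_gt0.
have [y hy] := close_params_prefix suv ju tj nj rho0.
have e : C0 * (3 * expR (- (k%:R * L)) * expR (2 * D + dr * r * j%:R - log_deriv (take j u))) =
   3 * C0 * expR (2 * D) * expR x.
  have -> : 2 * D + dr * r * j%:R - log_deriv (take j u) = 2 * D + (x + k%:R * L).
    by rewrite /x; ring.
  rewrite (expRD (2 * D)) (expRD x); set t := expR (2 * D); set t2 := expR x.
  have := expRxMexpNx_1 (k%:R * L); set t3 := expR (k%:R * L); set t4 := expR (- _) => t34.
  transitivity (3 * C0 * t * t2 * (t3 * t4)); first by ring.
  by rewrite t34 mulr1.
rewrite e in hy.
apply: (@le_trans _ _ (Num.min (2 * r) (6 * C0 * expR (2 * D) * expR x))%:E).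
  rewrite EFin_min le_min close_params_total /=.
  have -> : 6 * C0 * expR (2 * D) * expR x = 2 * (3 * C0 * expR (2 * D) * expR x) by ring.
  apply: close_params_ball hy.
  by rewrite !mulr_ge0 ?expR_ge0 // ltW.
rewrite lee_fin /transv_const; apply: expR_interp => //; first by rewrite mulr_ge0 // ltW.
by rewrite !mulr_ge0 ?expR_ge0 // ltW.
Qed.

Lemma prefix_sum u (j n : nat) : size u = n -> (j <= n)%N ->
  \sum_(v : n.-tuple 'I_m.+1) p0 v * (take j u == take j v)%:R = p0 (take j u).
Proof.
move=> su jn.
rewrite -(@word_sumE _ _ n (fun v => p0 v * (take j u == take j v)%:R)).
rewrite -(@mean_trunc _ _ P0 (fun v => (take j u == take j v)%:R)).
have mc : measurable (cylinder (take j u) : set (Omega m)) by exact: measurable_cylinder.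
rewrite /cylprob -mean_indic //; apply: eq_Rintegral => w _.
rewrite indicE trunc_take //; congr ((nat_of_bool _)%:R).
have sj : size (take j u) = j by rewrite size_takel // su.
apply/idP/idP => [/eqP ->|]; first by rewrite inE; exact: cylinder_trunc.
by rewrite inE /cylinder /= sj => ->.
Qed.

Definition pair_weight (gam : R) N n (p : n.-tuple 'I_m.+1 * n.-tuple 'I_m.+1) : R :=
  (good_word gam N p.1 && good_word gam N p.2)%:R * (p0 p.1 * p0 p.2).

Lemma pair_weight_ge0 gam N n p : 0 <= @pair_weight gam N n p.
Proof. by rewrite mulr_ge0 // mulr_ge0 ?cylprob_ge0. Qed.

(** Sum [close_params_measure] over v: the prefix w of length j contributes
    2^(-k be) |f_w'|^(-be) times the mass of w, which for a good word is at
    most |f_w'|^gam.  The surplus |f_w'|^(gam - be) <= g2 ^ ((gam - be) j) pays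
    for the drift, so each of the n + 1 lengths contributes O(2^(-k be)).  The
    words are long enough, g2 ^ n <= 2 ^ -k, for the pairs u = v to obey the
    same bound. *)
Lemma energy_bound (be gam : R) (N kk k : nat) (n := (kk * k)%N) :
  0 <= be <= 1 -> be <= gam -> be * (dr * r) <= (gam - be) * - ln g2 ->
  L <= kk%:R * - ln g2 ->
  (\sum_(p : n.-tuple 'I_m.+1 * n.-tuple 'I_m.+1)
     (pair_weight gam N p)%:E * lam (close_params p.1 p.2 (3 * expR (- (k%:R * L)))) <=
   (transv_const * expR (gam * (N%:R * - ln g1)) * (n%:R + 1) * expR (- (k%:R * be * L)))%:E)%E.
Proof.
move=> be01 begam drift_small hkk.
have /andP[be0 be1] := be01.
have gam0 : 0 <= gam by rewrite (le_trans be0).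
have lg2 : 0 < - ln g2 by exact: contraction_rate_gt0 H.
set C3 := expR (gam * _).
have C30 : 0 < C3 by exact: expR_gt0.
pose B u j := transv_const * expR (be * (- (k%:R * L) + dr * r * j%:R - log_deriv (take j u))).
pose bb u v := \sum_(j < n) (take j u == take j v)%:R * B u j +
  (u == v)%:R * transv_const.
have B0 u j : 0 <= B u j by rewrite mulr_ge0 ?transv_const_ge0 ?expR_ge0.
apply: (@le_trans _ _ (\sum_(p : n.-tuple 'I_m.+1 * n.-tuple 'I_m.+1)
    (pair_weight gam N p * bb p.1 p.2)%:E)%E).
  apply: lee_sum => -[u v] _ /=; rewrite [X in (_ <= X)%E]EFinM.
  apply: lee_wpmul2l; first by rewrite lee_fin pair_weight_ge0.
  have := @close_params_measure be u v k be01; rewrite !size_tuple; exact.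
rewrite sumEFin lee_fin.
have -> : \sum_(p : n.-tuple 'I_m.+1 * n.-tuple 'I_m.+1) pair_weight gam N p * bb p.1 p.2 =
    \sum_(u : n.-tuple 'I_m.+1) \sum_(v : n.-tuple 'I_m.+1) pair_weight gam N (u, v) * bb u v.
  by rewrite pair_bigA /=; apply: eq_bigr => -[].
apply: (@le_trans _ _ (\sum_(u : n.-tuple 'I_m.+1) p0 u *
  (transv_const * C3 * (n%:R + 1) * expR (- (k%:R * be * L))))); last first.
  by rewrite -mulr_suml -(@word_sumE _ _ n p0) word_sum_cylprob mul1r.
apply: ler_sum => u _.
have bb0 v : 0 <= bb u v.
  rewrite /bb addr_ge0 //; last by rewrite mulr_ge0 // transv_const_ge0.
  by apply: sumr_ge0 => j _; rewrite mulr_ge0.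
have [gu|gu] := boolP (good_word gam N u); last first.
  rewrite big1; last by move=> v _; rewrite /pair_weight /= (negbTE gu) !mul0r.
  by rewrite !mulr_ge0 ?cylprob_ge0 ?expR_ge0 ?transv_const_ge0 // ltW.
apply: (@le_trans _ _ (\sum_(v : n.-tuple 'I_m.+1) p0 u * (p0 v * bb u v))).
  apply: ler_sum => v _; rewrite /pair_weight /= gu /= -[leRHS]mul1r !mulrA.
  rewrite ler_wpM2r // -!mulrA ler_wpM2r ?mulr_ge0 ?cylprob_ge0 //.
  by case: (good_word _ _ _).
rewrite -mulr_sumr ler_wpM2l ?cylprob_ge0 //.
have -> : \sum_(v : n.-tuple 'I_m.+1) p0 v * bb u v =
    \sum_(j < n) B u j * p0 (take j u) + transv_const * p0 u.
  rewrite /bb; under eq_bigr do rewrite mulrDr.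
  rewrite big_split /=; congr (_ + _).
    under eq_bigr do rewrite mulr_sumr.
    rewrite exchange_big /=; apply: eq_bigr => j _.
    rewrite -(@prefix_sum u j n) ?size_tuple // ?(ltnW (ltn_ord j)) //.
    by rewrite mulr_sumr; apply: eq_bigr => v _; ring.
  have -> : p0 u = p0 (take n u) by rewrite take_oversize // size_tuple.
  rewrite -(@prefix_sum u n n) ?size_tuple //.
  rewrite mulr_sumr; apply: eq_bigr => v _.
  by rewrite !take_oversize ?size_tuple //; ring.
have termj (j : 'I_n) : B u j * p0 (take j u) <= transv_const * C3 * expR (- (k%:R * be * L)).
  have ju : (j <= size u)%N by rewrite size_tuple ltnW.
  have h1 := good_word_bound gam0 gu ju; rewrite -/C3 in h1.
  apply: (le_trans (ler_wpM2l (B0 u j) h1)).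
  have -> : B u j * (C3 * expR (gam * log_deriv (take j u))) = transv_const * C3 *
    (expR (be * (- (k%:R * L) + dr * r * j%:R - log_deriv (take j u))) *
     expR (gam * log_deriv (take j u))) by rewrite /B; ring.
  rewrite ler_wpM2l ?mulr_ge0 ?transv_const_ge0 ?(ltW C30) // -expRD ler_expR.
  have := log_deriv_ub (take j u); rewrite size_takel // => h2.
  have h3 : (gam - be) * log_deriv (take j u) <= (gam - be) * (j%:R * ln g2).
    by rewrite ler_wpM2l // subr_ge0.
  have h4 : j%:R * (be * (dr * r)) <= j%:R * ((gam - be) * - ln g2).
    by rewrite ler_wpM2l.
  rewrite -subr_ge0 in h3; rewrite -subr_ge0 in h4.
  rewrite -subr_ge0.
  have -> : - (k%:R * be * L) - (be * (- (k%:R * L) + dr * r * j%:R - log_deriv (take j u)) +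
     gam * log_deriv (take j u)) = ((gam - be) * (j%:R * ln g2) - (gam - be) * log_deriv (take j u)) +
     (j%:R * ((gam - be) * - ln g2) - j%:R * (be * (dr * r))) by ring.
  exact: addr_ge0.
have diag : transv_const * p0 u <= transv_const * C3 * expR (- (k%:R * be * L)).
  have h1 := good_word_bound gam0 gu (leqnn _); rewrite take_size -/C3 in h1.
  rewrite -mulrA ler_wpM2l ?transv_const_ge0 // (le_trans h1) // ler_pM2l // ler_expR.
  have := log_deriv_ub u; rewrite size_tuple => h2.
  have h3 : gam * log_deriv u <= gam * (n%:R * ln g2) by rewrite ler_wpM2l.
  apply: (le_trans h3).
  have h4 : be * (n%:R * - ln g2) <= gam * (n%:R * - ln g2).
    by rewrite ler_wpM2r // mulr_ge0 // ltW.
  have h5 : k%:R * L <= n%:R * - ln g2.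
    by rewrite /n natrM (mulrC kk%:R) -mulrA ler_wpM2l.
  have h6 : be * (k%:R * L) <= be * (n%:R * - ln g2) by rewrite ler_wpM2l.
  lra.
apply: (@le_trans _ _ (\sum_(j < n) transv_const * C3 * expR (- (k%:R * be * L)) +
   transv_const * C3 * expR (- (k%:R * be * L)))).
  by apply: lerD => //; apply: ler_sum.
by rewrite sumr_const card_ord -mulr_natl; lra.
Qed.

Definition close_pair_mass (gam : R) N kk k (l : R) : R := let n := (kk * k)%N in
  \sum_(p : n.-tuple 'I_m.+1 * n.-tuple 'I_m.+1)
    pair_weight gam N p * \1_(close_params p.1 p.2 (3 * expR (- (k%:R * L)))) l.

(** Markov inequality and Borel-Cantelli; the gap between be' and be absorbs the
    linear factor of [energy_bound]. *)
Lemma close_pair_mass_small (be be' gam : R) (N kk : nat) :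
  0 <= be <= 1 -> be' < be -> be <= gam -> be * (dr * r) <= (gam - be) * - ln g2 ->
  L <= kk%:R * - ln g2 ->
  {ae lam, forall l, exists k1, forall k, (k1 <= k)%N ->
     close_pair_mass gam N kk k l <= expR (- (k%:R * be' * L))}.
Proof.
move=> be01 be'be begam hdr hkk.
have L0 : 0 < L by rewrite ln_gt0 // ltr1n.
pose F k := [set l | expR (- (k%:R * be' * L)) <= close_pair_mass gam N kk k l].
have mF k : measurable (F k).
  apply: measurable_ge; apply: measurable_sum => p.
  apply: measurable_funM; first exact: measurable_cst.
  by apply: measurable_indic; exact: measurable_close_params.
pose del := (be - be') * L / 2.
have del0 : 0 < del by rewrite divr_gt0 // mulr_gt0 // subr_gt0.
have [A A0 hA] := @linear_le_exp R kk%:R del (ler0n _ _) del0.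
pose C := transv_const * expR (gam * (N%:R * - ln g1)) * A.
have C0' : 0 <= C by rewrite !mulr_ge0 ?transv_const_ge0 ?expR_ge0.
have muF k : (lam (F k) <= (C * expR (- del) ^+ k)%:E)%E.
  have := @markov_indic R _ _ lam _ (@pair_weight gam N (kk * k))
    (fun p => close_params p.1 p.2 (3 * expR (- (k%:R * L)))) _ (expR (- (k%:R * be' * L)))
    (@pair_weight_ge0 gam N (kk * k)) (fun p => measurable_close_params _ _ _) (expR_gt0 _)
    (@energy_bound be gam N kk k be01 begam hdr hkk).
  move=> h; apply: (le_trans h); rewrite lee_fin -expRM_natl.
  have h2 := hA k.
  apply: (@le_trans _ _ (transv_const * expR (gam * (N%:R * - ln g1)) * (A * expR (del * k%:R)) *
     expR (- (k%:R * be * L)) / expR (- (k%:R * be' * L)))).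
    rewrite ler_pM2r ?invr_gt0 ?expR_gt0 // ler_pM2r ?expR_gt0 //.
    by rewrite ler_wpM2l ?mulr_ge0 ?transv_const_ge0 ?expR_ge0 // natrM.
  rewrite -expRN opprK /C.
  have -> : k%:R * - del = del * k%:R + - (k%:R * be * L) + k%:R * be' * L.
    by rewrite /del; field.
  by rewrite !expRD le_eqVlt; apply/orP; left; apply/eqP; ring.
have F0 : lam (lim_sup_set F) = 0%E.
  have q01 : 0 <= expR (- del) < 1 by rewrite expR_ge0 /= expR_lt1 oppr_lt0.
  exact: (@geometric_bc R _ _ lam F C (expR (- del)) C0' q01 mF muF).
exists (lim_sup_set F); split => //.
  by apply: measurable_lim_sup.
move=> l /= nl; apply/lim_supP; apply: contrapT => /existsNP[k1 hk1].
apply: nl; exists k1 => k kk1; rewrite leNgt; apply/negP => hh.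
by apply: hk1; exists k => //; exact: ltW.
Qed.

End energy.

Arguments log_deriv {R m} f g x0 l0 u.
Arguments good_word {R m} f g x0 l0 P0 gam N u.
Arguments close_pair_mass {R m} f g x0 l0 P0 r gam N kk k l.
Arguments pair_weight {R m} f g x0 l0 P0 gam N [n] p.
Arguments close_params {R m} f x0 l0 r u v rho _.

(** * Lower bound for the dimension near a parameter *)

Section lower_bound.
Context {R : realType} {m : nat} {c d a b : R}.
Context {f g : R -> 'I_m.+1 -> R -> R} {K g1 g2 : R}.
Hypothesis H : tame c d a b f g K g1 g2.
Context {x0 : R}.
Hypothesis X0 : a <= x0 <= b.
Local Notation Pi := (natural_projection f x0).
Local Notation U l := (c < l < d).
Context {l0 : R}.
Hypothesis Ul0 : U l0.
Variable P0 : probability (Omega m) R.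
Local Notation p0 := (cylprob P0).
Local Notation D := (distortion K g1 g2).
Local Notation dr := (drift K g1 g2).
Local Notation L := (ln (2 : R)).
Local Notation log_deriv := (log_deriv f g x0 l0).
Implicit Types (u v : seq 'I_m.+1).

Section fixed_parameter.
Variables (l : R) (P : probability (Omega m) R).
Hypothesis Ul : U l.
Hypotheses (Pinv : shift_invariant P) (Perg : ergodic P).
Local Notation p := (cylprob P).
Local Notation chi := (\int[P]_(w in setT) potential f g x0 l w).

(** For large n the P-probability of a typical prefix is at most e^(-n (h - e1)),
    hence also its P0-probability with a further factor e^(n e1), while its
    derivative at l is at least e^(-n (chi + e1)) and at l0 at least
    e^(-n (chi + 2 e1)) up to distortion.  Since h >= kap chi with kap > gam, the
    difference (kap - gam) chi of the exponents is larger than the errors. *)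
Lemma good_word_ae (e1 C gam kap : R) : 0 < e1 -> 0 < C -> 0 <= gam <= kap ->
  (forall u, (1 <= size u)%N -> p0 u <= C * expR (e1 * (size u)%:R) * p u) ->
  dr * `|l - l0| <= e1 -> kap * chi <= entropy P ->
  2 * e1 * (1 + gam) < (kap - gam) * - ln g2 ->
  {ae P, forall w, exists N, forall n, (N <= n)%N ->
     p0 (trunc_word w n) <= expR (gam * log_deriv (trunc_word w n))}.
Proof.
move=> e10 C0 /andP[gam0 gamkap] p0p hdr hkap gap.
have hchi := lyapunov_ge H X0 P Ul.
pose del := (kap - gam) * - ln g2 - 2 * e1 * (1 + gam).
have del0 : 0 < del by rewrite subr_gt0.
have := cylinder_ub Pinv Perg e10.
have := birkhoff_potential_ub H X0 Pinv Perg Ul e10.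
apply: filterS2 => w [N1 HN1] [N2 HN2].
exists (maxn 1 (maxn (maxn N1 N2) (Num.truncn ((ln C + 2 * D * gam) / del)).+1)) => n.
rewrite !geq_max => /and3P[n1 /andP[nN1 nN2] nN3].
have hp := HN2 n nN2; have hb := HN1 n nN1.
set u := trunc_word w n in hp *.
have su : size u = n by rewrite size_trunc.
have h1 : p0 u <= C * expR (e1 * n%:R) * expR (- (n%:R * (entropy P - e1))).
  have := p0p u; rewrite su => /(_ n1) h; apply: (le_trans h).
  by rewrite ler_wpM2l // mulr_ge0 ?expR_ge0 // ltW.
have Xz := proj_in H X0 (iter n sft w) Ul.
have h2 : - (2 * D) - n%:R * (chi + 2 * e1) <= log_deriv u.
  have hr1 := deriv_word_ratio H u Ul Ul Xz X0.
  have hr2 := deriv_word_ratio H u Ul Ul0 X0 X0.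
  rewrite subrr normr0 mulr0 mul0r addr0 (deriv_word_birkhoff_sum H X0 w n Ul) in hr1.
  rewrite su -(expR_log_deriv H X0 Ul0) in hr2.
  have h3 : expR (- birkhoff_sum (potential f g x0 l) n w) <=
      expR (D + (D + dr * `|l - l0| * n%:R) + log_deriv u).
    apply: (le_trans hr1); rewrite expRD [expR (D + _)]expRD -mulrA.
    by rewrite ler_pM2l ?expR_gt0.
  rewrite ler_expR in h3.
  have h4 : dr * `|l - l0| * n%:R <= e1 * n%:R by rewrite ler_wpM2r.
  lra.
apply: (le_trans h1).
rewrite -{1}[C]lnK ?posrE // -!expRD ler_expR.
have h5 : gam * (- (2 * D) - n%:R * (chi + 2 * e1)) <= gam * log_deriv u.
  by rewrite ler_wpM2l.
apply: le_trans h5.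
have h6 : ln C + 2 * D * gam <= n%:R * del.
  rewrite -ler_pdivrMr // (le_trans (ltW (truncnS_gt _))) // ler_nat.
  exact: nN3.
have h7 : (kap - gam) * - ln g2 <= (kap - gam) * chi.
  by rewrite ler_wpM2l // subr_ge0.
have h8 : n%:R * (kap * chi) <= n%:R * entropy P by rewrite ler_wpM2l.
have h9 : n%:R * ((kap - gam) * - ln g2) <= n%:R * ((kap - gam) * chi).
  by rewrite ler_wpM2l.
rewrite /del in h6.
lra.
Qed.

Variables (gam r : R).
Local Notation good := (good_word f g x0 l0 P0 gam).

Definition good_tail N : set (Omega m) := [set w | forall n, (N <= n)%N ->
     p0 (trunc_word w n) <= expR (gam * log_deriv (trunc_word w n))].

Lemma measurable_good_tail N : measurable (good_tail N).
Proof.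
have -> : good_tail N = \bigcap_(n in [set n | (N <= n)%N])
    [set w | p0 (trunc_word w n) <= expR (gam * log_deriv (trunc_word w n))] by [].
apply: bigcap_measurable => [|n _]; first by exists N => /=.
exact: (@measurable_trunc m n [set u | p0 u <= expR (gam * log_deriv u)]).
Qed.

Lemma good_tail_word N w n : good_tail N w -> good N (trunc_word w n).
Proof.
move=> Gw; apply/good_wordP => j; rewrite size_trunc => /andP[Nj jn].
by rewrite trunc_take //; exact: Gw.
Qed.

(** The good tails increase to a set of full measure. *)
Lemma good_tail_pos : {ae P, forall w, exists N, forall n, (N <= n)%N ->
     p0 (trunc_word w n) <= expR (gam * log_deriv (trunc_word w n))} ->
  exists N, (0 < P (good_tail N))%E.
Proof.
move=> ae; apply: contrapT => /forallNP hN.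
have G0 N : P (good_tail N) = 0%E.
  have := hN N => /negP; rewrite -leNgt measure_le0 => /eqP; exact.
have : P.-negligible (\bigcup_N good_tail N).
  apply: negligible_bigcup => N; apply/negligibleP; [exact: measurable_good_tail|exact: G0].
move=> /negligibleU /(_ ae).
have -> : \bigcup_N good_tail N `|` ~` [set w | exists N, forall n, (N <= n)%N ->
     p0 (trunc_word w n) <= expR (gam * log_deriv (trunc_word w n))] = setT.
  apply/seteqP; split => // w _.
  have [[N hw]|nw] := pselect (exists N, forall n, (N <= n)%N ->
     p0 (trunc_word w n) <= expR (gam * log_deriv (trunc_word w n))).
    by left; exists N.
  by right.
move/negligibleP => /(_ measurableT) h.
have h0 : P setT = 0%E := h.
by move: h0; rewrite probability_setT => /eqP; rewrite onee_eq0.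
Qed.

Definition near_mass N n rho u : R :=
  word_sum n (fun v => p v * (good N v && (`|Pi l (pad_word u) - Pi l (pad_word v)| <= rho))%:R).

Lemma near_mass_ge0 N n rho u : 0 <= near_mass N n rho u.
Proof. by rewrite /near_mass word_sumE; apply: sumr_ge0 => v _; rewrite mulr_ge0 ?cylprob_ge0. Qed.

Lemma prob_trunc n (Q : pred (seq 'I_m.+1)) :
  fine (P [set w | Q (trunc_word w n)]) = word_sum n (fun u => p u * (Q u)%:R).
Proof.
rewrite -(@mean_trunc _ _ P (fun u => (Q u)%:R)) -mean_indic; last exact: (@measurable_trunc m n [set u | Q u]).
apply: eq_Rintegral => w _; rewrite indicE; congr ((nat_of_bool _)%:R).
by apply/idP/idP; rewrite inE.
Qed.

Hypothesis lr : `|l - l0| < r.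

(** Passing from P0 to P costs the comparison factor once for each of the two
    words of a pair. *)
Lemma near_mass_sum N (kk k : nat) (n := (kk * k)%N) (e1 C : R) : 0 < C ->
  (1 <= n)%N ->
  (forall u, (1 <= size u)%N -> p u <= C * expR (e1 * (size u)%:R) * p0 u) ->
  word_sum n (fun u => p u * (good N u)%:R * near_mass N n (3 * expR (- (k%:R * L))) u) <=
  C ^+ 2 * expR (2 * e1 * n%:R) * close_pair_mass f g x0 l0 P0 r gam N kk k l.
Proof.
move=> C0 n1 pp0; rewrite /close_pair_mass mulr_sumr.
have -> : word_sum n (fun u => p u * (good N u)%:R * near_mass N n (3 * expR (- (k%:R * L))) u) =
  \sum_(q : n.-tuple 'I_m.+1 * n.-tuple 'I_m.+1)
    p q.1 * (good N q.1)%:R * (p q.2 * (good N q.2 &&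
      (`|Pi l (pad_word q.1) - Pi l (pad_word q.2)| <= 3 * expR (- (k%:R * L))))%:R).
  rewrite word_sumE -(pair_bigA _ (fun u v : n.-tuple 'I_m.+1 => p u * (good N u)%:R * (p v * (good N v &&
      (`|Pi l (pad_word u) - Pi l (pad_word v)| <= 3 * expR (- (k%:R * L))))%:R))) /=.
  by apply: eq_bigr => u _; rewrite /near_mass word_sumE mulr_sumr.
apply: ler_sum => -[u v] _ /=; rewrite /pair_weight /=.
set A := `|_ - _| <= _.
have -> : \1_(close_params f x0 l0 r u v (3 * expR (- (k%:R * L)))) l = A%:R :> R.
  rewrite indicE; congr ((nat_of_bool _)%:R); apply/idP/idP => h.
    by move: h; rewrite inE => -[].
  by rewrite inE; split.
have pu : p u <= C * expR (e1 * n%:R) * p0 u.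
  by have := pp0 u; rewrite size_tuple => /(_ n1).
have pv : p v <= C * expR (e1 * n%:R) * p0 v.
  by have := pp0 v; rewrite size_tuple => /(_ n1).
have -> : p u * (good N u)%:R * (p v * (good N v && A)%:R) =
   (p u * p v) * ((good N u && good N v)%:R * A%:R).
  by case: (good N u); case: (good N v); case: A => /=; ring.
have -> : C ^+ 2 * expR (2 * e1 * n%:R) * ((good N u && good N v)%:R * (p0 u * p0 v) * A%:R)
  = (C * expR (e1 * n%:R) * p0 u) * (C * expR (e1 * n%:R) * p0 v) *
    ((good N u && good N v)%:R * A%:R).
  have -> : 2 * e1 * n%:R = e1 * n%:R + e1 * n%:R by ring.
  by rewrite expRD; ring.
rewrite ler_wpM2r ?mulr_ge0 //.
by apply: ler_pM => //; exact: cylprob_ge0.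
Qed.

Lemma powR_dyadic (k : nat) (al : R) :
  (2^-1 ^+ k : R) `^ al = expR (- (k%:R * al * L)).
Proof.
have z0 : (0 : R) < 2^-1 by rewrite invr_gt0.
rewrite powR_exprn ?(ltW z0) // -[2^-1](lnK (_ : 2^-1 \in Num.pos)) ?posrE //.
by rewrite -expRM -expRM_natl lnV ?posrE //; congr expR; ring.
Qed.

(** Call a good word u of order k bad if the good words projecting close to u have
    mass more than 2^(-k al).  By Markov the mass of the bad words is at most
    2^(k al) times the mass of close pairs, hence geometrically small; so points
    all of whose good prefixes of large order are not bad form, together with the
    good tail, a set of positive measure.  On it the Frostman condition with
    exponent al holds by definition, and the mass distribution principle
    applies. *)
Lemma local_dim (e1 C al be' : R) (kk : nat) : 0 < al -> 0 < C -> (0 < kk)%N ->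
  2 * e1 * kk%:R < (be' - al) * L -> L <= kk%:R * - ln g2 ->
  (forall u, (1 <= size u)%N -> p u <= C * expR (e1 * (size u)%:R) * p0 u) ->
  {ae P, forall w, exists N, forall n, (N <= n)%N ->
     p0 (trunc_word w n) <= expR (gam * log_deriv (trunc_word w n))} ->
  (forall N, exists k1, forall k, (k1 <= k)%N ->
     close_pair_mass f g x0 l0 P0 r gam N kk k l <= expR (- (k%:R * be' * L))) ->
  (al%:E <= measure_hausdorff_dim (pushforward P (Pi l)))%E.
Proof.
move=> al0 C0 kk0 gap hkk pp0 ae hW.
have [N PN] := good_tail_pos ae.
have [k1 hk1] := hW N.
have mG := measurable_good_tail N.
pose rho k : R := 3 * expR (- (k%:R * L)).
pose bad k u := good N u && (expR (- (k%:R * al * L)) < near_mass N (kk * k) (rho k) u).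
(* words of positive length are needed for the comparison of measures, hence
   orders k >= 1 *)
pose k2 := maxn 1 k1.
pose F k : set (Omega m) := [set w | bad (k + k2)%N (trunc_word w (kk * (k + k2)))].
have mF k : measurable (F k).
  exact: (@measurable_trunc m (kk * (k + k2)) [set u | bad (k + k2)%N u]).
pose q := expR (al * L + 2 * e1 * kk%:R - be' * L).
have q01 : 0 <= q < 1.
  by rewrite /q expR_ge0 /= expR_lt1; lra.
have PF k : (P (F k) <= (C ^+ 2 * q ^+ k)%:E)%E.
  rewrite -[X in (X <= _)%E]fineK ?fin_num_measure // lee_fin.
  rewrite (@prob_trunc (kk * (k + k2)) (bad (k + k2)%N)).
  set k' := (k + k2)%N; set n := (kk * k')%N.
  have k'1 : (1 <= k')%N by rewrite /k' (leq_trans (leq_maxl 1 k1)) // leq_addl.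
  have n1 : (1 <= n)%N by rewrite muln_gt0 kk0.
  apply: (@le_trans _ _ (expR (k'%:R * al * L) * word_sum n (fun u => p u * (good N u)%:R * near_mass N n (rho k') u))).
    rewrite -word_sumZ; apply: ler_word_sum => u _.
    rewrite /bad; have [gu|gu] := boolP (good N u); last first.
      by rewrite /= !mulr0 mul0r mulr0.
    rewrite /= mulr1 mulrCA ler_wpM2l ?cylprob_ge0 //.
    have [h|h] := boolP (_ < _); last by rewrite mulr_ge0 ?expR_ge0 ?near_mass_ge0.
    by rewrite -ler_pdivrMl ?expR_gt0 // mulr1 -expRN ltW.
  have h1 := near_mass_sum N C0 n1 pp0.
  have h2 := hk1 k' (leq_trans (leq_maxr 1 k1) (leq_addl _ _)).
  apply: (le_trans (ler_wpM2l (expR_ge0 _) h1)).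
  apply: (@le_trans _ _ (expR (k'%:R * al * L) * (C ^+ 2 * expR (2 * e1 * n%:R) * expR (- (k'%:R * be' * L))))).
    by rewrite ler_wpM2l ?expR_ge0 // ler_wpM2l // mulr_ge0 ?expR_ge0 ?exprn_ge0 // ltW.
  have -> : expR (k'%:R * al * L) * (C ^+ 2 * expR (2 * e1 * n%:R) * expR (- (k'%:R * be' * L)))
     = C ^+ 2 * q ^+ k'.
    rewrite /q -expRM_natl.
    have -> : k'%:R * (al * L + 2 * e1 * kk%:R - be' * L) =
      k'%:R * al * L + 2 * e1 * n%:R + - (k'%:R * be' * L) by rewrite /n natrM; ring.
    by rewrite !expRD; ring.
  rewrite ler_wpM2l ?exprn_ge0 ?(ltW C0) //.
  have /andP[q0 q1] := q01.
  by rewrite ler_wiXn2l ?(ltW q1) // leq_addr.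
have C20 : 0 <= C ^+ 2 by rewrite exprn_ge0 // ltW.
have F0 := geometric_bc C20 q01 mF PF.
have PG0 : 0 < fine (P (good_tail N)).
  by rewrite fine_gt0 // PN /= (le_lt_trans (probability_le1 P mG)) // ltry.
have [n0 Pn0] := lim_sup_tail mF F0 PG0.
pose B := \bigcup_(k in [set k | (n0 <= k)%N]) F k.
have mB : measurable B by exact: bigcup_measurable.
pose Gs := good_tail N `\` B.
have mGs : measurable Gs by exact: measurableD.
have PGs : (0 < P Gs)%E.
  rewrite lt_neqAle measure_ge0 andbT eq_sym; apply/negP => /eqP h0.
  have : (P (good_tail N) <= P (Gs `|` B))%E.
    rewrite le_measure ?inE //; first exact: measurableU.
    by move=> w Gw; have [?|?] := pselect (B w); [right|left].
  have h1 : (P (Gs `|` B) <= P Gs + P B)%E by exact: measureU2.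
  rewrite h0 add0e in h1 => /le_trans/(_ h1) h2.
  move: Pn0; rewrite ltNge => /negP; apply.
  by rewrite fine_le ?fin_num_measure.
apply: le_ereal_inf_tmp => _ [A [mA nuA] <-].
have mPA : measurable (Pi l @^-1` A).
  by rewrite -[_ @^-1` _]setTI; exact: (measurable_proj H X0 Ul).
apply: (@hausdorff_dim_ge R _ _ P (Pi l) Gs al (n0 + k2) al0 mGs PGs) => //.
move=> k w k0k [Gw nBw].
set n := (kk * k)%N; set u := trunc_word w n.
have kk2 : (k2 <= k)%N by rewrite (leq_trans _ k0k) // leq_addl.
exists [set w' : Omega m | good N (trunc_word w' n) &&
    (`|Pi l (pad_word u) - Pi l (pad_word (trunc_word w' n))| <= rho k)]; split.
- exact: (@measurable_trunc m n [set v | good N v &&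
    (`|Pi l (pad_word u) - Pi l (pad_word v)| <= rho k)]).
- move=> w' [Gw' _] hw /=; rewrite good_tail_word //=.
  have hd z : `|Pi l z - Pi l (pad_word (trunc_word z n))| <= 2^-1 ^+ k.
    have st : size (trunc_word z n) = n by rewrite size_trunc.
    rewrite (proj_word H X0 z n Ul) (proj_word H X0 (pad_word (trunc_word z n)) n Ul).
    have -> : trunc_word (pad_word (trunc_word z n)) n = trunc_word z n.
      by rewrite -{2}st trunc_pad_word.
    have := f_word_contr H (trunc_word z n) Ul
      (proj_in H X0 (iter n sft z) Ul)
      (proj_in H X0 (iter n sft (pad_word (trunc_word z n))) Ul).
    rewrite st => h; apply: (le_trans h).
    have [_ g10 g12 _] := tame_consts H; have g20 := lt_le_trans g10 g12.
    rewrite /n exprM; apply: lerXn2r; rewrite ?nnegrE ?exprn_ge0 ?invr_ge0 ?(ltW g20) //.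
    rewrite -[g2](lnK (_ : g2 \in Num.pos)) ?posrE // -expRM_natl.
    rewrite -[2^-1](lnK (_ : 2^-1 \in Num.pos)) ?posrE ?invr_gt0 // ler_expR lnV ?posrE //.
    lra.
  (* the factor 3: one 2 ^ -k for the distance of the two projections, and one for
     replacing each of the two points by its padded prefix *)
  have -> : rho k = 2^-1 ^+ k + 2^-1 ^+ k + 2^-1 ^+ k.
    have := powR_dyadic k 1; rewrite powRr1 ?exprn_ge0 ?invr_ge0 // mulr1 => ->.
    by rewrite /rho; ring.
  have -> : Pi l (pad_word u) - Pi l (pad_word (trunc_word w' n)) =
    - (Pi l w - Pi l (pad_word u)) - (Pi l w' - Pi l w) + (Pi l w' - Pi l (pad_word (trunc_word w' n))).
    by ring.
  rewrite (le_trans (ler_normD _ _)) // lerD ?hd //.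
  by rewrite (le_trans (ler_normB _ _)) // normrN lerD ?hd.
- rewrite powR_dyadic.
  have := @prob_trunc n (fun v => good N v && (`|Pi l (pad_word u) - Pi l (pad_word v)| <= rho k)).
  rewrite -/(near_mass N n (rho k) u) => hP.
  set S := [set w' | _] in hP *.
  have mS : measurable S.
    exact: (@measurable_trunc m n [set v | good N v &&
      (`|Pi l (pad_word u) - Pi l (pad_word v)| <= rho k)]).
  rewrite -[X in (X <= _)%E]fineK ?fin_num_measure // lee_fin hP.
  rewrite leNgt; apply/negP => hn; apply: nBw.
  exists (k - k2)%N => /=; first by rewrite leq_subRL // addnC.
  by rewrite /F /bad /= subnK // -/n good_tail_word.
Qed.

End fixed_parameter.

Lemma measure_hausdorff_dim_ge0 (nu : set R -> \bar R) :
  (0%:E <= measure_hausdorff_dim nu)%E.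
Proof.
apply: le_ereal_inf_tmp => _ [A _ <-].
by apply: le_ereal_inf_tmp => _ [s [s0 _] <-]; rewrite lee_fin.
Qed.

Variable P : R -> probability (Omega m) R.
Hypotheses (Pinv : forall l, U l -> shift_invariant (P l))
  (Perg : forall l, U l -> ergodic (P l)).
Local Notation dim_ratio l :=
  (entropy (P l) / \int[P l]_(w in setT) potential f g x0 l w).

(** With t0 = min (1, h/chi) at l0, the exponents al < be' < be < gam < kap < t0 are
    spaced at distances comparable to e: kap is below h/chi for all nearby l by
    continuity, gam defines good words, be is the exponent of the energy
    estimate, be' that of its almost sure version and al the resulting dimension.
    The comparison error e1 is then chosen small with respect to these gaps, and
    the neighbourhood so small that drift and comparison stay below e1. *)
Lemma dim_lower_local (e : R) :
  (exists2 eta : R, 0 < eta & forall l (u v : Omega m), U l ->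
    letter u 0 <> letter v 0 -> `|Pi l u - Pi l v| < eta ->
    eta <= `|derive1 (fun t => Pi t u - Pi t v) l|) ->
  (forall e, 0 < e -> exists (C xi : R), [/\ 0 < C, 0 < xi & forall u l,
    (1 <= size u)%N -> U l -> `|l - l0| < xi ->
    p0 u <= C * expR (e * (size u)%:R) * cylprob (P l) u /\
    cylprob (P l) u <= C * expR (e * (size u)%:R) * p0 u]) ->
  (forall e, 0 < e -> exists2 xi : R, 0 < xi & forall l, U l -> `|l - l0| < xi ->
     `|dim_ratio l - dim_ratio l0| < e) ->
  0 < e -> exists2 xi : R, 0 < xi &
  {ae @lebesgue_measure R, forall l, `|l - l0| < xi ->
     ((Num.min 1 (dim_ratio l) - e)%:E <=
        measure_hausdorff_dim (pushforward (P l) (Pi l)))%E}.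
Proof.
move=> T M0 cont e0.
have e80 : 0 < e / 8 by rewrite divr_gt0.
have [xi1 xi10 hxi1] := cont _ e80.
have [r0 [C0 [r00 C00 r0U sub]]] := transversal_sublevel H X0 Ul0 T.
set t0 := Num.min 1 (dim_ratio l0).
have near_t0 l : U l -> `|l - l0| < xi1 ->
    Num.min 1 (dim_ratio l) <= t0 + e / 8 /\ t0 - e / 8 <= dim_ratio l.
  move=> Ul /(hxi1 _ Ul); rewrite ltr_norml => /andP[h1 h2].
  have m1 : t0 <= dim_ratio l0 by rewrite /t0 ge_min lexx orbT.
  have m2 : Num.min 1 (dim_ratio l) <= 1 by rewrite ge_min lexx.
  have m3 : Num.min 1 (dim_ratio l) <= dim_ratio l by rewrite ge_min lexx orbT.
  split; last by lra.
  rewrite /t0 [in leRHS]/Num.min; case: ifP => _; lra.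
have t01 : t0 <= 1 by rewrite /t0 ge_min lexx.
(* if t0 is at most e / 2 the bound to prove is negative; otherwise al > 0 *)
have [t0e|t0e] := leP t0 (e / 2).
  exists (Num.min r0 xi1); first by rewrite lt_min r00.
  apply: aeW => l; rewrite lt_min => /andP[lr lxi].
  have [h _] := near_t0 l (r0U _ lr) lxi.
  apply: le_trans (measure_hausdorff_dim_ge0 _); rewrite lee_fin; lra.
pose cg := - ln g2; have cg0 : 0 < cg by exact: contraction_rate_gt0 H.
have L0 : 0 < L by rewrite ln_gt0 // ltr1n.
pose kap := t0 - e / 8; pose gam := t0 - 2 * (e / 8).
pose be := t0 - 3 * (e / 8); pose al := t0 - e / 2.
pose be' := (al + be) / 2.
have al0 : 0 < al by rewrite /al; lra.
have gam0 : 0 <= gam by rewrite /gam; lra.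
(* kk letters contract by at least 1/2: words of order k have length kk k *)
pose kk := (Num.truncn (L / cg)).+1.
have kk0 : 0 < kk%:R :> R by rewrite ltr0n.
have hkk : L <= kk%:R * cg.
  by rewrite -ler_pdivrMr // ltW // truncnS_gt.
have g1p : 0 < 1 + gam by lra.
pose e1 := Num.min (e / 8 * cg / (4 * (1 + gam))) (e / 16 * L / (4 * kk%:R)).
have e10 : 0 < e1.
  rewrite lt_min !divr_gt0 ?mulr_gt0 //; lra.
have e1a : e1 * (4 * (1 + gam)) <= e / 8 * cg.
  by rewrite -ler_pdivlMr ?mulr_gt0 // ge_min lexx.
have e1b : e1 * (4 * kk%:R) <= e / 16 * L.
  by rewrite -ler_pdivlMr ?mulr_gt0 // ge_min lexx orbT.
have [C [xi2 [Cp xi20 hM0]]] := M0 e1 e10.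
have dr0 := drift_ge0 H.
have dr1 : 0 < dr + 1 by rewrite ltr_wpDl.
pose r := Num.min (Num.min r0 (e1 / (dr + 1))) (Num.min xi1 xi2).
have rp : 0 < r by rewrite !lt_min r00 xi10 xi20 divr_gt0.
have rr0 : r <= r0 by rewrite !ge_min lexx.
have rr1 : r <= xi1 by rewrite !ge_min lexx !orbT.
have rr2 : r <= xi2 by rewrite !ge_min lexx !orbT.
have hdr : dr * r <= e1.
  have h : r <= e1 / (dr + 1) by rewrite !ge_min lexx orbT.
  apply: (le_trans (ler_wpM2l dr0 h)).
  by rewrite mulrA ler_pdivrMr // mulrDr mulr1 mulrC lerDl ltW.
exists r => //.
have be01 : 0 <= be <= 1 by apply/andP; split; rewrite /be; lra.
have be'be : be' < be by rewrite /be' /al /be; lra.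
have begam : be <= gam by rewrite /be /gam; lra.
have ecg : 0 < e * cg by rewrite mulr_gt0.
have hdr2 : be * (dr * r) <= (gam - be) * - ln g2.
  have /andP[be0 be1] := be01.
  have : be * (dr * r) <= 1 * e1 by rewrite ler_pM // mulr_ge0 // ltW.
  have h3 : 0 <= e1 * gam by rewrite mulr_ge0 // ltW.
  have -> : (gam - be) * - ln g2 = e / 8 * cg by rewrite /gam /be /cg; ring.
  lra.
have : {ae @lebesgue_measure R, forall l N, exists k1, forall k, (k1 <= k)%N ->
   close_pair_mass f g x0 l0 P0 r gam N kk k l <= expR (- (k%:R * be' * L))}.
  apply: ae_foralln => N.
  exact: (close_pair_mass_small H X0 Ul0 P0 C00 r0U sub rp rr0 N be01 be'be begam hdr2 hkk).
apply: (@filterS _ _ (ae_filter_ringOfSetsType (@lebesgue_measure R))) => l hW lr.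
have Ul := r0U l (lt_le_trans lr rr0).
have [near1 near2] := near_t0 l Ul (lt_le_trans lr rr1).
have hM u : (1 <= size u)%N -> _ := fun h => hM0 u l h Ul (lt_le_trans lr rr2).
have chi0 := lt_le_trans cg0 (lyapunov_ge H X0 (P l) Ul).
apply: (@le_trans _ _ al%:E); first by rewrite lee_fin /al; lra.
apply: (@local_dim l (P l) Ul gam r lr e1 C al be' kk) => //.
- have -> : (be' - al) * L = e / 16 * L by rewrite /be' /be /al; field.
  have : 0 < e * L by rewrite mulr_gt0.
  have := e1b; set q := e1 * _; have -> : 2 * e1 * kk%:R = q / 2 by rewrite /q; field.
  lra.
- by move=> u /hM[].
- apply: (@good_word_ae l (P l) Ul (Pinv Ul) (Perg Ul) e1 C gam kap) => //.
  + by apply/andP; split; rewrite // /gam /kap; lra.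
  + by move=> u /hM[].
  + by apply: le_trans hdr; rewrite ler_wpM2l // ltW.
  + by rewrite -ler_pdivlMr // /kap.
  + have -> : (kap - gam) * - ln g2 = e / 8 * cg by rewrite /kap /gam /cg; ring.
    have := e1a; set q := e1 * _; have -> : 2 * e1 * (1 + gam) = q / 2 by rewrite /q; field.
    lra.
Qed.

End lower_bound.

(** * Finite measures and the equality almost everywhere *)

Section normalisation.
Context {R : realType} {m : nat} (mu : {finite_measure set (Omega m) -> \bar R}).
Hypothesis mu0 : mu setT <> 0%E.

Definition mass : R := fine (mu setT).

Lemma massE : mu setT = mass%:E.
Proof. by rewrite fineK // fin_num_measure. Qed.

Lemma mass_gt0 : 0 < mass.
Proof.
rewrite -lte_fin -massE lt_neqAle measure_ge0 andbT eq_sym; apply/negP => /eqP.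
exact: mu0.
Qed.

Definition normalized : probability (Omega m) R := mnormalize mu (dirac (point : Omega m)).

Lemma normalizedE A : normalized A = (mu A * (mass^-1)%:E)%E.
Proof.
rewrite [LHS]/(mnormalize mu _ A) /mnormalize ifF; first by rewrite -/mass.
apply/negP => /orP[/eqP h|/eqP h]; first exact: mu0 h.
by have h' : mu setT = +oo%E := h; rewrite massE in h'.
Qed.

Lemma mu_normalized A : mu A = (normalized A * mass%:E)%E.
Proof.
rewrite normalizedE -muleA -EFinM mulVf ?mule1 // gt_eqF //; exact: mass_gt0.
Qed.

Lemma fine_mu A : fine (mu A) = mass * fine (normalized A).
Proof.
rewrite mu_normalized; case: (normalized A) => [r||] /=.
- by rewrite mulrC.
- by rewrite mulyr gtr0_sg ?mass_gt0 // mul1e mulr0.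
- by rewrite mulNyr gtr0_sg ?mass_gt0 // mul1e mulr0.
Qed.

Lemma normalized_eq0 A : normalized A = 0%E <-> mu A = 0%E.
Proof.
split=> h; last by rewrite normalizedE h mul0e.
by rewrite mu_normalized h mul0e.
Qed.

Lemma normalized_invariant : shift_invariant mu -> shift_invariant normalized.
Proof. by move=> h B mB; rewrite !normalizedE h. Qed.

Lemma normalized_ergodic : ergodic mu -> ergodic normalized.
Proof. by move=> h B mB /(h B mB) [] ?; [left|right]; apply/normalized_eq0. Qed.

(** The entropy functional of mu is not homogeneous: each word also contributes
    its mass times ln mass, but divided by n this disappears in the limit. *)
Lemma normalized_entropy : shift_invariant mu -> ergodic mu ->
  entropy mu = mass * entropy normalized.
Proof.
move=> inv erg.
have [h [_ cvh _ _]] := entropy_exists (normalized_invariant inv) (normalized_ergodic erg).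
rewrite (entropyE cvh) /entropy.
have -> : (fun n => n%:R^-1 * \sum_(u : n.-tuple 'I_m.+1)
       fine (mu (cylinder u)) * ln (fine (mu (cylinder u)))) =
   (fun n => - (mass * (block_entropy normalized n / n%:R)) + mass * ln mass * n%:R^-1).
  apply/funext => n; rewrite /block_entropy word_sumE.
  have one : \sum_(t : n.-tuple 'I_m.+1) cylprob normalized t = 1.
    by rewrite -(@word_sumE _ _ n (cylprob normalized)) word_sum_cylprob.
  have -> : \sum_(u : n.-tuple 'I_m.+1)
      fine (mu (cylinder u)) * ln (fine (mu (cylinder u))) =
    mass * ln mass - mass * \sum_(t : n.-tuple 'I_m.+1) cylprob normalized t * - ln (cylprob normalized t).
    rewrite -{1}[mass * ln mass]mulr1 -one !mulr_sumr -sumrB; apply: eq_bigr => u _.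
    rewrite fine_mu -/(cylprob normalized u); have := cylprob_ge0 normalized u.
    rewrite le_eqVlt => /predU1P[<-|p0]; first by rewrite !mulr0 !mul0r mulr0 subr0.
    by rewrite lnM ?posrE ?mass_gt0 //; ring.
  by ring.
rewrite -[RHS]opprK; congr (- _); apply: cvg_lim => //.
rewrite -[X in _ --> X]addr0; apply: cvgD.
  by apply: cvgN; apply: cvgMr.
rewrite -[X in _ --> X](mulr0 (mass * ln mass)); apply: cvgMr.
rewrite -(cvg_shiftS (fun n => n%:R^-1 : R)).
exact: cvg_harmonic.
Qed.

Lemma normalized_integral (phi : Omega m -> R) : measurable_fun setT phi ->
  (forall w, 0 <= phi w) ->
  \int[mu]_(w in setT) phi w = mass * \int[normalized]_(w in setT) phi w.
Proof.
move=> mphi phi0.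
have m0 : 0 <= mass by rewrite ltW // mass_gt0.
have h : (\int[mu]_(w in setT) (phi w)%:E = mass%:E * \int[normalized]_(w in setT) (phi w)%:E)%E.
  have := @ge0_integral_mscale _ _ R normalized setT measurableT (NngNum m0) (EFin \o phi).
  rewrite /= => <- //; last 2 first.
  - exact/measurable_EFinP.
  - by move=> w _; rewrite lee_fin.
  apply: eq_measure_integral => A mA _.
  by rewrite /mscale /= mu_normalized muleC.
rewrite /Rintegral h; case: (integral _ _ _) => [r||] //=.
- by rewrite mulry gtr0_sg ?mass_gt0 // mul1e mulr0.
- by rewrite mulrNy gtr0_sg ?mass_gt0 // mul1e mulr0.
Qed.

Lemma normalized_dim (Pi : Omega m -> R) :
  measure_hausdorff_dim (pushforward mu Pi) = measure_hausdorff_dim (pushforward normalized Pi).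
Proof.
rewrite /measure_hausdorff_dim /pushforward; congr (ereal_inf (_ @` _)).
by apply/seteqP; split => A [mA /normalized_eq0 h]; split.
Qed.

(** The one-letter cylinders partition the space; this is how a comparison that is
    only assumed for words of positive length extends to the total masses. *)
Lemma mass_cylinders : mass = word_sum 1 (fun u => fine (mu (cylinder u))).
Proof.
rewrite -[LHS]mulr1 -(word_sum_cylprob normalized 1) -word_sumZ; apply: eq_word_sum => u _.
by rewrite fine_mu.
Qed.

End normalisation.

Section subexponential.
Context {R : realType} {m : nat} (mu nu : {finite_measure set (Omega m) -> \bar R}).
Hypotheses (mu0 : mu setT <> 0%E) (nu0 : nu setT <> 0%E).

Lemma normalized_compare (C e : R) : 0 < C -> (forall u : seq 'I_m.+1, (1 <= size u)%N ->
    (mu (cylinder u) <= (C * expR (e * (size u)%:R))%:E * nu (cylinder u))%E) ->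
  (forall u : seq 'I_m.+1, (1 <= size u)%N ->
    (nu (cylinder u) <= (C * expR (e * (size u)%:R))%:E * mu (cylinder u))%E) ->
  forall u, (1 <= size u)%N ->
  cylprob (normalized mu) u <= C ^+ 2 * expR e * expR (e * (size u)%:R) * cylprob (normalized nu) u.
Proof.
move=> C0 h1 h2.
have mc u : measurable (cylinder u : set (Omega m)) by exact: measurable_cylinder.
have toR (m1 m2 : {finite_measure set (Omega m) -> \bar R}) (k : R) u :
    (m1 (cylinder u) <= k%:E * m2 (cylinder u))%E ->
    fine (m1 (cylinder u)) <= k * fine (m2 (cylinder u)).
  move=> h; rewrite -lee_fin EFinM !fineK ?fin_num_measure //.
have hmass : mass nu <= C * expR e * mass mu.
  rewrite !mass_cylinders // -word_sumZ; apply: ler_word_sum => u su.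
  by have := toR _ _ _ _ (h2 u _); rewrite su mulr1; apply.
move=> u su; have := toR _ _ _ _ (h1 u su).
rewrite (fine_mu mu0) (fine_mu nu0) -/(cylprob (normalized mu) u) -/(cylprob (normalized nu) u) => h.
have M0 := mass_gt0 mu0; rewrite -(ler_pM2l M0) (le_trans h) //.
have -> : mass mu * (C ^+ 2 * expR e * expR (e * (size u)%:R) * cylprob (normalized nu) u) =
  (C * expR e * mass mu) * (C * expR (e * (size u)%:R) * cylprob (normalized nu) u) by ring.
have -> : C * expR (e * (size u)%:R) * (mass nu * cylprob (normalized nu) u) =
  mass nu * (C * expR (e * (size u)%:R) * cylprob (normalized nu) u) by ring.
by rewrite ler_wpM2r // mulr_ge0 ?cylprob_ge0 // mulr_ge0 ?expR_ge0 // ltW.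
Qed.

End subexponential.

(** Lindeloef: countably many intervals with rational end points suffice. *)
Lemma ae_of_local (R : realType) (U : set R) (Q : R -> Prop) :
  (forall l0, U l0 -> exists2 xi : R, 0 < xi &
     {ae @lebesgue_measure R, forall l, U l -> `|l - l0| < xi -> Q l}) ->
  {ae @lebesgue_measure R, forall l, U l -> Q l}.
Proof.
move=> loc.
pose J (pq : rat * rat) : set R := `]ratr pq.1, ratr pq.2[%classic.
pose neg (A : set R) := (@lebesgue_measure R).-negligible A.
pose B i : set R := if unpickle i is Some pq then
  if pselect (neg (J pq `&` (U `&` ~` Q))) then J pq `&` (U `&` ~` Q) else set0
  else set0.
have negB i : neg (B i).
  rewrite /B; case: unpickle => [pq|]; last exact: negligible_set0.
  by case: pselect => [h|h] /=; [exact: h|exact: negligible_set0].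
have negU : neg (\bigcup_i B i) by exact: negligible_bigcup.
apply: negligibleS negU => l /= /not_implyP[Ul nQ].
have [xi xi0 hxi] := loc l Ul.
have [p pI] := @rat_in_itvoo R (l - xi) l (ltac:(lra)).
have [q qI] := @rat_in_itvoo R l (l + xi) (ltac:(lra)).
move: pI qI; rewrite !in_itv /= => /andP[p1 p2] /andP[q1 q2].
have [i iE] : exists i, unpickle i = Some (p, q).
  by exists (pickle (p, q)); exact: pickleK.
exists i => //; rewrite /B iE.
case: pselect => [h|] /=; first by split => //; rewrite /J /= in_itv /= p2 q1.
case; apply: negligibleS hxi => z /= [+ [Uz nQz]]; rewrite /J /= in_itv /= => /andP[z1 z2].
move=> h; apply: nQz; apply: h => //; rewrite ltr_norml; apply/andP; split; lra.
Qed.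

Theorem theorem3p1 (R : realType) (m : nat) (delta : R)
  (a b x0 c d : R) (X U : set R)
  (f : R -> 'I_m.+1 -> R -> R)
  (mu : R -> {finite_measure set (Omega m) -> \bar R})
  (hdelta : 0 < delta <= 1)
  (hX : X = `[a, b]%classic) (hdiam : diam X = 1%:E) (hx0 : X x0)
  (hU : U = `]c, d[%classic) (hcd : c < d)
  (hf : is_ifs f X U)
  (hA1 : assumption_A1 f X U delta)
  (hA2 : assumption_A2 f X U delta)
  (hA3 : assumption_A3 f X U delta)
  (hA4 : assumption_A4 f X U)
  (hT : transversality f x0 U)
  (hmu0 : forall l, closure U l -> mu l setT <> 0%E)
  (hmuI : forall l, closure U l -> shift_invariant (mu l))
  (hmuE : forall l, closure U l -> ergodic (mu l))
  (hM0 : condition_M0 U (fun l => mu l))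
  (hent : {within closure U, continuous (fun l => entropy (mu l))})
  (hlyap : {within closure U, continuous (fun l => lyapunov f X x0 l (mu l))}) :
  {ae @lebesgue_measure R, forall l, U l ->
    measure_hausdorff_dim
      (pushforward (mu l) (natural_projection f x0 l)) =
    (Num.min 1 (entropy (mu l) / lyapunov f X x0 l (mu l)))%:E}.
Proof.
have [K [g1 [g2 H]]] :=
  tame_of_assumptions hdelta hX hdiam hx0 hU hcd hf hA1 hA2 hA3 hA4.
have X0 : a <= x0 <= b by move: hx0; rewrite hX /= in_itv.
have UE l : U l = (c < l < d) by rewrite hU /= in_itv.
have Ucl l : U l -> closure U l by exact: subset_closure.
pose P l := normalized (mu l).
pose phi l := potential f (d_x f X) x0 l.
pose s l := entropy (P l) / \int[P l]_(w in setT) phi l w.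
have mphi l : U l -> measurable_fun setT (phi l).
  by rewrite UE => Ul; exact: (measurable_potential H X0 Ul).
have lyap l : U l ->
    lyapunov f X x0 l (mu l) = mass (mu l) * \int[P l]_(w in setT) phi l w.
  move=> Ul; have Ul' := Ul; rewrite UE in Ul'.
  rewrite -(normalized_integral (hmu0 _ (Ucl _ Ul)) (mphi l Ul)); last first.
    by move=> w; have /andP[+ _] := potential_bd H X0 w Ul'; apply: le_trans; rewrite ltW // (contraction_rate_gt0 H).
  have bd w : `|- phi l w| <= - ln g1.
    by rewrite normrN; exact: (potential_abs H X0 w Ul').
  have mN : measurable_fun setT (fun w => - phi l w).
    by apply: measurableT_comp => //; exact: mphi.
  have iN : (mu l).-integrable setT (EFin \o (fun w => - phi l w)).
    apply: measurable_bounded_integrable => //.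
      by rewrite -ge0_fin_numE // fin_num_measure.
    exists (- ln g1); split; first by rewrite num_real.
    by move=> M hM w _ /=; rewrite (le_trans (bd w)) // ltW.
  rewrite /lyapunov -mulN1r -RintegralZl //.
  - by apply: eq_Rintegral => w _; rewrite mulN1r /phi /potential.
  - by move: iN; congr ((mu l).-integrable setT _); apply/funext => w /=; rewrite /phi /potential opprK.
have Pinv l : c < l < d -> shift_invariant (P l).
  by rewrite -UE => Ul; apply: normalized_invariant; [exact: hmu0 _ (Ucl _ Ul)|exact: hmuI _ (Ucl _ Ul)].
have Perg l : c < l < d -> ergodic (P l).
  by rewrite -UE => Ul; apply: normalized_ergodic; [exact: hmu0 _ (Ucl _ Ul)|exact: hmuE _ (Ucl _ Ul)].
have ratio l : U l -> entropy (mu l) / lyapunov f X x0 l (mu l) = s l.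
  move=> Ul; rewrite lyap // normalized_entropy; [|exact: hmu0 _ (Ucl _ Ul)|exact: hmuI _ (Ucl _ Ul)|exact: hmuE _ (Ucl _ Ul)].
  by rewrite -mulf_div divff ?mul1r // gt_eqF // mass_gt0 //; exact: hmu0 _ (Ucl _ Ul).
have chi0 l : U l -> 0 < \int[P l]_(w in setT) phi l w.
  by rewrite UE => Ul; apply: lt_le_trans (lyapunov_ge H X0 (P l) Ul); exact: contraction_rate_gt0 H.
have cont l0 : U l0 -> forall e, 0 < e -> exists2 xi : R, 0 < xi &
    forall l, c < l < d -> `|l - l0| < xi -> `|s l - s l0| < e.
  move=> Ul0 e e0.
  have /subspace_continuousP/(_ l0 (Ucl _ Ul0)) ce := hent.
  have /subspace_continuousP/(_ l0 (Ucl _ Ul0)) cl := hlyap.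
  have l00 : lyapunov f X x0 l0 (mu l0) != 0.
    by rewrite lyap // gt_eqF // mulr_gt0 ?chi0 // mass_gt0 //; exact: hmu0 _ (Ucl _ Ul0).
  have : entropy (mu l) / lyapunov f X x0 l (mu l) @[l --> within (closure U) (nbhs l0)]
      --> entropy (mu l0) / lyapunov f X x0 l0 (mu l0).
    by apply: cvgM; [exact: ce|apply: cvgV; [exact: l00|exact: cl]].
  move=> /cvgrPdist_lt /(_ e e0); rewrite near_withinE => -[xi xi0 hxi].
  exists xi => // l; rewrite -UE => Ul lxi.
  have := hxi l; rewrite /= distrC => /(_ lxi (Ucl _ Ul)).
  by rewrite distrC -(ratio l Ul) -(ratio l0 Ul0).
have hTc : exists2 eta : R, 0 < eta & forall l (u v : Omega m), c < l < d ->
    letter u 0 <> letter v 0 ->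
    `|natural_projection f x0 l u - natural_projection f x0 l v| < eta ->
    eta <= `|derive1 (fun t => natural_projection f x0 t u -
                                natural_projection f x0 t v) l|.
  by have [eta eta0 h] := hT; exists eta => // l u v; rewrite -UE; exact: h.
pose dim l := measure_hausdorff_dim (pushforward (mu l) (natural_projection f x0 l)).
have dimE l : U l -> dim l = measure_hausdorff_dim (pushforward (P l) (natural_projection f x0 l)).
  by move=> Ul; apply: normalized_dim; exact: hmu0 _ (Ucl _ Ul).
have low (k : nat) : {ae @lebesgue_measure R, forall l, U l ->
    ((Num.min 1 (s l) - k.+1%:R^-1)%:E <= dim l)%E}.
  apply: ae_of_local => l0 Ul0; have Ul0' := Ul0; rewrite UE in Ul0'.
  have M0 e : 0 < e -> exists (C xi : R), [/\ 0 < C, 0 < xi & forall u l,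
    (1 <= size u)%N -> c < l < d -> `|l - l0| < xi ->
    cylprob (P l0) u <= C * expR (e * (size u)%:R) * cylprob (P l) u /\
    cylprob (P l) u <= C * expR (e * (size u)%:R) * cylprob (P l0) u].
    move=> e0; have [C [xi [C0 xi0 h]]] := hM0 l0 e (Ucl _ Ul0) e0.
    exists (C ^+ 2 * expR e), xi; split => //.
      by rewrite mulr_gt0 ?exprn_gt0 ?expR_gt0.
    move=> u l su Ul lxi; rewrite -UE in Ul.
    have up v : (1 <= size v)%N ->
        (mu l (cylinder v) <= (C * expR (e * (size v)%:R))%:E * mu l0 (cylinder v))%E.
      by move=> sv; have [] := h v l sv (Ucl _ Ul) lxi.
    have dn v : (1 <= size v)%N ->
        (mu l0 (cylinder v) <= (C * expR (e * (size v)%:R))%:E * mu l (cylinder v))%E.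
      move=> sv; have [h1 _] := h v l sv (Ucl _ Ul) lxi.
      have k0 : 0 < C * expR (e * (size v)%:R) by rewrite mulr_gt0 // expR_gt0.
      have := lee_wpmul2l (_ : (0 <= (C * expR (e * (size v)%:R))%:E)%E) h1.
      rewrite lee_fin ltW // => /(_ isT); rewrite muleA -EFinM mulNr expRN.
      by rewrite -invfM divff ?mul1e // gt_eqF.
    by split; apply: normalized_compare => //; apply: hmu0; exact: Ucl.
  have e0 : 0 < k.+1%:R^-1 :> R by rewrite invr_gt0.
  have [xi xi0 hxi] := @dim_lower_local _ _ _ _ _ _ _ _ _ _ _ H _ X0 _ Ul0' (P l0) P
    Pinv Perg _ hTc M0 (cont l0 Ul0) e0.
  exists xi => //.
  apply: (@filterS _ _ (ae_filter_ringOfSetsType (@lebesgue_measure R))) hxi => l hl Ul lxi.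
  by rewrite dimE //; exact: hl.
have : {ae @lebesgue_measure R, forall l k, U l ->
    ((Num.min 1 (s l) - k.+1%:R^-1)%:E <= dim l)%E} by apply: ae_foralln.
apply: (@filterS _ _ (ae_filter_ringOfSetsType (@lebesgue_measure R))) => l hl Ul.
rewrite ratio //; apply/eqP; rewrite eq_le; apply/andP; split.
  rewrite -/(dim l) dimE //; have Ul' := Ul; rewrite UE in Ul'.
  exact: (dim_upper_bound H X0 (Pinv _ Ul') (Perg _ Ul') Ul').
apply/lee_addgt0Pr => e e0.
have [k hk] : exists k : nat, k.+1%:R^-1 < e.
  exists (Num.truncn e^-1).
  by rewrite -[ltRHS]invrK ltf_pV2 ?posrE ?invr_gt0 ?ltr0n // truncnS_gt.
have := hl k Ul; rewrite -/(dim l) => h.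
apply: (@le_trans _ _ ((Num.min 1 (s l) - k.+1%:R^-1)%:E + e%:E)%E).
  by rewrite -EFinD lee_fin -addrA lerDl addrC subr_ge0 ltW.
exact: leeD2r.
Qed.
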